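(* Let $g=\{g_R\}_{R\in\mathcal{D}\otimes\mathcal{D}}$ be a dyadic distribution and let $\pi_g(f):=\sum_{R\in\mathcal{D}\otimes\mathcal{D}} g_R\langle f\rangle_R h_R$. Then: (I) for all $0<p,q,r<\infty$ with $\frac1q=\frac1p+\frac1r$, \[\|\pi_g\|_{H_d^p(\mathbb{R}\otimes\mathbb{R})\to\dot H_d^q(\mathbb{R}\otimes\mathbb{R})}\simeq \|g\|_{\dot H_d^r(\mathbb{R}\otimes\mathbb{R})};\] (II) for all $0<p<\infty$, \[\|\pi_g\|_{H_d^p(\mathbb{R}\otimes\mathbb{R})\to\dot H_d^p(\mathbb{R}\otimes\mathbb{R})}\simeq \|g\|_{BMO_d(\mathbb{R}\otimes\mathbb{R})},\] where $\simeq$ means two-sided inequalities with constants depending only on the exponents (in particular independent of $g$; both sides may be infinite simultaneously).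
   Context: $\mathcal{D}$ is the set of dyadic intervals of $\mathbb{R}$ and $\mathcal{D}\otimes\mathcal{D}$ the set of dyadic rectangles $R=I\times J$, $I,J\in\mathcal{D}$. For a dyadic interval $I$, $h_I$ is the $L^2$-normalized Haar function of $I$, and $h_R:=h_I\otimes h_J$. A dyadic distribution is a family of real numbers $\{f_R\}_{R\in\mathcal{D}\otimes\mathcal{D}}$, written formally $f=\sum_R f_Rh_R$; its dyadic square function is $S_d(f)=(\sum_R f_R^2\chi_R/|R|)^{1/2}$. $\langle f\rangle_R=|R|^{-1}\int_R f$. The bi-parameter dyadic maximal function of $f\in L^1_{loc}(\mathbb{R}^2)$ is $M_d(f)(x)=\sup_{x\in R\in\mathcal{D}\otimes\mathcal{D}}|\langle f\rangle_R|$. $H_d^p(\mathbb{R}\otimes\mathbb{R})$ is the completion of the space of locally integrable $f$ with $\|f\|_{H^p_d}:=\|M_d f\|_{L^p(\mathbb{R}^2)}<\infty$. $\dot H_d^q(\mathbb{R}\otimes\mathbb{R})$ is the space of dyadic distributions $f$ with $\|f\|_{\dot H^q_d}:=\|S_d(f)\|_{L^q(\mathbb{R}^2)}<\infty$. $\pi_g(f)$ is the dyadic distribution with coefficients $g_R\langle f\rangle_R$, and the operator norm is the supremum of $\|\pi_g f\|_{\dot H^q_d}$ over locally integrable $f$ with $\|f\|_{H^p_d}\le 1$. $\|g\|_{BMO_d(\mathbb{R}\otimes\mathbb{R})}:=\sup_\Omega\big(|\Omega|^{-1}\sum_{R\in\mathcal{D}\otimes\mathcal{D},\,R\subseteq\Omega}g_R^2\big)^{1/2}$,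 the supremum over all open sets $\Omega\subset\mathbb{R}^2$ of finite positive measure. *)

(* Defs.v *)
From HB Require Import structures.
From mathcomp Require Import all_boot all_order all_algebra.
From mathcomp Require Import all_classical all_reals all_analysis.
Set Implicit Arguments. Unset Strict Implicit. Unset Printing Implicit Defensive.
Import Order.TTheory GRing.Theory Num.Theory.
Import numFieldNormedType.Exports.
Local Open Scope classical_set_scope.
Local Open Scope ring_scope.

Section Dyadic.
Variable R : realType.

(* A dyadic interval is coded by (k, m) : int * int and denotes
   [m 2^k, (m+1) 2^k).  Every dyadic interval of R arises exactly once. *)
Definition dint := (int * int)%type.
Definition dint_set (I : dint) : set R :=
  [set x | (I.2%:~R * (2%:R ^ I.1) <= x) && (x < (I.2 + 1)%:~R * (2%:R ^ I.1))].
Definition dint_len (I : dint) : R := 2%:R ^ I.1.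

Definition drect := (dint * dint)%type.
Definition drect_set (Q : drect) : set (R * R) :=
  [set x | dint_set Q.1 x.1 /\ dint_set Q.2 x.2].
Definition drect_area (Q : drect) : R := dint_len Q.1 * dint_len Q.2.

Definition leb2 := ((@lebesgue_measure R) \x (@lebesgue_measure R))%E.

Definition loc_integrable (f : R * R -> R) : Prop :=
  forall K : set (R * R), compact K -> leb2.-integrable K (EFin \o f).

Definition davg (f : R * R -> R) (Q : drect) : R :=
  (drect_area Q)^-1 * Rintegral leb2 (drect_set Q) f.

Definition Md (f : R * R -> R) (x : R * R) : \bar R :=
  ereal_sup [set (`|davg f Q|)%:E | Q in [set Q | drect_set Q x]].

Definition Hp_norm (p : R) (f : R * R -> R) : \bar R :=
  Lnorm leb2 p%:E (Md f).

Definition Sd (c : drect -> R) (x : R * R) : \bar R :=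
  ((\esum_(Q in [set Q | drect_set Q x]) ((c Q) ^+ 2 / drect_area Q)%:E)
     `^ (2%:R^-1))%E.

Definition Hdot_norm (q : R) (c : drect -> R) : \bar R :=
  Lnorm leb2 q%:E (Sd c).

(* pi_g f : the dyadic distribution with coefficients g_Q <f>_Q *)
Definition pi_g (g : drect -> R) (f : R * R -> R) : drect -> R :=
  fun Q => g Q * davg f Q.

Definition pi_opnorm (p q : R) (g : drect -> R) : \bar R :=
  ereal_sup [set Hdot_norm q (pi_g g f) |
             f in [set f | loc_integrable f /\ (Hp_norm p f <= 1)%E]].

Definition BMO_norm (g : drect -> R) : \bar R :=
  ereal_sup [set (((fine (leb2 Om))^-1)%:E *
                  \esum_(Q in [set Q | drect_set Q `<=` Om]) ((g Q) ^+ 2)%:E)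
                 `^ (2%:R^-1) |
             Om in [set Om : set (R * R) | open Om /\
                                     (0 < leb2 Om)%E /\ (leb2 Om < +oo)%E]]%E.

End Dyadic.

(* Main.v *)
Require Import Defs.
From HB Require Import structures.
From mathcomp Require Import all_boot all_order all_algebra.
From mathcomp Require Import all_classical all_reals all_analysis.
From mathcomp Require Import archimedean measurable_realfun ring lra zify.
Import Order.TTheory GRing.Theory Num.Theory.
Import numFieldNormedType.Exports HBNNSimple.
Local Open Scope ring_scope.
Set Implicit Arguments. Unset Strict Implicit. Unset Printing Implicit Defensive.

(** Both equivalences are first proved for finite families of rectangles in a finite
    product of dyadic trees, where [M] is the strong maximal operator and [S] the
    square function.

    Upper bounds. As [|<f>_R| <= M f] on [R], one has [S (pi_g f) <= S g * M f], and
    Hoelder gives (I). For (II), the Carleson embedding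
    [sum_R g_R^2 a_R <= K * sum_u max_(R containing u) a_R] follows by induction on the
    number of nonzero [a_R]. It contains the case [p = 2]; Hoelder reduces [p < 2] to it,
    and for [p > 2] one bounds [sum S (pi_g f)^p = sum S (pi_g f)^2 * phi] by the embedding
    and the boundedness of [M] on [phi].

    Lower bounds. For (II), test on the indicator of the union [Om] of a family maximizing
    the Carleson ratio if [p >= 2]. For small [p] its maximal function is too large, and one
    uses instead a twofold localization of its martingale differences, which is close to it
    in [L^2] and has a maximal function living on an enlargement of [Om]; Hoelder between
    the exponents [p], [2] and [4] then involves the upper bound for [p = 4].
    For (I), test on [H^(r / p)] with [H = (M (S g)^beta)^(1 / beta)] if [p > 1]. If
    [p <= 1], test on a signed sum over [k] of [2^(k r / p)] times localized indicators of
    [{H > 2^k}], the signs being chosen greedily so that the levels do not cancel in a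
    quadratic form; the rectangles on which the errors are large contribute little.

    Transfer. A finite function is placed on cells of the four quadrants of the plane and
    continued, in each variable, by a translate with the opposite sign, so that its averages
    over rectangles that are too large vanish. Infinite families of coefficients are
    reached by monotone convergence. For the upper bound in (II), the half-open cells are
    covered by open squares of four times their area. *)

(** In the finite model every quantity is a real number, so an estimate whose unknown (the Carleson
    constant, or the sum of [S ^ r]) reappears on the right to a power below 1 can be absorbed. No
    constant may depend on the depth [n], the number of rectangles or the cell size.

    For small [p] test functions need cancellation in both variables, and a cut-off by an indicator
    would destroy it. [localize] multiplies martingale differences by predictable sets, so that they
    remain martingale differences; this survives the second localization because the sets used there
    depend on the first variable only through the parent level. The price is closeness to the
    indicator in mean square only. Rectangles on which the error has a large average have a small
    union, and they carry a fraction of the quantity sought: by extremality of the Carleson ratio in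
    (II), by [bad_rect_sum] in (I).

    In (I) with [q <= 2] the power [q / 2] of the squared square function is bounded below by a
    linear expression with weight [(S * F) ^ (q - 2)]; this is what turns the question of
    cancellation into one about a quadratic form. *)

Section RealPowers.
Variable R : realType.
Implicit Types (a b t s : R).

Lemma young_powR t a b : 0 < t < 1 -> 0 <= a -> 0 <= b ->
  a `^ t * b `^ (1 - t) <= t * a + (1 - t) * b.
Proof.
move=> /andP[t0 t1] a0 b0.
have := @conjugate_powR R (a `^ t) (b `^ (1 - t)) t^-1 (1 - t)^-1.
have t10 : 0 < 1 - t by lra.
rewrite !powR_ge0 !invr_gt0 t0 t10 !invrK -!powRrM !mulfV ?gt_eqF// !powRr1//.
move=> /(_ isT isT isT isT); rewrite [a * t]mulrC [b * _]mulrC; apply; lra.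
Qed.

Lemma powR_mul_sum a s t : 0 < s -> 0 < t -> a `^ (s + t) = a `^ s * a `^ t.
Proof. by move=> s0 t0; rewrite powRD// gt_eqF// addr_gt0. Qed.

Lemma le_powRN a b s : 0 < a -> a <= b -> s <= 0 -> b `^ s <= a `^ s.
Proof.
move=> a0 ab s0; have b0 := lt_le_trans a0 ab.
rewrite -[s]opprK !(powRN _ (- s)) lef_pV2 ?posrE ?powR_gt0//.
by apply: ge0_ler_powR; rewrite ?nnegrE ?oppr_ge0// ltW.
Qed.

Lemma powR_powRVK a s : 0 <= a -> s != 0 -> (a `^ s) `^ s^-1 = a.
Proof. by move=> a0 s0; rewrite -powRrM mulfV// powRr1. Qed.

Lemma powRV_powRK a s : 0 <= a -> s != 0 -> (a `^ s^-1) `^ s = a.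
Proof. by move=> a0 s0; rewrite -powRrM mulVf// powRr1. Qed.

Lemma powRV a s : 0 <= a -> a^-1 `^ s = (a `^ s)^-1.
Proof. by move=> a0; rewrite -powR_inv1// -powRrM mulN1r powRN. Qed.

Lemma sqr_powR a s : 0 <= a -> (a ^+ 2) `^ s = a `^ (2 * s).
Proof. by move=> a0; rewrite powRrM powR_mulrn. Qed.

Lemma powR_sqr a s : 0 <= a -> (a `^ s) ^+ 2 = a `^ (2 * s).
Proof. by move=> a0; rewrite mulrC powRrM powR_mulrn// powR_ge0. Qed.

Lemma powR_interp (a b m t : R) : 0 < t < 1 -> 0 <= a -> 0 <= b -> 0 <= m ->
  (a * m) `^ t * (b * m) `^ (1 - t) = a `^ t * b `^ (1 - t) * m.
Proof.
move=> /andP[t0 t1] a0 b0 m0; rewrite !powRM// mulrACA; congr (_ * _).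
move: m0; rewrite le_eqVlt => /orP[/eqP<-|m0].
  by rewrite powR0 ?mul0r// gt_eqF.
rewrite -powRD ?(gt_eqF m0) ?implybT//.
by rewrite (addrC t) subrK powRr1 ?(ltW m0).
Qed.

(** Divide by [P ^ (1 - t)], which is legitimate because [P] is a real number and the case [P = 0]
    is trivial. This closes every self-referential estimate below. *)
Lemma powR_absorb (C P Q t : R) : 0 < t <= 1 -> 0 <= C -> 0 <= P -> 0 <= Q ->
  P <= C * (Q `^ t * P `^ (1 - t)) -> P <= C `^ t^-1 * Q.
Proof.
move=> /andP[t0 t1] C0 P0 Q0; rewrite le_eqVlt in P0; case/orP: P0 => [/eqP<- _|P0 h].
  by rewrite mulr_ge0// powR_ge0.
have h1 : P `^ t <= C * Q `^ t.
  rewrite -(ler_pM2r (powR_gt0 (1 - t) P0)) -mulrA -powRD ?(gt_eqF P0) ?implybT//.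
  by rewrite (addrC t) subrK powRr1 ?(ltW P0).
have := @ge0_ler_powR R t^-1.
rewrite invr_ge0 (ltW t0) => /(_ isT _ _ _ _ h1).
rewrite !nnegrE powR_ge0 mulr_ge0 ?powR_ge0// => /(_ isT isT).
by rewrite powRM ?powR_ge0// !powR_powRVK ?gt_eqF// ltW.
Qed.

Section Sums.
Variable X : finType.
Implicit Types f g : X -> R.

Lemma sum_holder t f g : 0 < t < 1 ->
  (forall x, 0 <= f x) -> (forall x, 0 <= g x) ->
  \sum_x f x `^ t * g x `^ (1 - t) <=
  (\sum_x f x) `^ t * (\sum_x g x) `^ (1 - t).
Proof.
move=> t01 f0 g0; have /andP[t0 t1] := t01; have t10 : 0 < 1 - t by lra.
have [F0|F0] := eqVneq (\sum_x f x) 0.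
  rewrite big1 ?mulr_ge0 ?powR_ge0// => x _.
  have /eqP := F0; rewrite psumr_eq0// => /allP/(_ x).
  by rewrite mem_index_enum => /(_ isT)/eqP->; rewrite powR0 ?gt_eqF// mul0r.
have [G0|G0] := eqVneq (\sum_x g x) 0.
  rewrite big1 ?mulr_ge0 ?powR_ge0// => x _.
  have /eqP := G0; rewrite psumr_eq0// => /allP/(_ x).
  by rewrite mem_index_enum => /(_ isT)/eqP->; rewrite [0 `^ _]powR0 ?gt_eqF// mulr0.
set F := \sum_x f x in F0 *; set G := \sum_x g x in G0 *.
have Fp : 0 < F by rewrite lt_def F0 sumr_ge0.
have Gp : 0 < G by rewrite lt_def G0 sumr_ge0.
have Fi := ltW Fp; have Gi := ltW Gp.
rewrite -[leRHS]mul1r -ler_pdivrMr ?mulr_gt0 ?powR_gt0// mulr_suml.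
have e1 : 1 = \sum_x (t * (f x / F) + (1 - t) * (g x / G)).
  by rewrite big_split -!mulr_sumr -!mulr_suml -/F -/G !mulfV//=; lra.
rewrite [leRHS]e1.
apply: ler_sum => x _.
apply: le_trans (young_powR _ _ _) => //; rewrite ?divr_ge0//.
rewrite !powRM ?invr_ge0// !powRV// invfM le_eqVlt; apply/orP; left; apply/eqP; ring.
Qed.

Lemma sum_cauchy f g :
  (\sum_x f x * g x) ^+ 2 <= (\sum_x f x ^+ 2) * (\sum_x g x ^+ 2).
Proof.
set a := \sum_x f x ^+ 2; set b := \sum_x f x * g x; set c := \sum_x g x ^+ 2.
have a0 : 0 <= a by apply: sumr_ge0 => x _; exact: sqr_ge0.
have key (s t : R) : 0 <= s ^+ 2 * a - 2 * s * t * b + t ^+ 2 * c.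
  have -> : s ^+ 2 * a - 2 * s * t * b + t ^+ 2 * c = \sum_x (s * f x - t * g x) ^+ 2.
    rewrite !mulr_sumr -sumrB -big_split /=; apply: eq_bigr => x _; ring.
  by apply: sumr_ge0 => x _; exact: sqr_ge0.
have [az|an] := eqVneq a 0.
  suff -> : b = 0 by rewrite expr0n /= az mul0r.
  apply: big1 => x _; move/eqP: az; rewrite psumr_eq0; last by move=> *; exact: sqr_ge0.
  by move/allP => /(_ x); rewrite mem_index_enum sqrf_eq0 => /(_ isT)/eqP->; rewrite mul0r.
have ap : 0 < a by rewrite lt_def an.
have := key b a; have -> : b ^+ 2 * a - 2 * b * a * b + a ^+ 2 * c = a * (a * c - b ^+ 2) by ring.
by rewrite pmulr_rge0// subr_ge0.
Qed.

End Sums.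
End RealPowers.

(** A sigma-algebra is given by a labelling [e]: its atoms are the fibres of [e], and the measure is
    the counting measure. *)
Definition cexp (R : realType) (X : finType) (L : eqType) (e : X -> L) (f : X -> R) (u : X) : R :=
  (\sum_(v | e v == e u) f v) / #|[pred v | e v == e u]|%:R.

Definition label_meas (X : finType) (L : eqType) (e : X -> L) (T : Type) (h : X -> T) :=
  forall u v, e u = e v -> h u = h v.

(** * Conditional expectations on a finite set *)

Section CondExp.
Variables (R : realType) (X : finType) (L : eqType) (e : X -> L).
Implicit Types (f g h : X -> R) (u v : X).
Notation E := (@cexp R X L e).

Lemma card_fiber_gt0 u : 0 < #|[pred v | e v == e u]|%:R :> R.
Proof. by rewrite ltr0n; apply/card_gt0P; exists u; rewrite inE. Qed.

Lemma eq_cexp f g u : (forall v, e v = e u -> f v = g v) -> E f u = E g u.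
Proof. by move=> fg; rewrite /cexp; congr (_ / _); apply: eq_bigr => v /eqP/fg. Qed.

Lemma cexp_label f : label_meas e (E f).
Proof. by move=> u v uv; rewrite /cexp uv. Qed.

Lemma cexp_ge0 f u : (forall v, 0 <= f v) -> 0 <= E f u.
Proof. by move=> f0; rewrite divr_ge0// sumr_ge0. Qed.

Lemma cexp_le f g u : (forall v, e v = e u -> f v <= g v) -> E f u <= E g u.
Proof.
move=> fg; rewrite ler_wpM2r ?invr_ge0//; apply: ler_sum => v /eqP; exact: fg.
Qed.

Lemma cexpMr f h u : label_meas e h -> E (fun v => f v * h v) u = E f u * h u.
Proof.
move=> hm; rewrite /cexp [RHS]mulrAC [in RHS]mulr_suml; congr (_ / _).
by apply: eq_bigr => v /eqP/hm->.
Qed.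

Lemma sum_fiber_cst (c : R) u :
  \sum_(v | e v == e u) c = c * #|[pred v | e v == e u]|%:R.
Proof. by rewrite sumr_const mulr_natr. Qed.

Lemma cexp_cst (c : R) u : E (fun=> c) u = c.
Proof. by rewrite /cexp sum_fiber_cst mulfK// gt_eqF// card_fiber_gt0. Qed.

Lemma cexp_id h u : label_meas e h -> E h u = h u.
Proof.
move=> hm; rewrite -[RHS]mul1r -[X in X * _](cexp_cst 1 u) -cexpMr//.
by apply: eq_cexp => v _; rewrite mul1r.
Qed.

Lemma cexpD f g u : E (fun v => f v + g v) u = E f u + E g u.
Proof. by rewrite /cexp big_split mulrDl. Qed.

Lemma cexpZ c f u : E (fun v => c * f v) u = c * E f u.
Proof. by rewrite /cexp -mulr_sumr mulrA. Qed.

Lemma cexpN f u : E (fun v => - f v) u = - E f u.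
Proof. by rewrite /cexp sumrN mulNr. Qed.

Lemma cexpB f g u : E (fun v => f v - g v) u = E f u - E g u.
Proof. by rewrite cexpD cexpN. Qed.

Lemma cexp_big (I : Type) (r : seq I) (P : pred I) (F : I -> X -> R) u :
  E (fun v => \sum_(i <- r | P i) F i v) u = \sum_(i <- r | P i) E (F i) u.
Proof. by rewrite /cexp exchange_big mulr_suml. Qed.

Lemma cexp_norm f u : `|E f u| <= E (fun v => `|f v|) u.
Proof.
rewrite normrM [X in _ * X]ger0_norm ?invr_ge0//.
by rewrite ler_wpM2r ?invr_ge0// ler_norm_sum.
Qed.

Lemma sum_cexp f : \sum_u E f u = \sum_u f u.
Proof.
rewrite /cexp; under eq_bigr do rewrite mulr_suml.
rewrite (exchange_big_dep predT)//=; apply: eq_bigr => v _.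
rewrite (eq_bigr (fun=> f v / #|[pred w | e w == e v]|%:R)); last by move=> u /eqP->.
rewrite sumr_const -[_ *+ _]mulr_natr -[X in _ * X%:R](_ : #|[pred w | e w == e v]| = _).
  by rewrite divfK// gt_eqF// card_fiber_gt0.
by apply: eq_card => u; rewrite !inE eq_sym.
Qed.

Lemma sum_cexpM f h : label_meas e h -> \sum_u E f u * h u = \sum_u f u * h u.
Proof. by move=> hm; under eq_bigr do rewrite -cexpMr//; rewrite sum_cexp. Qed.

Lemma cexp_cauchy f g u :
  (E (fun v => f v * g v) u) ^+ 2 <= E (fun v => f v ^+ 2) u * E (fun v => g v ^+ 2) u.
Proof.
rewrite /cexp exprMn [leRHS]mulrACA -expr2 ler_wpM2r ?sqr_ge0//.
rewrite !(big_mkcond (fun v => e v == e u))/=.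
have := @sum_cauchy R X (fun v => if e v == e u then f v else 0)
                        (fun v => if e v == e u then g v else 0).
congr (_ ^+ 2 <= _ * _); apply: eq_bigr => v _; case: ifP => _//;
  by rewrite ?mulr0 ?expr0n.
Qed.

(** Hoelder against the indicator of the fibre, whose mass [c] supplies the factor [c ^ (1 - t)]. *)
Lemma cexp_jensen t f u : 0 < t <= 1 -> (forall v, 0 <= f v) ->
  E (fun v => f v `^ t) u <= (E f u) `^ t.
Proof.
move=> /andP[t0]; rewrite le_eqVlt => /orP[/eqP-> f0|t1 f0].
  rewrite powRr1 ?cexp_ge0//; apply: cexp_le => v _; by rewrite powRr1.
have c0 := card_fiber_gt0 u.
rewrite /cexp powRM ?sumr_ge0 ?invr_ge0// powRV//.
set c := _%:R in c0 *; rewrite ler_pdivrMr// -mulrA.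
have -> : (c `^ t)^-1 * c = c `^ (1 - t).
  by rewrite mulrC -[X in X / _](powRr1 (ltW c0)) -powRB// gt_eqF ?implybT.
rewrite !(big_mkcond (fun v => e v == e u))/=.
have := @sum_holder R X t (fun v => if e v == e u then f v else 0)
          (fun v => if e v == e u then 1 else 0).
rewrite t0 t1 => /(_ isT); rewrite -!big_mkcond/= sum_fiber_cst mul1r -/c.
under eq_bigr => v _.
  have -> : (if e v == e u then f v else 0) `^ t * (if e v == e u then 1 else 0) `^ (1 - t) =
            if e v == e u then f v `^ t else 0.
    case: ifP => _; first by rewrite powR1 mulr1.
    by rewrite powR0 ?mul0r// gt_eqF.
  over.
rewrite -big_mkcond/= => Hx; apply: Hx => v; case: ifP => _ //; exact: ler01.
Qed.

End CondExp.

Section Tower.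
Variables (R : realType) (X : finType) (L L' : eqType) (e : X -> L) (e' : X -> L').
Hypothesis fine : forall u v, e' u = e' v -> e u = e v.
Implicit Types (f : X -> R).

Lemma cexp_fine_coarse f u : cexp e' (cexp e f) u = cexp e f u.
Proof. by apply: cexp_id => x y /fine; exact: cexp_label. Qed.

(** The indicator [h] of a coarse fibre is measurable for the finer labelling, so averaging at the
    finer level preserves the sum against it. *)
Lemma cexp_coarse_fine f u : cexp e (cexp e' f) u = cexp e f u.
Proof.
rewrite /cexp; congr (_ / _).
pose h v : R := (e v == e u)%:R.
have hm : label_meas e' h by move=> x y /fine xy; rewrite /h xy.
have P F : \sum_(v | e v == e u) F v = \sum_v F v * h v.
  by rewrite big_mkcond; apply: eq_bigr => v _; rewrite /h; case: ifP; rewrite ?mulr1 ?mulr0.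
by rewrite !P; exact: (sum_cexpM _ hm).
Qed.

End Tower.

(** * One filtration: Doob's inequality and localization *)

Section Filtration.
Variables (R : realType) (X : finType) (L : eqType) (e : nat -> X -> L).
Hypothesis nest : forall i u v, e i.+1 u = e i.+1 v -> e i u = e i v.
Implicit Types (f h : X -> R) (u v : X) (W : pred X).
Notation E i := (cexp (e i)).

Lemma nest_le i j u v : (i <= j)%N -> e j u = e j v -> e i u = e i v.
Proof. by elim: j => [|j IH]; [case: i|rewrite leq_eqVlt => /orP[/eqP->|/IH H /nest]]. Qed.

Lemma label_meas_le (T : Type) i j (h : X -> T) :
  (i <= j)%N -> label_meas (e i) h -> label_meas (e j) h.
Proof. by move=> ij hm u v /(nest_le ij)/hm. Qed.

Fixpoint runmax k f u : R :=
  if k is k'.+1 then Num.max (runmax k' f u) (E k f u) else E 0 f u.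

Lemma le_runmax i k f u : (i <= k)%N -> E i f u <= runmax k f u.
Proof.
elim: k => [|k IH] /=; first by rewrite leqn0 => /eqP->.
by rewrite leq_eqVlt => /orP[/eqP->|/IH H]; rewrite le_max ?lexx ?orbT// H.
Qed.

Lemma runmax_le k f u c : (forall i, (i <= k)%N -> E i f u <= c) -> runmax k f u <= c.
Proof.
elim: k => [|k IH] H /=; first exact: H.
by rewrite ge_max H// IH// => i /leqW/H.
Qed.

Lemma runmax_ge0 k f u : (forall v, 0 <= f v) -> 0 <= runmax k f u.
Proof. by move=> f0; apply: le_trans (le_runmax _ _ (leq0n k)); exact: cexp_ge0. Qed.

Lemma runmax_mono k f h u : (forall v, f v <= h v) -> runmax k f u <= runmax k h u.
Proof.
move=> fh; apply: runmax_le => i ik; apply: le_trans (le_runmax _ _ ik).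
by apply: cexp_le => v _.
Qed.

Lemma runmax_label k f : label_meas (e k) (runmax k f).
Proof.
elim: k => [|k IH] u v uv /=; first exact: cexp_label.
by congr Num.max; [exact: (label_meas_le (leqnSn k) IH)|exact: cexp_label].
Qed.

(** The increment form of Doob's inequality, to be summed over the levels. Only [m < a] has content,
    and there it is Young's inequality for [a * m ^ (s - 1)]. *)
Lemma doob_pointwise s (m a : R) : 1 < s -> 0 <= m -> 0 <= a ->
  Num.max m a `^ s - m `^ s <=
  s / (s - 1) * (a * Num.max m a `^ (s - 1) - a * m `^ (s - 1)).
Proof.
move=> s1 m0 a0; have s0 : 0 < s by lra.
case: (leP a m) => [am|ma]; first by rewrite !subrr mulr0.
have -> : a * a `^ (s - 1) = a `^ s by rewrite mulr_powRB1.
have := @young_powR _ s^-1 (a `^ s) (m `^ s).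
rewrite invr_gt0 s0 invf_lt1// s1 => /(_ isT); rewrite !powR_ge0 => /(_ isT isT).
rewrite powR_powRVK ?gt_eqF//.
rewrite -powRrM mulrBr mulr1 mulfV ?gt_eqF// => H.
have c0 : 0 < s / (s - 1) by rewrite divr_gt0// subr_gt0.
have := ler_wpM2l (ltW c0) H; rewrite mulrDr !mulrA.
have -> : s / (s - 1) * s^-1 = s / (s - 1) - 1 by field; rewrite !gt_eqF// subr_gt0.
have -> : s / (s - 1) * (1 - s^-1) = 1 by field; rewrite !gt_eqF// subr_gt0.
rewrite mul1r mulrBl mul1r mulrBr mulrA.
set A := a `^ s; set B := m `^ s; set C := m `^ (s - 1); set D := s / (s - 1).
lra.
Qed.

Lemma doob_sum s k f : 1 < s -> (forall v, 0 <= f v) ->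
  \sum_u runmax k f u `^ s <= s / (s - 1) * \sum_u f u * runmax k f u `^ (s - 1).
Proof.
move=> s1 f0; have s0 : 0 < s by lra.
have swap j h : label_meas (e j) h -> \sum_u E j f u * h u = \sum_u f u * h u.
  exact: sum_cexpM.
have pm j (a : R) : label_meas (e j) (fun u => runmax j f u `^ a).
  by move=> u v uv; rewrite (runmax_label _ uv).
rewrite -(swap k)//; elim: k => [|k IH].
  rewrite mulr_sumr; apply: ler_sum => u _ /=.
  rewrite mulr_powRB1 ?cexp_ge0//.
  by rewrite ler_peMl ?powR_ge0// ler_pdivlMr ?subr_gt0// mul1r lerBlDr lerDl.
have step : \sum_u (runmax k.+1 f u `^ s - runmax k f u `^ s) <=
    s / (s - 1) * \sum_u (E k.+1 f u * runmax k.+1 f u `^ (s - 1) -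
                          E k.+1 f u * runmax k f u `^ (s - 1)).
  rewrite mulr_sumr; apply: ler_sum => u _ /=.
  by apply: doob_pointwise; rewrite ?cexp_ge0 ?runmax_ge0.
(* [runmax k f] is measurable at level [k], so the average at level [k.+1] may be replaced by the
   one at level [k]; the increments then telescope. *)
have sw : \sum_u E k.+1 f u * runmax k f u `^ (s - 1) = \sum_u E k f u * runmax k f u `^ (s - 1).
  by rewrite (swap k) // (swap k.+1 (fun u => runmax k f u `^ (s - 1)))//; exact: label_meas_le (pm k _).
move: step IH; rewrite !sumrB sw mulrBr.
set a := \sum_u runmax k.+1 _ _ `^ _; set b := \sum_u runmax k _ _ `^ _.
set x := _ * _; set y := _ * _ => h1 h2; rewrite -/x; lra.
Qed.

Lemma doob s k f : 1 < s -> (forall v, 0 <= f v) ->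
  \sum_u runmax k f u `^ s <= (s / (s - 1)) `^ s * \sum_u f u `^ s.
Proof.
move=> s1 f0; have s0 : 0 < s by lra.
have c0 : 0 <= s / (s - 1) by apply: divr_ge0; lra.
have absorb := @powR_absorb R (s / (s - 1)) (\sum_u runmax k f u `^ s) (\sum_u f u `^ s) s^-1.
rewrite invrK in absorb; apply: absorb => //.
- by rewrite invr_gt0 s0 invf_le1 ?ltW.
- by apply: sumr_ge0 => u _; exact: powR_ge0.
- by apply: sumr_ge0 => u _; exact: powR_ge0.
apply: le_trans (doob_sum k s1 f0) _; rewrite ler_wpM2l//.
apply: le_trans (sum_holder _ _ _); last first.
- by move=> u; exact: powR_ge0.
- by move=> u; exact: powR_ge0.
- by rewrite invr_gt0 s0 invf_lt1.
apply: ler_sum => u _; rewrite powR_powRVK ?gt_eqF//.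
by rewrite -powRrM mulrBr mulr1 mulfV ?gt_eqF.
Qed.

Lemma sum_sqr_orth m (t : nat -> X -> R) :
  (forall j, label_meas (e j) (t j)) -> (forall j u, E j (t j.+1) u = 0) ->
  \sum_u (\sum_(j < m) t j u) ^+ 2 = \sum_(j < m) \sum_u t j u ^+ 2.
Proof.
move=> tm t0; elim: m => [|m IH].
  by rewrite big_ord0 big1// => u _; rewrite big_ord0 expr0n.
rewrite big_ord_recr /= -IH -big_split /=.
have cross : \sum_u (\sum_(j < m) t j u) * t m u = 0.
  case: m {IH} => [|m]; first by rewrite big1// => u _; rewrite big_ord0 mul0r.
  under eq_bigr do rewrite mulrC.
  rewrite -(@sum_cexpM _ _ _ (e m)); first by rewrite big1// => u _; rewrite t0 mul0r.
  move=> u v uv; apply: eq_bigr => j _; apply: (label_meas_le _ (tm j)) uv.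
  by rewrite -ltnS.
rewrite -[RHS]addr0; transitivity (\sum_u ((\sum_(j < m) t j u) ^+ 2 + t m u ^+ 2) +
    2 * \sum_u (\sum_(j < m) t j u) * t m u); last by rewrite cross mulr0.
rewrite mulr_sumr -big_split/=.
by apply: eq_bigr => u _; rewrite big_ord_recr /=; ring.
Qed.

Definition inside W j u := [forall v, (e j v == e j u) ==> W v].

Lemma insideP W j u : reflect (forall v, e j v = e j u -> W v) (inside W j u).
Proof.
by apply: (iffP forallP) => H v; [move/eqP; exact: implyP|apply/implyP => /eqP/H].
Qed.

Lemma inside_label W j : label_meas (e j) (inside W j).
Proof. by move=> u v uv; rewrite /inside uv. Qed.

Lemma inside_le W i j u : (i <= j)%N -> inside W i u -> inside W j u.
Proof. by move=> ij /insideP H; apply/insideP => v /(nest_le ij)/H. Qed.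

Lemma inside_self W j u : inside W j u -> W u.
Proof. by move/insideP; exact. Qed.

Definition mdiff j f u : R := if j is j'.+1 then E j f u - E j' f u else E 0 f u.

Lemma sum_mdiff f m u : \sum_(j < m.+1) mdiff j f u = E m f u.
Proof.
elim: m => [|m IH]; first by rewrite big_ord1.
by rewrite big_ord_recr IH /= addrC subrK.
Qed.

Lemma mdiff_label j f : label_meas (e j) (mdiff j f).
Proof.
case: j => [|j] u v uv /=; first exact: cexp_label.
by congr (_ - _); [|apply: (label_meas_le (leqnSn j))]; first exact: cexp_label;
  first exact: cexp_label.
Qed.

Lemma cexp_mdiff j f u : E j (mdiff j.+1 f) u = 0.
Proof.
by rewrite /= cexpB cexp_coarse_fine ?cexp_fine_coarse ?subrr// => ? ? /nest.
Qed.

Variable n : nat.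
Hypothesis fine : injective (e n).
Hypothesis dbl : forall i u,
  (#|[pred v | e i v == e i u]| <= 2 * #|[pred v | e i.+1 v == e i.+1 u]|)%N.

Lemma cexp_finest f u : E n f u = f u.
Proof. by apply: cexp_id => x y /fine->. Qed.

(** The indicator is measurable one level below the difference, which keeps the conditional mean of
    the product zero. For [j = 0] the predecessor is again [0]: the coarsest average is kept on the
    coarsest atoms contained in [W]. *)
Definition locterm W f j u : R := (inside W j.-1 u)%:R * mdiff j f u.

(* The parts of the martingale differences of [f] whose parent atom lies in [W]:
   unlike those of the product of [f] with an indicator, the averages of their
   sum all vanish off [W]. *)
Definition localize W f u : R := \sum_(j < n.+1) locterm W f j u.

Lemma locterm_label W f j : label_meas (e j) (locterm W f j).
Proof.
move=> u v uv; rewrite /locterm (mdiff_label _ uv).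
by rewrite (label_meas_le (leq_pred j) (@inside_label W j.-1) uv).
Qed.

Lemma cexp_locterm W f j u : E j (locterm W f j.+1) u = 0.
Proof.
rewrite /locterm (eq_cexp (g := fun v => mdiff j.+1 f v * (inside W j v)%:R)); last first.
  by move=> v _; rewrite mulrC.
by rewrite cexpMr ?cexp_mdiff ?mul0r// => x y xy; rewrite (inside_label _ xy).
Qed.

Lemma cexp_locterm_le W f j k u : E k (locterm W f j) u =
  if (j <= k)%N then locterm W f j u else 0.
Proof.
case: leqP => jk; first by apply: cexp_id; exact: label_meas_le (@locterm_label W f j).
case: j jk => // j; rewrite ltnS => kj.
rewrite -(@cexp_coarse_fine _ _ _ _ (e k) (e j)); last by move=> x y; exact: nest_le.
rewrite (eq_cexp (g := fun=> 0)) ?cexp_cst// => v _; exact: cexp_locterm.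
Qed.

Lemma cexp_localize W f k u :
  E k (localize W f) u = \sum_(j < n.+1 | (j <= k)%N) locterm W f j u.
Proof.
by rewrite /localize cexp_big [RHS]big_mkcond; apply: eq_bigr => j _; rewrite cexp_locterm_le.
Qed.

(** Averaging at level [k] merely truncates the sum of the terms, and at a point [u] off [W] each
    term vanishes because no atom containing [u] lies in [W]. *)
Lemma localize_out W f k u : ~~ W u -> E k (localize W f) u = 0.
Proof.
move=> Wu; rewrite cexp_localize big1// => j _; rewrite /locterm.
case: (boolP (inside W j.-1 u)) => [/inside_self|_]; last by rewrite mul0r.
by rewrite (negPf Wu).
Qed.

Lemma sub_localize W f u :
  f u - localize W f u = \sum_(j < n.+1) (~~ inside W j.-1 u)%:R * mdiff j f u.
Proof.
rewrite -{1}(cexp_finest f) -sum_mdiff -sumrB; apply: eq_bigr => j _.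
by rewrite /locterm; case: inside; rewrite ?mul1r ?mul0r ?subrr ?subr0.
Qed.

Definition upset (eps : R) f u := eps < runmax n f u.

Lemma cexp_double i f u : (forall v, 0 <= f v) -> E i.+1 f u <= 2 * E i f u.
Proof.
move=> f0; have c0 j := card_fiber_gt0 R (e j) u.
have A : \sum_(v | e i.+1 v == e i.+1 u) f v <= \sum_(v | e i v == e i u) f v.
  rewrite big_mkcond [leRHS]big_mkcond/=; apply: ler_sum => v _.
  by case: eqP => [/nest->|_]; [rewrite eqxx|case: ifP].
have B : #|[pred v | e i v == e i u]|%:R <= 2 * #|[pred v | e i.+1 v == e i.+1 u]|%:R :> R.
  by rewrite -natrM ler_nat dbl.
rewrite /cexp ler_pdivrMr// mulrA mulrAC ler_pdivlMr// -mulrA mulrCA.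
by apply: ler_pM; rewrite ?sumr_ge0.
Qed.

(** At a point of [W] the discarded differences telescope to the average of [f] over the first atom
    contained in [W]. The parent of that atom leaves [W], hence meets [V] in density at most [eps];
    by doubling the atom itself has density at most [2 * eps], and Cauchy-Schwarz against the
    indicator of [V] gains this factor. The first atoms are disjoint, so the bounds add up. *)
Lemma localize_small (V : pred X) (eps : R) f : 0 < eps < 1 ->
  (forall u, ~~ V u -> f u = 0) ->
  \sum_u (f u - localize (upset eps (fun v => (V v)%:R)) f u) ^+ 2 <=
  2 * eps * \sum_u f u ^+ 2.
Proof.
move=> /andP[eps0 eps1] fV; set IV := fun v => (V v)%:R : R; set W := upset eps IV.
have VW u : V u -> W u.
  move=> Vu; rewrite /W /upset (lt_le_trans eps1)//.
  apply: le_trans (le_runmax IV u (leqnn n)).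
  by rewrite cexp_finest /IV Vu.
pose stop k u := inside W k.+1 u && ~~ inside W k u.
have pw u : (f u - localize W f u) ^+ 2 <=
    \sum_(k < n) 2 * eps * (E k.+1 (fun v => f v ^+ 2) u * (stop k u)%:R).
  have r0 k : 0 <= 2 * eps * (E k.+1 (fun v => f v ^+ 2) u * (stop k u)%:R).
    apply: mulr_ge0; first by rewrite mulr_ge0// ltW.
    by apply: mulr_ge0 => //; apply: cexp_ge0 => v; exact: sqr_ge0.
  rewrite sub_localize.
  have [Wu|Wu] := boolP (W u); last first.
    have -> : \sum_(j < n.+1) (~~ inside W j.-1 u)%:R * mdiff j f u = f u.
      rewrite -[RHS]cexp_finest -sum_mdiff; apply: eq_bigr => j _.
      case: (boolP (inside W j.-1 u)) => [/inside_self|_]; last by rewrite mul1r.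
      by rewrite (negPf Wu).
    by rewrite fV ?expr0n ?sumr_ge0//; apply: contra Wu; exact: VW.
  have exk : exists k, inside W k u by exists n; apply/insideP => v /fine->.
  case: (ex_minnP exk) => k ik kmin.
  have kn : (k <= n)%N by apply: kmin; apply/insideP => v /fine->.
  case: k ik kmin kn => [i0 _ _|k ik kmin kn].
    rewrite big1 ?expr0n ?sumr_ge0// => j _.
    by rewrite (inside_le (leq0n _) i0) mul0r.
  have nik : ~~ inside W k u by apply/negP => /kmin; rewrite ltnn.
  (* The difference of index [j] is governed by level [j.-1], so the discarded ones run up to [k.+1]
     inclusive. *)
  have -> : \sum_(j < n.+1) (~~ inside W j.-1 u)%:R * mdiff j f u = E k.+1 f u.
    rewrite -sum_mdiff (big_ord_widen n.+1 (fun j => mdiff j f u)) ?ltnS//.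
    rewrite [RHS]big_mkcond; apply: eq_bigr => j _.
    case: ltnP => jk.
      have /negPf-> : ~~ inside W j.-1 u; last by rewrite mul1r.
      apply: contra nik; apply: inside_le; by case: (j : nat) jk.
    rewrite (inside_le _ ik) ?mul0r//; by case: (j : nat) jk.
  rewrite (bigD1 (Ordinal kn))//= /stop ik nik mulr1.
  rewrite -[leLHS]addr0 lerD ?sumr_ge0//.
  rewrite (eq_cexp (g := fun v => f v * IV v)); last first.
    by move=> v _; rewrite /IV; case: (boolP (V v)) => [|/fV->]; rewrite ?mulr1 ?mulr0.
  apply: le_trans (cexp_cauchy _ _ _ _) _; rewrite mulrC ler_wpM2r//.
    by apply: cexp_ge0 => v; exact: sqr_ge0.
  rewrite (eq_cexp (g := IV)); last by move=> v _; rewrite /IV; case: (V v); rewrite ?expr1n ?expr0n.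
  apply: le_trans (cexp_double _ _ _) _ => [v|]; first by rewrite /IV.
  rewrite ler_pM2l//.
  (* [z] is a point of the parent atom outside [W]; there every average of the indicator of [V] is
     at most [eps]. *)
  have /forallPn[z] := nik; rewrite negb_imply => /andP[/eqP zu].
  rewrite /W /upset -leNgt -(cexp_label _ zu); apply: le_trans.
  exact: le_runmax (ltnW kn).
apply: le_trans (ler_sum _ (fun u _ => pw u)) _.
rewrite exchange_big/=; under eq_bigr do rewrite -mulr_sumr.
rewrite -mulr_sumr ler_pM2l ?mulr_gt0//.
rewrite (eq_bigr (fun k : 'I_n => \sum_u f u ^+ 2 * (stop k u)%:R)); last first.
  move=> k _; apply: sum_cexpM => u v uv; rewrite /stop (inside_label _ uv).
  by rewrite (label_meas_le (leqnSn k) (@inside_label W k) uv).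
rewrite exchange_big/=; apply: ler_sum => u _; rewrite -mulr_sumr.
rewrite ler_piMr ?sqr_ge0//.
have [k /andP[ik nk]|none] := pickP (fun k : 'I_n => stop k u); last first.
  by rewrite big1// => k _; rewrite none.
rewrite (bigD1 k)//= big1 ?addr0 ?lern1 ?leq_b1// => j jk.
suff -> : stop j u = false by [].
apply/negbTE; rewrite /stop negb_and negbK.
move: jk; rewrite -val_eqE/= neq_ltn => /orP[jk|kj].
  by apply/orP; left; apply: contra nk; exact: inside_le.
by apply/orP; right; exact: inside_le ik.
Qed.

End Filtration.

(** * The strong maximal function of two commuting filtrations *)

Section Labels.
Variables (X : finType) (L1 L2 : eqType) (n : nat).
Variables (e1 : nat -> X -> L1) (e2 : nat -> X -> L2).

Definition e12 i j v := (e1 i v, e2 j v).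
Definition lab1 i := e12 i n.
Definition lab2 j := e12 n j.

End Labels.

(* [e12 e1 e2 i j] labels the rectangles of bilevel [(i, j)], level [0] being
   the coarsest and level [n] the points; [lab1] and [lab2] label the fibres
   along which a single variable is averaged. *)
Record bifiltration (R : realType) (X : finType) (L1 L2 : eqType) (n : nat)
    (e1 : nat -> X -> L1) (e2 : nat -> X -> L2) : Prop := Bifiltration {
  nest1 : forall i u v, lab1 n e1 e2 i.+1 u = lab1 n e1 e2 i.+1 v ->
    lab1 n e1 e2 i u = lab1 n e1 e2 i v;
  nest2 : forall i u v, lab2 n e1 e2 i.+1 u = lab2 n e1 e2 i.+1 v ->
    lab2 n e1 e2 i u = lab2 n e1 e2 i v;
  fine1 : injective (lab1 n e1 e2 n);
  fine2 : injective (lab2 n e1 e2 n);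
  double1 : forall i u, (#|[pred v | lab1 n e1 e2 i v == lab1 n e1 e2 i u]| <=
    2 * #|[pred v | lab1 n e1 e2 i.+1 v == lab1 n e1 e2 i.+1 u]|)%N;
  double2 : forall i u, (#|[pred v | lab2 n e1 e2 i v == lab2 n e1 e2 i u]| <=
    2 * #|[pred v | lab2 n e1 e2 i.+1 v == lab2 n e1 e2 i.+1 u]|)%N;
  cexp12 : forall i j (f : X -> R) u,
    cexp (lab1 n e1 e2 i) (cexp (lab2 n e1 e2 j) f) u = cexp (e12 e1 e2 i j) f u;
  cexp21 : forall i j (f : X -> R) u,
    cexp (lab2 n e1 e2 j) (cexp (lab1 n e1 e2 i) f) u = cexp (e12 e1 e2 i j) f u }.

Section StrongMaximal.
Variables (R : realType) (X : finType) (L1 L2 : eqType) (n : nat).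
Variables (e1 : nat -> X -> L1) (e2 : nat -> X -> L2).
Hypothesis bif : @bifiltration R X L1 L2 n e1 e2.
Local Notation d1 := (lab1 n e1 e2).
Local Notation d2 := (lab2 n e1 e2).
Implicit Types (f h : X -> R) (u v : X).

Definition smax f u : R := \big[Num.max/0]_(ij : 'I_n.+1 * 'I_n.+1) `|cexp (e12 e1 e2 ij.1 ij.2) f u|.

Lemma le_smax i j f u : (i <= n)%N -> (j <= n)%N -> `|cexp (e12 e1 e2 i j) f u| <= smax f u.
Proof.
move=> ip jp.
exact: (le_bigmax 0 (fun ij : 'I_n.+1 * 'I_n.+1 => `|cexp (e12 e1 e2 ij.1 ij.2) f u|)
  (@Ordinal n.+1 i ip, @Ordinal n.+1 j jp)).
Qed.

Lemma smax_ge0 f u : 0 <= smax f u.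
Proof. exact: bigmax_ge_id. Qed.

Lemma smax_le f u c : 0 <= c ->
  (forall i j, (i <= n)%N -> (j <= n)%N -> `|cexp (e12 e1 e2 i j) f u| <= c) -> smax f u <= c.
Proof. by move=> c0 H; apply: bigmax_le => // -[i j] _; apply: H; rewrite -ltnS. Qed.

Lemma smax_self f u : `|f u| <= smax f u.
Proof.
suff <- : cexp (e12 e1 e2 n n) f u = f u by exact: le_smax.
rewrite -(cexp12 bif).
by rewrite !(cexp_finest (fine1 bif), cexp_finest (fine2 bif)).
Qed.

Lemma smaxZ c f u : smax (fun v => c * f v) u = `|c| * smax f u.
Proof.
have le (a : R) h : smax (fun v => a * h v) u <= `|a| * smax h u.
  apply: smax_le => [|i j ip jp]; first by rewrite mulr_ge0 ?smax_ge0.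
  by rewrite cexpZ normrM ler_wpM2l// le_smax.
apply/le_anti; rewrite le/=; have [->|c0] := eqVneq c 0.
  by rewrite normr0 mul0r smax_ge0.
have := le c^-1 (fun v => c * f v).
rewrite normfV ler_pdivlMl ?normr_gt0//; apply: le_trans; rewrite ler_wpM2l//.
apply: smax_le => [|i j ip jp]; first exact: smax_ge0.
apply: le_trans (le_smax _ _ ip jp); rewrite le_eqVlt; apply/orP; left; apply/eqP.
by congr `|_|; apply: eq_cexp => v _; rewrite mulKf.
Qed.

Lemma smax_sum (I : Type) (r : seq I) (F : I -> X -> R) u :
  smax (fun v => \sum_(k <- r) F k v) u <= \sum_(k <- r) smax (F k) u.
Proof.
apply: smax_le => [|i j ip jp]; first by rewrite sumr_ge0// => k _; exact: smax_ge0.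
rewrite cexp_big; apply: le_trans (ler_norm_sum _ _ _) _.
by apply: ler_sum => k _; exact: le_smax.
Qed.

(** Doob's constant once for each variable. *)
Definition smax_cst s : R := ((s / (s - 1)) `^ s) ^+ 2.

Lemma smax_Ls s f : 1 < s ->
  \sum_u smax f u `^ s <= smax_cst s * \sum_u `|f u| `^ s.
Proof.
move=> s1; have s0 : 0 <= s by lra.
have f0 u : 0 <= `|f u| by [].
have r0 u := runmax_ge0 d2 n u f0.
have le u : smax f u <= runmax d1 n (runmax d2 n (fun v => `|f v|)) u.
  apply: smax_le => [|i j ip jp]; first exact: runmax_ge0.
  apply: le_trans (cexp_norm _ _ _) _; rewrite -[leLHS](cexp12 bif).
  apply: le_trans (le_runmax _ _ _ ip); apply: cexp_le => v _; exact: le_runmax.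
have pw u : smax f u `^ s <= runmax d1 n (runmax d2 n (fun v => `|f v|)) u `^ s.
  by apply: ge0_ler_powR (le u) => //; rewrite nnegrE ?smax_ge0//; exact: runmax_ge0.
apply: le_trans (ler_sum _ (fun u _ => pw u)) _.
apply: le_trans (doob (nest1 bif) _ s1 r0) _.
rewrite /smax_cst expr2 -mulrA ler_wpM2l ?powR_ge0//.
exact: (@doob _ _ _ _ (nest2 bif) s n (fun v => `|f v|) s1 f0).
Qed.

Lemma smax_cst_ge0 s : 0 <= smax_cst s.
Proof. exact: sqr_ge0. Qed.

Lemma smax_L2 f : \sum_u smax f u ^+ 2 <= 16 * \sum_u f u ^+ 2.
Proof.
have := @smax_Ls 2 f; rewrite ltr1n => /(_ isT).
under eq_bigr do rewrite (powR_mulrn 2) ?smax_ge0//.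
under [in X in _ <= X]eq_bigr do rewrite (powR_mulrn 2)// real_normK ?num_real//.
have -> // : smax_cst 2 = 16.
rewrite /smax_cst; have -> : (2 : R) / (2 - 1) = 2.
  have -> : (2 - 1 : R) = 1 by lra.
  by rewrite divr1.
by rewrite (powR_mulrn 2)// -exprM -natrX.
Qed.

End StrongMaximal.

(** * Twofold localization of an indicator *)

Section SmallTestFunction.
Variables (R : realType) (X : finType) (L1 L2 : eqType) (n : nat).
Variables (e1 : nat -> X -> L1) (e2 : nat -> X -> L2).
Hypothesis bif : @bifiltration R X L1 L2 n e1 e2.
Local Notation d1 := (lab1 n e1 e2).
Local Notation d2 := (lab2 n e1 e2).
Variables (Om : pred X) (eps : R).
Implicit Types (f : X -> R) (u v : X).
Hypothesis eps01 : 0 < eps < 1.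
Let N1 := nest1 bif.
Let N2 := nest2 bif.
Let ind (P : pred X) : X -> R := fun u => (P u)%:R.
Let enl1 := upset d1 n eps (ind Om).
Let t i : X -> R := locterm d1 enl1 (ind Om) i.
Let V i := inside d1 enl1 i.-1.
Let W i := upset d2 n eps (ind (V i)).
Let s i : X -> R := localize d2 n (W i) (t i).
Let enl2 := upset d2 n eps (ind enl1).

Let eps0 : 0 < eps. Proof. by case/andP: eps01. Qed.

(** A function measurable at level [k] in the first variable is its own average there, and the two
    averages commute. *)
Lemma label1_cexp2 k j (f : X -> R) :
  label_meas (d1 k) f -> label_meas (d1 k) (cexp (d2 j) f).
Proof.
move=> fm u v uv.
have E w : cexp (d2 j) f w = cexp (d1 k) (cexp (d2 j) f) w.
  rewrite (cexp12 bif) -(cexp21 bif); apply: eq_cexp => z _.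
  by rewrite (cexp_id _ fm).
by rewrite !E; exact: cexp_label.
Qed.

Lemma cexp1_mdiff2 k j f u :
  cexp (d1 k) (mdiff d2 j f) u = mdiff d2 j (cexp (d1 k) f) u.
Proof.
case: j => [|j] /=; first by rewrite (cexp12 bif) (cexp21 bif).
by rewrite cexpB !(cexp12 bif) !(cexp21 bif).
Qed.

Lemma label1_inside2 k j (P : pred X) :
  label_meas (d1 k) P -> label_meas (d1 k) (inside d2 P j).
Proof.
move=> Pm.
(* Lying inside [P] is expressed by an average equal to 1, which reduces the claim to the preceding
   lemma. *)
have E u : inside d2 P j u = (cexp (d2 j) (ind P) u == 1).
  apply/insideP/eqP => [H|H v vu].
    by rewrite (eq_cexp (g := fun=> 1)) ?cexp_cst// => v /H; rewrite /ind => ->.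
  have : cexp (d2 j) (fun w => 1 - ind P w) u == 0 by rewrite cexpB cexp_cst H subrr.
  have nn w : 0 <= 1 - ind P w by rewrite /ind; case: (P w); rewrite ?subrr// subr0.
  rewrite /cexp mulf_eq0 invr_eq0 (gt_eqF (card_fiber_gt0 _ _ _)) orbF psumr_eq0//.
  move=> /allP/(_ v); rewrite mem_index_enum => /(_ isT).
  rewrite vu eqxx /= /ind; case: (P v) => //; rewrite subr0 => /eqP/eqP.
  by rewrite oner_eq0.
move=> u v uv; rewrite !E (label1_cexp2 _ _ uv)// => x y /Pm.
by rewrite /ind => ->.
Qed.

Let labelV i : label_meas (d1 i.-1) (V i).
Proof. exact: inside_label. Qed.

(** This predictability of [W i] in the first variable makes the second localization commute with
    averages in the first, so that the [s i] are again martingale differences. *)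
Let labelW i : label_meas (d1 i.-1) (W i).
Proof.
move=> u v uv; rewrite /W /upset; congr (_ < _).
have E k : cexp (d2 k) (ind (V i)) u = cexp (d2 k) (ind (V i)) v.
  by apply: (label1_cexp2 (k := i.-1)) uv => x y /labelV; rewrite /ind => ->.
suff H m : runmax d2 m (ind (V i)) u = runmax d2 m (ind (V i)) v by [].
by elim: m => [|m IH] /=; rewrite ?E ?IH.
Qed.

Let t_label i : label_meas (d1 i) (t i).
Proof. exact: locterm_label. Qed.

Let s_label i : label_meas (d1 i) (s i).
Proof.
move=> u v uv; apply: eq_bigr => j _; rewrite /locterm.
have W' := label1_inside2 j.-1 (@labelW i).
rewrite (label_meas_le N1 (leq_pred i) W' uv); congr (_ * _).
case: (j : nat) => [|k] /=; first exact: (label1_cexp2 0 (@t_label i)).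
by rewrite (label1_cexp2 k.+1 (@t_label i) uv) (label1_cexp2 k (@t_label i) uv).
Qed.

Let s_cexp i u : cexp (d1 i) (s i.+1) u = 0.
Proof.
rewrite /s /localize cexp_big big1// => j _.
have W' := label1_inside2 j.-1 (@labelW i.+1).
rewrite /locterm (eq_cexp (g := fun v => mdiff d2 j (t i.+1) v *
  (inside d2 (W i.+1) j.-1 v)%:R)); last by move=> v _; rewrite mulrC.
rewrite cexpMr; last by move=> x y /W' ->.
rewrite cexp1_mdiff2; have E x : cexp (d1 i) (t i.+1) x = 0 by exact: cexp_locterm.
have E' k : cexp (d2 k) (cexp (d1 i) (t i.+1)) u = 0.
  by rewrite (eq_cexp (g := fun=> 0)) ?cexp_cst.
by case: (j : nat) => [|k] /=; rewrite !E' ?subrr mul0r.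
Qed.

Let tdiff i u := t i u - s i u.

Let f1 u := localize d1 n enl1 (ind Om) u.

(* A replacement in [H^p], [p <= 1], for the indicator of [Om]: localizing in the
   first variable and then, difference by difference, in the second one changes
   it little in [L^2] and confines its strong maximal function to [enl2]. *)
Definition test_fun u : R := \sum_(i < n.+1) s i u.

Let sum_ind (P : pred X) : \sum_u ind P u ^+ 2 = #|P|%:R.
Proof.
rewrite -sum1_card natr_sum [RHS]big_mkcond; apply: eq_bigr => u _.
by rewrite /ind unfold_in; case: (P u); rewrite ?expr1n ?expr0n.
Qed.

Let sum_f1 : \sum_u f1 u ^+ 2 = \sum_(i < n.+1) \sum_u t i u ^+ 2.
Proof.
apply: (sum_sqr_orth N1); first exact: t_label.
by move=> j u; exact: cexp_locterm.
Qed.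

Let err1 : \sum_u (ind Om u - f1 u) ^+ 2 <= 2 * eps * #|Om|%:R.
Proof.
rewrite -sum_ind; apply: (localize_small N1 (fine1 bif) (double1 bif)) => // u.
by rewrite /ind => /negPf->.
Qed.

(** The [tdiff i] are orthogonal martingale differences in the first variable, so the second
    localization may be estimated separately for each [t i], which is supported in [V i]. *)
Let err2 : \sum_u (f1 u - test_fun u) ^+ 2 <= 2 * eps * \sum_u f1 u ^+ 2.
Proof.
rewrite sum_f1 mulr_sumr.
under eq_bigr do rewrite /f1 /localize /test_fun -sumrB.
rewrite (@sum_sqr_orth _ _ _ d1 N1 n.+1 tdiff).
- apply: ler_sum => i _; rewrite /tdiff /s /W.
  apply: (localize_small N2 (fine2 bif) (double2 bif)) => // u /negPf Vu.
  by rewrite /t /locterm -/(V i) Vu mul0r.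
- by move=> j u v uv; rewrite /tdiff (t_label uv) (s_label uv).
- by move=> j u; rewrite /tdiff cexpB s_cexp subr0; exact: cexp_locterm.
Qed.

Let sqr2 (a b : R) : (a + b) ^+ 2 <= 2 * a ^+ 2 + 2 * b ^+ 2.
Proof.
rewrite -subr_ge0 (_ : _ - _ = (a - b) ^+ 2) ?sqr_ge0//; ring.
Qed.

Let sum_sqr2 (a b : X -> R) :
  \sum_u (a u + b u) ^+ 2 <= 2 * (\sum_u a u ^+ 2) + 2 * (\sum_u b u ^+ 2).
Proof. by rewrite !mulr_sumr -big_split; apply: ler_sum => u _; exact: sqr2. Qed.

Lemma sum_test_err : \sum_u (ind Om u - test_fun u) ^+ 2 <= 28 * eps * #|Om|%:R.
Proof.
have /= := @sum_sqr2 (fun u => ind Om u - f1 u) (fun u => f1 u - test_fun u).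
under eq_bigr do rewrite subrKA.
have /= := @sum_sqr2 (fun u => ind Om u) (fun u => f1 u - ind Om u).
under eq_bigr do rewrite addrC subrK.
rewrite sum_ind.
have -> : \sum_u (f1 u - ind Om u) ^+ 2 = \sum_u (ind Om u - f1 u) ^+ 2.
  by apply: eq_bigr => u _; rewrite -sqrrN opprB.
move: err1 err2; set a := \sum_u (_ - f1 _) ^+ 2; set b := \sum_u (f1 _ - _) ^+ 2.
set c := \sum_u f1 u ^+ 2; set d := \sum_u (_ - _) ^+ 2; set m := #|Om|%:R.
have m0 : 0 <= m by rewrite /m.
have c0 : 0 <= c by apply: sumr_ge0 => u _; exact: sqr_ge0.
(* Since [c <= 2 * m + 4 * eps * m <= 6 * m], the two errors contribute [4 * eps * m] and
   [24 * eps * m]. *)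
move: eps01 => /andP[e0 d1'] h1 h2 h3 h4.
have em : eps * m <= m by rewrite ler_piMl// ltW.
have cm : c <= 6 * m by lra.
have : eps * c <= eps * (6 * m) by rewrite ler_pM2l.
lra.
Qed.

Lemma sum_test_fun : \sum_u test_fun u ^+ 2 <= 58 * #|Om|%:R.
Proof.
have /= := @sum_sqr2 (fun u => ind Om u) (fun u => test_fun u - ind Om u).
under eq_bigr do rewrite addrC subrK.
have -> : \sum_u (test_fun u - ind Om u) ^+ 2 = \sum_u (ind Om u - test_fun u) ^+ 2.
  by apply: eq_bigr => u _; rewrite -sqrrN opprB.
have := sum_test_err; rewrite sum_ind.
set a := \sum_u _; set b := \sum_u _; set m := #|Om|%:R.
have m0 : 0 <= m by rewrite /m.
move: eps01 => /andP[e0 d1'] h1 h2.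
have em : eps * m <= m by rewrite ler_piMl// ltW.
lra.
Qed.

(** Averaging in the first variable truncates the sum of the [s k]; averaging in the second one then
    gives zero off [W k] by [localize_out], and [W k] lies in [enl2] because [V k] lies in
    [enl1]. *)
Lemma smax_test_fun_out u : ~~ enl2 u -> smax n e1 e2 test_fun u = 0.
Proof.
move=> nu; apply/le_anti; rewrite smax_ge0 andbT; apply: smax_le => // i j ip jp.
rewrite /e12 -(cexp21 bif).
rewrite (eq_cexp (g := fun v => \sum_(k < n.+1 | (k <= i)%N) s k v)); last first.
  move=> v _; rewrite /test_fun cexp_big [RHS]big_mkcond; apply: eq_bigr => k _.
  case: leqP => ki; first by apply: cexp_id; exact: label_meas_le (@s_label k).
  case: (k : nat) ki => // k'; rewrite ltnS => ik.
  rewrite -(@cexp_coarse_fine _ _ _ _ (d1 i) (d1 k')); last by move=> x y; exact: nest_le.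
  by rewrite (eq_cexp (g := fun=> 0)) ?cexp_cst.
rewrite cexp_big big1 ?normr0// => k _; apply: localize_out => //.
apply: contra nu; rewrite /W /enl2 /upset => /lt_le_trans; apply.
apply: runmax_mono => v; rewrite /ind ler_nat; case: (boolP (V k v)) => // /inside_self.
by rewrite /=; case: enl1.
Qed.

Let card_upset (L : eqType) (e : nat -> X -> L) (P : pred X) :
  (forall i u v, e i.+1 u = e i.+1 v -> e i u = e i v) ->
  #|upset e n eps (ind P)|%:R <= 4 * eps ^- 2 * #|P|%:R :> R.
Proof.
move=> N; rewrite -!sum_ind.
have i0 u : 0 <= ind P u by [].
have := @doob _ _ _ _ N 2 n (ind P); rewrite ltr1n => /(_ isT i0).
under eq_bigr do rewrite (powR_mulrn 2) ?runmax_ge0//.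
under [in X in _ <= X]eq_bigr do rewrite (powR_mulrn 2)//.
have -> : (2 : R) / (2 - 1) = 2 by rewrite (_ : 2 - 1 = 1 :> R) ?divr1//; lra.
rewrite (powR_mulrn 2)// => H.
rewrite mulrAC; rewrite (mulrC _ (eps ^- 2)) ler_pdivlMl ?exprn_gt0//.
rewrite (_ : 4 = 2 ^+ 2 :> R); last by rewrite -natrX.
apply: le_trans H; rewrite mulr_sumr; apply: ler_sum => u _.
rewrite -exprMn.
have r0 := runmax_ge0 e n u i0.
rewrite ler_sqr ?nnegrE ?mulr_ge0 ?(ltW eps0)//.
rewrite {1}/ind; by case: (boolP (upset _ _ _ _ _)) => [/ltW|]; rewrite ?mulr1 ?mulr0.
Qed.

Lemma card_enl2 : #|enl2|%:R <= 16 * eps ^- 4 * #|Om|%:R :> R.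
Proof.
apply: le_trans (card_upset _ N2) _.
have -> : 16 * eps ^- 4 * #|Om|%:R = 4 * eps ^- 2 * (4 * eps ^- 2 * #|Om|%:R).
  have := eps0 => e0; field; rewrite gt_eqF//.
by rewrite ler_pM2l ?mulr_gt0 ?invr_gt0 ?exprn_gt0// card_upset.
Qed.

(** Hoelder between the [L^2] bound and the size of the support [enl2], which was gained by two
    applications of Chebyshev. *)
Lemma sum_smax_test_fun p : 0 < p < 2 ->
  \sum_u smax n e1 e2 test_fun u `^ p <=
  (16 * 58) `^ (p / 2) * (16 * eps ^- 4) `^ (1 - p / 2) * #|Om|%:R.
Proof.
move=> /andP[p0 p2]; set M := smax n e1 e2 test_fun.
have p21 : 0 < p / 2 < 1 by apply/andP; split; lra.
have h : forall u, M u `^ p = (M u ^+ 2) `^ (p / 2) * ind enl2 u `^ (1 - p / 2).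
  move=> u; rewrite sqr_powR ?smax_ge0// (_ : 2 * (p / 2) = p); last by lra.
  rewrite /ind; case: (boolP (enl2 u)) => [_|/smax_test_fun_out]; first by rewrite powR1 mulr1.
  by rewrite /M => ->; rewrite powR0 ?mul0r// gt_eqF.
under eq_bigr do rewrite h.
apply: le_trans (sum_holder p21 _ _) _ => [u|u|]; [exact: sqr_ge0|by rewrite /ind|].
have e0 := eps0.
have -> : \sum_u ind enl2 u = \sum_u ind enl2 u ^+ 2.
  by apply: eq_bigr => u _; rewrite /ind; case: (enl2 u); rewrite ?expr1n ?expr0n.
rewrite sum_ind.
have A : \sum_u M u ^+ 2 <= 16 * 58 * #|Om|%:R.
  apply: le_trans (smax_L2 bif _) _; rewrite -mulrA ler_pM2l//; exact: sum_test_fun.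
have M0 : 0 <= #|Om|%:R :> R by [].
have c0 : 0 <= 16 * eps ^- 4 by rewrite mulr_ge0// invr_ge0 exprn_ge0// ltW.
apply: le_trans (ler_pM _ _ (ge0_ler_powR _ _ _ A) (ge0_ler_powR _ _ _ card_enl2)) _;
  rewrite ?nnegrE ?powR_ge0 ?mulr_ge0 ?sumr_ge0//; try lra.
  by move=> u _; exact: sqr_ge0.
by rewrite powR_interp.
Qed.

End SmallTestFunction.

(** * Carleson embedding and upper bounds *)

Section Rectangles.
Variables (R : realType) (X : finType) (L1 L2 : eqType) (n : nat).
Variables (e1 : nat -> X -> L1) (e2 : nat -> X -> L2).
Hypothesis bif : @bifiltration R X L1 L2 n e1 e2.
Variables (G : finType) (l1 l2 : G -> nat) (base : G -> X).
Hypotheses (l1n : forall i, (l1 i <= n)%N) (l2n : forall i, (l2 i <= n)%N).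
Implicit Types (f : X -> R) (u v : X) (i : G) (w a : G -> R) (K p q r c : R).

Definition in_rect i u := e12 e1 e2 (l1 i) (l2 i) u == e12 e1 e2 (l1 i) (l2 i) (base i).
Definition rect_size i : R := #|[pred u | in_rect i u]|%:R.
Definition rect_avg i f : R := cexp (e12 e1 e2 (l1 i) (l2 i)) f (base i).
(** No square root is taken: with [w i] in the place of [g_R ^ 2] this is the square of the square
    function, whence the exponents [q / 2] below. *)
Definition sqfun w u : R := \sum_(i | in_rect i u) w i / rect_size i.
Definition rect_max a u : R := \big[Num.max/0]_(i | in_rect i u) a i.
Definition rect_union (P : pred G) := [pred u | [exists i, P i && in_rect i u]].

Lemma rect_size_gt0 i : 0 < rect_size i.
Proof. exact: card_fiber_gt0. Qed.

Lemma in_rect_base i : in_rect i (base i).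
Proof. by rewrite /in_rect. Qed.

Lemma rect_avg_smax i f u : in_rect i u -> `|rect_avg i f| <= smax n e1 e2 f u.
Proof. by move=> /eqP iu; rewrite /rect_avg -(cexp_label f iu); exact: le_smax. Qed.

Lemma rect_avgE i f : rect_avg i f = (\sum_(u | in_rect i u) f u) / rect_size i.
Proof. by []. Qed.

Lemma rect_avg_le i f h : (forall u, in_rect i u -> f u <= h u) ->
  rect_avg i f <= rect_avg i h.
Proof. by move=> fh; apply: cexp_le => v vi; apply: fh; apply/eqP. Qed.

Lemma rect_avg_ge0 i f : (forall u, 0 <= f u) -> 0 <= rect_avg i f.
Proof. exact: cexp_ge0. Qed.

Lemma sum_sqfunM w f : \sum_u sqfun w u * f u = \sum_i w i * rect_avg i f.
Proof.
under eq_bigr do rewrite /sqfun mulr_suml.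
rewrite (exchange_big_dep predT)//=; apply: eq_bigr => i _.
rewrite rect_avgE mulr_suml mulr_sumr; apply: eq_bigr => u _; ring.
Qed.

Lemma sum_sqfun w : \sum_u sqfun w u = \sum_i w i.
Proof.
transitivity (\sum_u sqfun w u * 1); first by apply: eq_bigr => u _; rewrite mulr1.
by rewrite sum_sqfunM; apply: eq_bigr => i _; rewrite /rect_avg cexp_cst mulr1.
Qed.

Lemma sqfun_ge0 w u : (forall i, 0 <= w i) -> 0 <= sqfun w u.
Proof. by move=> w0; apply: sumr_ge0 => i _; rewrite divr_ge0// ltW ?rect_size_gt0. Qed.

Lemma sqfun_le w w' u : (forall i, in_rect i u -> w i <= w' i) -> sqfun w u <= sqfun w' u.
Proof.
move=> ww; apply: ler_sum => i /ww H; rewrite ler_wpM2r// invr_ge0 ltW//.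
exact: rect_size_gt0.
Qed.

Lemma sqfunZ w c u : sqfun (fun i => c * w i) u = c * sqfun w u.
Proof. by rewrite /sqfun mulr_sumr; apply: eq_bigr => i _; rewrite mulrA. Qed.

Lemma le_sqfun w i u : (forall i, 0 <= w i) -> in_rect i u -> w i / rect_size i <= sqfun w u.
Proof.
move=> w0 iu; rewrite /sqfun (bigD1 i)//= lerDl sumr_ge0// => j _.
by rewrite divr_ge0// ltW// rect_size_gt0.
Qed.

Lemma rect_max_ge0 a u : 0 <= rect_max a u.
Proof. exact: bigmax_ge_id. Qed.

Lemma le_rect_max a i u : in_rect i u -> a i <= rect_max a u.
Proof. by move=> iu; apply: (le_bigmax_cond 0 a (j := i)). Qed.

Lemma rect_max_le a u c : 0 <= c -> (forall i, in_rect i u -> a i <= c) -> rect_max a u <= c.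
Proof. by move=> c0 H; exact: bigmax_le. Qed.

Definition carleson K w :=
  forall P : pred G, \sum_(i | P i) w i <= K * #|rect_union P|%:R.

(** A layer-cake argument that peels off the lowest layer: lower all positive [a i] by their minimum
    [d]. The Carleson condition for the family of positive [a i] pays for this layer, and on its
    union [rect_max a] drops by at least [d]. *)
Lemma carleson_embedding K w a : 0 <= K -> (forall i, 0 <= w i) -> (forall i, 0 <= a i) ->
  carleson K w -> \sum_i w i * a i <= K * \sum_u rect_max a u.
Proof.
move=> K0 w0 + KC.
have [m] := ubnP #|[pred i | 0 < a i]|; elim: m a => // m IH a am a0.
have [i0 i0P|none] := pickP [pred i | 0 < a i]; last first.
  rewrite big1 ?mulr_ge0 ?sumr_ge0// => [u _|i _]; first exact: rect_max_ge0.
  have /negbT := none i; rewrite /= -leNgt => ai.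
  have -> : a i = 0 by apply/le_anti; rewrite ai a0.
  by rewrite mulr0.
case: (arg_minP (P := [pred i | 0 < a i]) a i0P) => {i0P}i1 /= a1 amin.
set d := a i1 in a1 amin.
pose P : pred G := [pred i | 0 < a i].
pose a' i := if P i then a i - d else 0.
have a'0 i : 0 <= a' i by rewrite /a'; case: ifP => // Pi; rewrite subr_ge0 amin.
have cm : (#|[pred i | (0 < a' i)%R]| < m)%N.
  move: am; rewrite ltnS; apply: leq_trans; apply: proper_card.
  apply/properP; split.
    by apply/fintype.subsetP => i; rewrite !inE /a'; case: ifP => //; rewrite ltxx.
  by exists i1; rewrite !inE ?a1// /a' /P /= a1 subrr ltxx.
have split_a i : w i * a i = (if P i then w i * d else 0) + w i * a' i.
  rewrite /a'; case: (boolP (P i)) => [_|]; first by ring.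
  rewrite /P /= -leNgt => ai; have -> : a i = 0 by apply/le_anti; rewrite ai a0.
  by rewrite !mulr0 addr0.
under eq_bigr do rewrite split_a.
rewrite big_split /= -big_mkcond/= -mulr_suml.
apply: le_trans (lerD (ler_wpM2r (ltW a1) (KC P)) (IH a' cm a'0)) _.
rewrite -mulrA -mulrDr ler_wpM2l//.
have -> : #|rect_union P|%:R = \sum_u (u \in rect_union P)%:R :> R.
  by rewrite -sum1_card natr_sum big_mkcond; apply: eq_bigr => u _; case: ifP.
rewrite mulr_suml -big_split/=; apply: ler_sum => u _; rewrite inE.
case: (boolP [exists i, _]) => [/existsP[i /andP[Pi iu]]|_].
  have di : d <= rect_max a u by apply: le_trans (le_rect_max a iu); exact: amin.
  rewrite mul1r addrC -lerBrDr; apply: rect_max_le; first by rewrite subr_ge0.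
  move=> j ju; rewrite /a'; case: ifP => _; last by rewrite subr_ge0.
  by rewrite lerD2r le_rect_max.
rewrite mul0r add0r; apply: rect_max_le; first exact: rect_max_ge0.
move=> i iu; apply: le_trans (le_rect_max a iu); rewrite /a'; case: ifP => // _.
by rewrite gerBl ltW.
Qed.

Lemma rect_max_powR a p u : 0 <= p -> (forall i, 0 <= a i) ->
  rect_max (fun i => a i `^ p) u <= rect_max a u `^ p.
Proof.
move=> p0 a0; apply: rect_max_le => [|i iu]; first exact: powR_ge0.
by apply: ge0_ler_powR; rewrite ?nnegrE ?rect_max_ge0// le_rect_max.
Qed.

Lemma sqfun_max w a p u : 0 < p < 2 -> (forall i, 0 <= w i) -> (forall i, 0 <= a i) ->
  sqfun (fun i => w i * a i ^+ 2) u <=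
  rect_max a u `^ (2 - p) * sqfun (fun i => w i * a i `^ p) u.
Proof.
move=> /andP[p0 p2] w0 a0; rewrite -sqfunZ; apply: sqfun_le => i iu.
have p20 : 0 < 2 - p by lra.
have -> : a i ^+ 2 = a i `^ (2 - p) * a i `^ p.
  by rewrite -powR_mul_sum// subrK powR_mulrn.
rewrite [leRHS]mulrCA ler_wpM2l//.
rewrite ler_wpM2r ?powR_ge0//.
by apply: ge0_ler_powR; rewrite ?nnegrE ?rect_max_ge0 ?le_rect_max// ltW.
Qed.

(** Pointwise, [rect_max a ^ (2 - p)] is pulled out of the square function; what remains has
    exponent [p] on [a], and its sum is estimated by the embedding. *)
Lemma paraproduct_carleson_lt2 K w a p : 0 < p < 2 -> 0 <= K ->
  (forall i, 0 <= w i) -> (forall i, 0 <= a i) -> carleson K w ->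
  \sum_u sqfun (fun i => w i * a i ^+ 2) u `^ (p / 2) <=
  K `^ (p / 2) * \sum_u rect_max a u `^ p.
Proof.
move=> p02 K0 w0 a0 KC; have /andP[p0 p2] := p02.
set T := sqfun (fun i => w i * a i `^ p).
have T0 u : 0 <= T u by apply: sqfun_ge0 => i; rewrite mulr_ge0// powR_ge0.
have m0 u := rect_max_ge0 a u.
have h u : sqfun (fun i => w i * a i ^+ 2) u `^ (p / 2) <=
    T u `^ (p / 2) * (rect_max a u `^ p) `^ (1 - p / 2).
  have := sqfun_max u p02 w0 a0; rewrite -/T => /ge0_ler_powR H.
  apply: le_trans (H (p / 2) _ _ _) _; rewrite ?nnegrE ?mulr_ge0 ?powR_ge0//; try lra.
    by apply: sqfun_ge0 => i; rewrite mulr_ge0// sqr_ge0.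
  rewrite powRM ?powR_ge0// mulrC -!powRrM.
  by rewrite (_ : (2 - p) * (p / 2) = p * (1 - p / 2))//; lra.
apply: le_trans (ler_sum _ (fun u _ => h u)) _.
apply: le_trans (sum_holder _ _ _) _ => [|//|u|]; first lra.
  exact: powR_ge0.
have M0 : 0 <= \sum_u rect_max a u `^ p by apply: sumr_ge0 => u _; exact: powR_ge0.
have A : \sum_u T u <= K * \sum_u rect_max a u `^ p.
  rewrite sum_sqfun; apply: le_trans (carleson_embedding K0 w0 _ KC) _.
    by move=> i; exact: powR_ge0.
  by rewrite ler_wpM2l//; apply: ler_sum => u _; apply: rect_max_powR => //; lra.
have p21 : 0 < p / 2 < 1 by lra.
have := powR_interp p21 K0 ler01 M0; rewrite mul1r powR1 mulr1 => <-.
rewrite ler_wpM2r ?powR_ge0//.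
by apply: ge0_ler_powR A; rewrite ?nnegrE ?(mulr_ge0 K0 M0) ?(sumr_ge0 _ (fun u _ => T0 u))//; lra.
Qed.

Lemma paraproduct_carleson_2 K w a : 0 <= K ->
  (forall i, 0 <= w i) -> (forall i, 0 <= a i) -> carleson K w ->
  \sum_u sqfun (fun i => w i * a i ^+ 2) u <= K * \sum_u rect_max a u ^+ 2.
Proof.
move=> K0 w0 a0 KC; rewrite sum_sqfun.
apply: le_trans (carleson_embedding K0 w0 _ KC) _ => [i|]; first exact: sqr_ge0.
rewrite ler_wpM2l//; apply: ler_sum => u _.
apply: rect_max_le => [|i iu]; first exact: sqr_ge0.
by rewrite ler_sqr ?nnegrE ?rect_max_ge0// le_rect_max.
Qed.

Lemma paraproduct_carleson_gt2 K w a p : 2 < p -> 0 <= K ->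
  (forall i, 0 <= w i) -> (forall i, 0 <= a i) -> carleson K w ->
  \sum_u sqfun (fun i => w i * a i ^+ 2) u `^ (p / 2) <=
  smax_cst (p / (p - 2)) `^ ((1 - 2 / p) * (p / 2)) * K `^ (p / 2) * \sum_u rect_max a u `^ p.
Proof.
move=> p2 K0 w0 a0 KC; have p0 : 0 < p by lra.
set Z := sqfun _; set c := smax_cst _; set M := \sum_u rect_max a u `^ p.
have Z0 u : 0 <= Z u by apply: sqfun_ge0 => i; rewrite mulr_ge0// sqr_ge0.
have c0 : 0 <= c by exact: smax_cst_ge0.
have M0 : 0 <= M by apply: sumr_ge0 => u _; exact: powR_ge0.
have m0 u := rect_max_ge0 a u.
pose phi u := Z u `^ (p / 2 - 1).
have phi0 u : 0 <= phi u by exact: powR_ge0.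
set Y := \sum_u _; have Y0 : 0 <= Y by apply: sumr_ge0 => u _; exact: powR_ge0.
have p21 : 0 < 2 / p < 1.
  by rewrite divr_gt0//= ltr_pdivrMr// mul1r.
have pe : p / (p - 2) * (1 - 2 / p) = 1 by field; rewrite !gt_eqF//; lra.
have s1 : 1 < p / (p - 2) by rewrite ltr_pdivlMr; lra.
(* The power [p / (p - 2)] of [phi] is [Z ^ (p / 2)], so the maximal inequality for [phi] brings
   back [Y] itself, to the power [1 - 2 / p]. *)
suff H : Y <= K * c `^ (1 - 2 / p) * (M `^ (2 / p) * Y `^ (1 - 2 / p)).
  have /andP[t0 t1] := p21.
  apply: le_trans (powR_absorb _ _ Y0 M0 H) _; rewrite ?mulr_ge0 ?powR_ge0//.
    by rewrite t0 ltW.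
  rewrite invf_div powRM ?powR_ge0// -powRrM [X in X * M]mulrC lexx//.
rewrite [leLHS](_ : Y = \sum_u Z u * phi u); last first.
  by apply: eq_bigr => u _; rewrite mulr_powRB1//; lra.
rewrite sum_sqfunM; under eq_bigr do rewrite -mulrA.
apply: le_trans (carleson_embedding K0 w0 _ KC) _ => [i|].
  by rewrite mulr_ge0 ?sqr_ge0 ?rect_avg_ge0.
rewrite -mulrA ler_wpM2l//.
have pw u : rect_max (fun i => a i ^+ 2 * rect_avg i phi) u <=
    (rect_max a u `^ p) `^ (2 / p) * (smax n e1 e2 phi u `^ (p / (p - 2))) `^ (1 - 2 / p).
  rewrite -!powRrM pe powRr1 ?smax_ge0// mulrCA mulfV ?gt_eqF// mulr1 (powR_mulrn 2)//.
  apply: rect_max_le => [|i iu]; first by rewrite mulr_ge0 ?sqr_ge0 ?smax_ge0.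
  apply: ler_pM; rewrite ?sqr_ge0 ?rect_avg_ge0//.
    by rewrite ler_sqr ?nnegrE// le_rect_max.
  by rewrite -[leLHS]ger0_norm ?rect_avg_ge0// rect_avg_smax.
have B : \sum_u smax n e1 e2 phi u `^ (p / (p - 2)) <= c * Y.
  apply: le_trans (smax_Ls bif _ s1) _; rewrite ler_wpM2l//.
  rewrite le_eqVlt; apply/orP; left; apply/eqP; apply: eq_bigr => u _.
  rewrite ger0_norm// /phi -powRrM; congr (_ `^ _).
  by field; rewrite gt_eqF//; lra.
apply: le_trans (ler_sum _ (fun u _ => pw u)) _.
apply: le_trans (sum_holder p21 _ _) _ => [u|u|]; rewrite ?powR_ge0//.
rewrite -/M [leRHS]mulrCA ler_wpM2l ?powR_ge0// -powRM//.
apply: ge0_ler_powR B; rewrite ?nnegrE ?(mulr_ge0 c0 Y0)//; first by lra.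
by apply: sumr_ge0 => u _; exact: powR_ge0.
Qed.

Lemma paraproduct_holder w a p q r : 0 < p -> 0 < q -> 0 < r ->
  q^-1 = p^-1 + r^-1 -> (forall i, 0 <= w i) -> (forall i, 0 <= a i) ->
  \sum_u sqfun (fun i => w i * a i ^+ 2) u `^ (q / 2) <=
  (\sum_u sqfun w u `^ (r / 2)) `^ (q / r) * (\sum_u rect_max a u `^ p) `^ (q / p).
Proof.
move=> p0 q0 r0 pqr w0 a0.
have qp : q / p = 1 - q / r.
  by apply: (mulfI (x := q^-1)); rewrite ?invr_eq0 ?gt_eqF// mulrBr !mulKf ?gt_eqF// mulr1 pqr addrK.
have qr01 : 0 < q / r < 1.
  by rewrite divr_gt0//= -subr_gt0 -qp divr_gt0.
have m0 u := rect_max_ge0 a u; have s0 u := sqfun_ge0 u w0.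
have H := sum_holder qr01 (fun u => powR_ge0 (sqfun w u) (r / 2))
  (fun u => powR_ge0 (rect_max a u) p).
rewrite qp; apply: le_trans H.
apply: ler_sum => u _; rewrite -qp -!powRrM.
have -> : r / 2 * (q / r) = q / 2 by field; rewrite gt_eqF.
have -> : p * (q / p) = 2 * (q / 2) by field; rewrite gt_eqF.
rewrite -sqr_powR// -powRM ?sqr_ge0//; apply: ge0_ler_powR; rewrite ?nnegrE ?mulr_ge0 ?sqr_ge0//.
- by lra.
- by apply: sqfun_ge0 => i; rewrite mulr_ge0 ?sqr_ge0.
rewrite mulrC -sqfunZ; apply: sqfun_le => i iu; rewrite mulrC ler_wpM2r//.
by rewrite ler_sqr ?nnegrE// le_rect_max.
Qed.

End Rectangles.

(** * Lower bound by the Carleson constant *)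

Section ParaproductBound.
Variables (R : realType) (X : finType) (L1 L2 : eqType) (n : nat).
Variables (e1 : nat -> X -> L1) (e2 : nat -> X -> L2).
Variables (G : finType) (l1 l2 : G -> nat) (base : G -> X).

(** The bound [A] for the operator norm, raised to the power [q], with counting measure on the
    points; the cell area is restored in [lower_cst]. *)
Definition paraproduct_bounded (p q : R) (w : G -> R) (A : R) :=
  forall f : X -> R,
    \sum_u sqfun e1 e2 l1 l2 base
      (fun i => w i * rect_avg e1 e2 l1 l2 base i f ^+ 2) u `^ (q / 2) <=
    (A * (\sum_u smax n e1 e2 f u `^ p) `^ p^-1) `^ q.

End ParaproductBound.

Section CarlesonLower.
Variables (R : realType) (X : finType) (L1 L2 : eqType) (n : nat).
Variables (e1 : nat -> X -> L1) (e2 : nat -> X -> L2).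
Hypothesis bif : @bifiltration R X L1 L2 n e1 e2.
Variables (G : finType) (l1 l2 : G -> nat) (base : G -> X).
Hypotheses (l1n : forall i, (l1 i <= n)%N) (l2n : forall i, (l2 i <= n)%N).
Variable w : G -> R.
Hypothesis w0 : forall i, 0 <= w i.
Local Notation inr := (in_rect e1 e2 l1 l2 base).
Local Notation sq := (sqfun e1 e2 l1 l2 base).
Local Notation av := (rect_avg e1 e2 l1 l2 base).
Local Notation union := (rect_union e1 e2 l1 l2 base).
Local Notation ind P := (fun u : X => (P u)%:R : R).

Lemma sum_ind (P : pred X) : \sum_u (P u)%:R = #|P|%:R :> R.
Proof.
rewrite -sum1_card natr_sum [RHS]big_mkcond; apply: eq_bigr => u _.
by rewrite unfold_in; case: (P u).
Qed.

Lemma sum_card_union (w' : G -> R) (P : pred G) :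
  (forall i, ~~ P i -> w' i = 0) -> forall u, ~~ union P u -> sq w' u = 0.
Proof.
move=> w'0 u /existsPn H; rewrite /sqfun big1// => i iu.
by have := H i; rewrite iu andbT => /w'0->; rewrite mul0r.
Qed.

(** A rectangle contains its base point, so an empty union comes from an empty family only and the
    value [0 / 0 = 0] is the right one. *)
Definition carleson_ratio (P : {set G}) : R :=
  (\sum_(i in P) w i) / #|union (fun i => i \in P)|%:R.

Lemma carleson_ratio_ge0 P : 0 <= carleson_ratio P.
Proof. by rewrite divr_ge0// sumr_ge0. Qed.

Lemma carleson_max P0 : (forall P, carleson_ratio P <= carleson_ratio P0) ->
  carleson e1 e2 l1 l2 base (carleson_ratio P0) w.
Proof.
move=> P0max P.
have -> : \sum_(i | P i) w i = \sum_(i in [set i | P i]) w i.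
  by apply: eq_bigl => i; rewrite inE.
have -> : #|union P| = #|union (fun i => i \in [set i | P i])|.
  apply: eq_card => u; rewrite !inE; apply: eq_existsb => i.
  by rewrite /= inE.
have := P0max [set i | P i]; rewrite /carleson_ratio.
set U := #|union (fun i => i \in [set i | P i])|.
have [U0 _|U0] := posnP U; last by rewrite ler_pdivrMr ?ltr0n.
rewrite U0 mulr0 big1// => i iP.
have : base i \in union (fun i => i \in [set i | P i]).
  by rewrite inE; apply/existsP; exists i; rewrite /= iP in_rect_base.
by move/card0_eq: U0 => ->.
Qed.

Lemma sq_avg_ind (P : pred G) i : P i -> av i (ind (union P)) = 1.
Proof.
move=> Pi; rewrite -[RHS](cexp_cst (e12 e1 e2 (l1 i) (l2 i)) 1 (base i)); apply: eq_cexp => v vi.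
by rewrite /=; case: existsP => // -[]; exists i; rewrite Pi /in_rect vi /=.
Qed.

Variables (P0 : {set G}) (A p : R).
Hypotheses (A0 : 0 <= A) (p0 : 0 < p).
Hypothesis P0max : forall P, carleson_ratio P <= carleson_ratio P0.
Hypothesis bnd : paraproduct_bounded n e1 e2 l1 l2 base p p w A.
Let K := carleson_ratio P0.
Let m : R := #|union (fun i => i \in P0)|%:R.
Let K0 : 0 <= K := carleson_ratio_ge0 P0.
Let KC := carleson_max P0max.

Let bnd' f : \sum_u sq (fun i => w i * av i f ^+ 2) u `^ (p / 2) <=
  A `^ p * \sum_u smax n e1 e2 f u `^ p.
Proof.
apply: le_trans (bnd f) _; rewrite powRM ?powR_ge0//.
rewrite powRV_powRK ?gt_eqF//.
by apply: sumr_ge0 => u _; exact: powR_ge0.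
Qed.

Let sumP0 : \sum_(i in P0) w i = K * m.
Proof.
rewrite /K /m /carleson_ratio; have [U0|U0] := eqVneq (#|union (fun i => i \in P0)|%:R : R) 0.
  rewrite U0 mulr0; apply/le_anti; rewrite sumr_ge0 ?andbT//.
  by have := KC (fun i => i \in P0); rewrite U0 mulr0.
by rewrite divfK.
Qed.

(** Since the maximal function of an indicator is at most 1, its power [p] is below its square and
    the [L^2] bound applies. The restricted square function lives on the union, so Hoelder brings
    its sum back from the exponent [p / 2]. *)
Lemma carleson_lower_ge2 : 2 <= p -> 0 < m -> K <= 16 `^ (2 / p) * A ^+ 2.
Proof.
move=> p2 m0.
pose w' i := if i \in P0 then w i else 0.
have w'0 i : 0 <= w' i by rewrite /w'; case: ifP.
set f := ind (union (fun i => i \in P0)).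
have H1 : \sum_u sq w' u `^ (p / 2) <= A `^ p * (16 * m).
  apply: le_trans (le_trans (bnd' f) _).
    apply: ler_sum => u _; apply: ge0_ler_powR; rewrite ?nnegrE ?sqfun_ge0 ?divr_ge0 ?(ltW p0)//.
      by move=> i; rewrite mulr_ge0 ?sqr_ge0.
    apply: sqfun_le => i _; rewrite /w'; case: ifP => iP; last by rewrite mulr_ge0 ?sqr_ge0.
    by rewrite sq_avg_ind// expr1n mulr1.
  rewrite ler_wpM2l ?powR_ge0//.
  have := smax_L2 bif f; under [in X in _ <= X -> _]eq_bigr do rewrite expr2 -natrM mulnb andbb.
  rewrite sum_ind -/m; apply: le_trans; apply: ler_sum => u _.
  have s0 := smax_ge0 n e1 e2 f u.
  have s1 : smax n e1 e2 f u <= 1.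
    apply: smax_le => // i j _ _; rewrite ger0_norm ?cexp_ge0//.
    rewrite -[leRHS](cexp_cst (e12 e1 e2 i j) 1 u); apply: cexp_le => v _.
    by rewrite /f lern1 leq_b1.
  move: s0; rewrite le_eqVlt => /orP[/eqP<-|s0]; first by rewrite powR0 ?expr0n ?gt_eqF.
  by rewrite -(powR_mulrn 2) ?(ltW s0)//; apply: ger_powR; rewrite ?s0.
have H2 : K * m <= (\sum_u sq w' u `^ (p / 2)) `^ (2 / p) * m `^ (1 - 2 / p).
  rewrite -sumP0 big_mkcond -/w' -(sum_sqfun e1 e2 l1 l2 base).
  move: p2; rewrite le_eqVlt => /orP[/eqP<-|p2].
    rewrite mulfV ?gt_eqF// subrr powRr0 mulr1 powRr1 ?sumr_ge0//; last first.
      by move=> u _; exact: powR_ge0.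
    by under [leRHS]eq_bigr do rewrite powRr1 ?sqfun_ge0//.
  have p21 : 0 < 2 / p < 1 by rewrite divr_gt0//= ltr_pdivrMr// mul1r.
  have := sum_holder p21 (fun u => powR_ge0 (sq w' u) (p / 2)) (fun u => ler0n _ (union (fun i => i \in P0) u)).
  rewrite sum_ind; apply: le_trans; apply: ler_sum => u _.
  have [uP|uP] := boolP (union (fun i => i \in P0) u).
    rewrite powR1 mulr1 -powRrM (_ : p / 2 * (2 / p) = 1) ?powRr1 ?sqfun_ge0//.
    by field; rewrite gt_eqF.
  rewrite (sum_card_union _ uP) ?mulr_ge0 ?powR_ge0// => i.
  by rewrite /w' /= => /negPf->.
have H3 : K * m <= (A `^ p * 16 * m) `^ (2 / p) * m `^ (1 - 2 / p).
  apply: le_trans H2 _; rewrite ler_wpM2r ?powR_ge0//.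
  apply: ge0_ler_powR; rewrite ?nnegrE ?divr_ge0 ?sumr_ge0 ?mulr_ge0 ?powR_ge0 ?(ltW p0) ?(ltW m0)//.
    by move=> u _; exact: powR_ge0.
  by rewrite -mulrA.
move: H3; rewrite [X in X `^ _]mulrC powRM ?mulr_ge0 ?powR_ge0 ?(ltW m0)//.
rewrite [X in _ <= X -> _]mulrAC -powRD ?(gt_eqF m0) ?implybT// addrC subrK powRr1 ?(ltW m0)//.
rewrite mulrC ler_pM2l// => H; apply: le_trans H _.
rewrite powRM ?powR_ge0// -powRrM (_ : p * (2 / p) = 2%:R) ?powR_mulrn// mulrC//.
by field; rewrite gt_eqF.
Qed.

(** Chosen so that [4 * 16 * 28 * carleson_eps = 1 / 2]: Chebyshev at height 1/2, the maximal
    inequality and [sum_test_err]. *)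
Definition carleson_eps : R := 3584^-1.

(** The exponent [t] solves [q / 2 * t + 2 * (1 - t) = 1], that is, it interpolates the sum of the
    squared square function between the exponents [q / 2] and [2]. The outer power comes from the
    absorption of [K]. *)
Definition carleson_cst (q : R) : R :=
  let t := 2 / (4 - q) in
  (2 * ((4 `^ (q / 2) * ((16 * 58) `^ (q / 2) *
    (16 * carleson_eps ^- 4) `^ (1 - q / 2))) `^ t *
   (smax_cst (4 / (4 - 2)) `^ ((1 - 2 / 4) * (4 / 2))) `^ (1 - t))) `^ (q * t / 2)^-1.

Lemma carleson_lower_lt2 : p < 2 -> 0 < m -> K <= carleson_cst p * A ^+ 2.
Proof.
move=> p2 m0.
have eps01 : 0 < carleson_eps < 1.
  by rewrite /carleson_eps invr_gt0 ltr0n/= invf_lt1 ?ltr0n// ltr1n.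
set f := test_fun n e1 e2 (union (fun i => i \in P0)) carleson_eps.
pose err u := (union (fun i => i \in P0) u)%:R - f u.
pose bad : pred G := fun i => (i \in P0) && (2^-1 < `|av i err|).
pose good : pred G := fun i => (i \in P0) && (`|av i err| <= 2^-1).
(* A bad rectangle lies where the maximal function of the error is at least 1/2. *)
have cardbad : #|union bad|%:R <= m / 2.
  have : \sum_u (union bad u)%:R <= 4 * \sum_u smax n e1 e2 err u ^+ 2.
    rewrite mulr_sumr; apply: ler_sum => u _.
    case: (boolP (union bad u)) => [/existsP[i /andP[/andP[_ ib] iu]]|_]; last first.
      by rewrite mulr_ge0 ?sqr_ge0.
    have h : 2^-1 <= smax n e1 e2 err u.
      by apply: le_trans (ltW ib) _; exact: rect_avg_smax.
    have h0 : 0 <= 2^-1 :> R by [].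
    have : 2^-1 ^+ 2 <= smax n e1 e2 err u ^+ 2 by rewrite ler_sqr ?nnegrE ?smax_ge0.
    have -> : 2^-1 ^+ 2 = 4^-1 :> R by rewrite exprVn -natrX.
    rewrite /=; lra.
  rewrite sum_ind => H; apply: le_trans H _.
  have h1 := smax_L2 bif err; have h2 := sum_test_err bif (union (fun i => i \in P0)) eps01.
  rewrite -/f -/m in h2.
  have -> : m / 2 = 4 * (16 * (28 * carleson_eps * m)) by rewrite /carleson_eps; field.
  by rewrite ler_pM2l//; apply: le_trans h1 _; rewrite ler_pM2l.
(* The whole family carries exactly [K * m], while the bad rectangles carry at most [K] times the
   size of their union: half of it. *)
have sumgood : K * m / 2 <= \sum_(i | good i) w i.
  have h1 : \sum_(i in P0) w i = \sum_(i | bad i) w i + \sum_(i | good i) w i.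
    by rewrite (bigID (fun i => 2^-1 < `|av i err|))/=; congr (_ + _);
      apply: eq_bigl => i; rewrite /good -?leNgt.
  have h2 := KC bad; have := ler_wpM2l K0 cardbad.
  move: sumP0 h2; rewrite h1 -/K; set a := \sum_(i | bad i) _; set b := \sum_(i | good i) _.
  set u := #|_|%:R; move=> e1' e2' e3'; lra.
pose a i : R := (good i)%:R.
have a0 i : 0 <= a i by [].
pose w' i := w i * a i ^+ 2.
have w'0 i : 0 <= w' i by rewrite mulr_ge0 ?sqr_ge0.
set Z := sq w'.
have Z0 u : 0 <= Z u by exact: sqfun_ge0.
have sumZ : K * m / 2 <= \sum_u Z u.
  rewrite sum_sqfun; apply: le_trans sumgood _.
  rewrite big_mkcond; apply: ler_sum => i _; rewrite /w' /a.
  by case: (good i); rewrite ?expr1n ?mulr1 ?mulr_ge0 ?sqr_ge0.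
have good_avg i : good i -> 2^-1 <= av i f.
  move=> /andP[iP ge]; have : av i err = 1 - av i f.
    by rewrite /err /rect_avg cexpB -/(rect_avg _ _ _ _ _ i _) sq_avg_ind.
  move: ge => /[swap] ->; rewrite ler_norml => /andP[_]; lra.
set c1 := (16 * 58) `^ (p / 2) * (16 * carleson_eps ^- 4) `^ (1 - p / 2).
have c10 : 0 <= c1 by rewrite mulr_ge0 ?powR_ge0.
have sumZp : \sum_u Z u `^ (p / 2) <= 4 `^ (p / 2) * (A `^ p * (c1 * m)).
  have H1 : \sum_u smax n e1 e2 f u `^ p <= c1 * m.
    by apply: sum_smax_test_fun => //; rewrite p0.
  have H2 := ler_wpM2l (powR_ge0 A p) H1.
  apply: le_trans (ler_wpM2l (powR_ge0 4 (p / 2)) (le_trans (bnd' f) H2)).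
  rewrite mulr_sumr; apply: ler_sum => u _.
  have s0 : 0 <= sq (fun i => w i * av i f ^+ 2) u.
    by apply: sqfun_ge0 => i; rewrite mulr_ge0 ?sqr_ge0.
  rewrite -powRM//; apply: ge0_ler_powR; rewrite ?nnegrE ?divr_ge0 ?(ltW p0) ?mulr_ge0//.
  rewrite -sqfunZ; apply: sqfun_le => i _; rewrite /w' [leRHS]mulrCA ler_wpM2l//.
  rewrite /a; case: (boolP (good i)) => [/good_avg h|_]; last first.
    by rewrite expr0n mulr_ge0 ?sqr_ge0.
  have : 2^-1 ^+ 2 <= av i f ^+ 2 by rewrite ler_sqr ?nnegrE//; apply: le_trans h.
  have -> : 2^-1 ^+ 2 = 4^-1 :> R by rewrite exprVn -natrX.
  rewrite expr1n; lra.
pose c4 : R := smax_cst (4 / (4 - 2)) `^ ((1 - 2 / 4) * (4 / 2)).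
have c40 : 0 <= c4 by exact: powR_ge0.
(* The upper bound for the exponent 4, applied to the indicator of the good rectangles. It involves
   [K] itself, which is absorbed at the end because the interpolation leaves it a power below 1. *)
have sumZ2 : \sum_u Z u `^ 2 <= c4 * K `^ 2 * m.
  have := @paraproduct_carleson_gt2 _ _ _ _ _ _ _ bif _ l1 l2 base l1n l2n K w a 4.
  rewrite ltr_nat => /(_ isT K0 w0 a0 KC); rewrite -/c4 -/Z.
  have -> : 4 / 2 = 2 :> R by lra.
  move=> H; apply: le_trans H _; rewrite ler_wpM2l ?mulr_ge0 ?powR_ge0//.
  rewrite /m -sum_ind; apply: ler_sum => u _.
  rewrite powR_mulrn ?rect_max_ge0//.
  have [uP|uP] := boolP (union (fun i => i \in P0) u).
    rewrite -[leRHS](expr1n _ 4) lerXn2r ?nnegrE ?rect_max_ge0//.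
    by apply: rect_max_le => // i _; rewrite /a lern1 leq_b1.
  suff -> : rect_max e1 e2 l1 l2 base a u = 0 by rewrite expr0n.
  apply/le_anti; rewrite rect_max_ge0 andbT; apply: rect_max_le => // i iu.
  have /existsPn/(_ i) := uP; rewrite iu andbT /= => iP.
  by rewrite /a /good (negPf iP).
have [t tE] : {t : R | t = 2 / (4 - p)} by exists (2 / (4 - p)).
have t01 : 0 < t < 1 by rewrite tE divr_gt0 ?ltr_pdivrMr/=; lra.
have /andP[t0 t1] := t01.
have eA : p * t / 2 = 2 * t - 1 by rewrite tE; field; rewrite gt_eqF; lra.
have eB : p / 2 * t + 2 * (1 - t) = 1 by rewrite tE; field; rewrite gt_eqF; lra.
have s01 : 0 < p * t / 2 <= 1.
  have : 0 < p * t / 2 by apply: divr_gt0 => //; exact: mulr_gt0.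
  rewrite eA; lra.
have key : K * m / 2 <= (4 `^ (p / 2) * (A `^ p * c1) * m) `^ t * (c4 * K `^ 2 * m) `^ (1 - t).
  apply: le_trans sumZ _.
  have := sum_holder t01 (fun u => powR_ge0 (Z u) (p / 2)) (fun u => powR_ge0 (Z u) 2).
  under eq_bigr => u _.
    rewrite -!powRrM.
    have -> : Z u `^ (p / 2 * t) * Z u `^ (2 * (1 - t)) = Z u.
      rewrite -powR_mul_sum; [|by rewrite mulr_gt0// divr_gt0|by lra].
      by rewrite eB powRr1.
    over.
  move=> H; apply: le_trans H _.
  have nn (e : R) : 0 <= \sum_u Z u `^ e by apply: sumr_ge0 => u _; exact: powR_ge0.
  apply: ler_pM; rewrite ?powR_ge0//.
    apply: ge0_ler_powR (le_trans sumZp _); rewrite ?nnegrE//; first exact: ltW.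
      by rewrite !mulr_ge0 ?powR_ge0// ltW.
    by rewrite -!mulrA.
  apply: ge0_ler_powR sumZ2; rewrite ?nnegrE//; first by rewrite subr_ge0 ltW.
  by rewrite !mulr_ge0 ?powR_ge0// ltW.
have m0' := ltW m0.
move: key; rewrite powR_interp ?mulr_ge0 ?powR_ge0// mulrAC ler_pM2r// => key.
rewrite /carleson_cst -tE -/c1 -/c4.
apply: powR_absorb => //.
- by rewrite !mulr_ge0 ?powR_ge0.
- exact: sqr_ge0.
have -> : K `^ (1 - p * t / 2) = (K `^ 2) `^ (1 - t).
  by rewrite -powRrM eA; congr (_ `^ _); lra.
have -> : (A ^+ 2) `^ (p * t / 2) = (A `^ p) `^ t.
  by rewrite sqr_powR// -powRrM; congr (_ `^ _); lra.
have Ac0 : 0 <= A `^ p * c1 by rewrite mulr_ge0 ?powR_ge0.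
move: key; rewrite (powRM t (powR_ge0 4 (p / 2)) Ac0) (powRM t (powR_ge0 A p) c10).
rewrite (powRM (1 - t) c40 (powR_ge0 K 2)) (powRM t (powR_ge0 4 (p / 2)) c10).
set x1 := (4 `^ (p / 2)) `^ t; set x2 := (A `^ p) `^ t; set x3 := c1 `^ t.
set x4 := c4 `^ (1 - t); set x5 := (K `^ 2) `^ (1 - t) => key.
have -> : 2 * (x1 * x3 * x4) * (x2 * x5) = 2 * (x1 * (x2 * x3) * (x4 * x5)) by ring.
by rewrite mulrC -ler_pdivrMr.
Qed.

End CarlesonLower.

Lemma carleson_lower (R : realType) (p : R) : 0 < p ->
  exists2 C : R, 0 <= C & forall (X : finType) (L1 L2 : eqType) n e1 e2
    (G : finType) (l1 l2 : G -> nat) (base : G -> X) (w : G -> R) (A : R),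
  @bifiltration R X L1 L2 n e1 e2 ->
  (forall i, (l1 i <= n)%N) -> (forall i, (l2 i <= n)%N) -> (forall i, 0 <= w i) ->
  0 <= A -> paraproduct_bounded n e1 e2 l1 l2 base p p w A ->
  carleson e1 e2 l1 l2 base (C * A ^+ 2) w.
Proof.
move=> p0; exists (16 `^ (2 / p) + carleson_cst p).
  by rewrite addr_ge0 ?powR_ge0.
move=> X L1 L2 n e1 e2 G l1 l2 base w A bif l1n l2n w0 A0 bnd.
case: (@arg_maxP _ _ _ (finset.set0 : {set G}) predT (@carleson_ratio R X L1 L2 e1 e2 G l1 l2 base w) isT) => P0 _ P0max.
have P0max' P : carleson_ratio e1 e2 l1 l2 base w P <= carleson_ratio e1 e2 l1 l2 base w P0.
  exact: P0max.
have KC := carleson_max P0max'.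
move=> P; apply: le_trans (KC P) _; rewrite ler_wpM2r//.
have [m0|m0] := posnP #|rect_union e1 e2 l1 l2 base (fun i => i \in P0)|.
  by rewrite /carleson_ratio m0 invr0 mulr0 mulr_ge0 ?addr_ge0 ?powR_ge0 ?sqr_ge0.
have A20 : 0 <= A ^+ 2 by exact: sqr_ge0.
have m0' : (0 : R) < #|rect_union e1 e2 l1 l2 base (fun i => i \in P0)|%:R by rewrite ltr0n.
rewrite mulrDl; have [p2|p2] := leP 2 p.
  apply: le_trans (carleson_lower_ge2 bif w0 A0 p0 P0max' bnd p2 m0') _.
  by rewrite lerDl mulr_ge0 ?powR_ge0.
apply: le_trans (carleson_lower_lt2 bif l1n l2n w0 A0 p0 P0max' bnd p2 m0') _.
by rewrite lerDr mulr_ge0 ?powR_ge0.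
Qed.

(** * Lower bound by the square function *)

Section Levels.
Variable R : realType.
Implicit Types (x d h r p : R).

Lemma dyadic_level x : 1 <= x -> exists j, 2 ^+ j <= x < 2 ^+ j.+1.
Proof.
move=> x1; have x0 : 0 <= x by apply: le_trans x1.
have ex : exists j, x < 2 ^+ j.+1.
  exists (Num.truncn x).
  apply: (lt_le_trans (truncnS_gt x)); rewrite -natrX ler_nat.
  exact/ltnW/ltn_expl.
case: (ex_minnP ex) => j xj jmin; exists j; rewrite xj andbT.
case: j xj jmin => [|j] xj jmin; first by rewrite expr0.
by rewrite leNgt; apply/negP => /jmin; rewrite ltnn.
Qed.

Definition geo r : R := (1 - 2 `^ (- r))^-1.

Lemma geo_gt1 r : 0 < r -> 1 < geo r.
Proof.
move=> r0; have h1 : 1 < 2 `^ r.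
  have := @gt0_ltr_powR R r r0 1 2; rewrite !nnegrE powR1 => -> //.
  by rewrite ltr1n.
have h : 2 `^ (- r) < 1 by rewrite powRN invf_lt1 ?powR_gt0.
by rewrite /geo invf_gt1 ?subr_gt0// gtrBl powR_gt0.
Qed.

(** The powers grow geometrically, so their sum is at most [geo r] times the last one that does not
    exceed [h ^ r]. *)
Lemma geometric_levels d h r M : 0 < d -> 0 < r -> 0 <= h ->
  \sum_(j < M) (if d * 2 ^+ j <= h then (d * 2 ^+ j) `^ r else 0) <= geo r * h `^ r.
Proof.
move=> d0 r0 h0; have g1 := geo_gt1 r0; have g0 : 0 < geo r by apply: lt_trans g1.
have geoE : geo r * 2 `^ (- r) + 1 = geo r.
  rewrite -[X in _ + X](mulfV (lt0r_neq0 g0)) -mulrDr; rewrite /geo invrK; ring.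
pose b j := (d * 2 ^+ j) `^ r.
have b0 j : 0 <= b j by exact: powR_ge0.
have bS j : b j = 2 `^ (- r) * b j.+1.
  rewrite /b exprS mulrCA [in RHS]powRM ?mulr_ge0 ?exprn_ge0 ?(ltW d0)// mulrA.
  by rewrite powRN mulVf ?mul1r// gt_eqF// powR_gt0.
have sb m : \sum_(j < m.+1) b j <= geo r * b m.
  elim: m => [|m IH]; first by rewrite big_ord1 ler_peMl// ltW.
  rewrite big_ord_recr/=; apply: le_trans (lerD IH (lexx _)) _.
  by rewrite (bS m) mulrA -[X in _ + X]mul1r -mulrDl geoE.
elim: M => [|M IH]; first by rewrite big_ord0 mulr_ge0 ?powR_ge0 ?(ltW g0).
rewrite big_ord_recr/=; case: (leP (d * 2 ^+ M) h) => hM; last by rewrite addr0.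
apply: (@le_trans _ _ (geo r * b M)).
  apply: le_trans (sb M); rewrite big_ord_recr/= lerD2r; apply: ler_sum => j _.
  by case: ifP.
rewrite ler_pM2l//; apply: ge0_ler_powR hM; rewrite ?nnegrE ?(ltW r0)//.
by rewrite mulr_ge0 ?exprn_ge0 ?(ltW d0).
Qed.

Lemma powR_subadd p (a b : R) : 0 < p <= 1 -> 0 <= a -> 0 <= b ->
  (a + b) `^ p <= a `^ p + b `^ p.
Proof.
move=> /andP[p0 p1] a0 b0.
have := addr_ge0 a0 b0; rewrite le_eqVlt => /orP[/eqP<-|ab].
  by rewrite powR0 ?gt_eqF// addr_ge0 ?powR_ge0.
have key (c : R) : 0 <= c -> c <= a + b -> c / (a + b) * (a + b) `^ p <= c `^ p.
  rewrite le_eqVlt => /orP[/eqP<- _|c0 cab]; first by rewrite !mul0r powR_ge0.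
  have -> : c `^ p = (c / (a + b)) `^ p * (a + b) `^ p.
    by rewrite -powRM ?divr_ge0 ?(ltW ab) ?(ltW c0)// divfK// gt_eqF.
  rewrite ler_pM2r ?powR_gt0//; apply: ger1_powR => //.
  by rewrite divr_gt0//= ler_pdivrMr// mul1r.
apply: le_trans (lerD (key a a0 _) (key b b0 _)); rewrite ?lerDl ?lerDr//.
by rewrite -mulrDl -mulrDl mulfV ?mul1r// gt_eqF.
Qed.

Lemma powR_sum_subadd p M (a : nat -> R) : 0 < p <= 1 -> (forall j, 0 <= a j) ->
  (\sum_(j < M) a j) `^ p <= \sum_(j < M) a j `^ p.
Proof.
move=> p01 a0; elim: M => [|M IH].
  by rewrite !big_ord0 powR0// gt_eqF//; case/andP: p01.
rewrite !big_ord_recr/=; apply: le_trans (powR_subadd p01 _ (a0 M)) _.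
  exact: sumr_ge0.
by rewrite lerD2r.
Qed.

(* Signs are chosen one at a time, each making its cross term with the
   partial sum nonnegative. *)
Lemma greedy_signs (G : finType) (mu : G -> R) (v : nat -> G -> R) M :
  exists s : nat -> R, (forall j, `|s j| = 1) /\
    \sum_(j < M) \sum_i mu i * v j i ^+ 2 <=
    \sum_i mu i * (\sum_(j < M) s j * v j i) ^+ 2.
Proof.
elim: M => [|M [s [s1 IH]]].
  exists (fun=> 1); split; first by move=> _; rewrite normr1.
  by rewrite big_ord0 big1// => i _; rewrite big_ord0 expr0n mulr0.
pose c := \sum_i mu i * ((\sum_(j < M) s j * v j i) * v M i).
pose sg : R := if 0 <= c then 1 else -1.
have sgc : 0 <= sg * c.
  by rewrite /sg; case: (leP 0 c) => h; rewrite ?mul1r// mulN1r oppr_ge0 ltW.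
have sg2 : sg ^+ 2 = 1 by rewrite /sg; case: ifP; rewrite ?expr1n// sqrrN expr1n.
exists (fun j => if (j < M)%N then s j else sg); split.
  by move=> j; case: ifP => // _; rewrite /sg; case: ifP; rewrite ?normrN normr1.
have E i : \sum_(j < M.+1) (if (j < M)%N then s j else sg) * v j i =
    \sum_(j < M) s j * v j i + sg * v M i.
  by rewrite big_ord_recr/= ltnn; congr (_ + _); apply: eq_bigr => j _; rewrite ltn_ord.
rewrite big_ord_recr/=; apply: le_trans (lerD IH (lexx _)) _.
rewrite -[leLHS]addr0; apply: (@le_trans _ _ (\sum_i mu i * (\sum_(j < M) s j * v j i) ^+ 2 +
  \sum_i mu i * v M i ^+ 2 + 2 * (sg * c))); first by rewrite lerD2l mulr_ge0.
rewrite /c !mulr_sumr -!big_split/= le_eqVlt; apply/orP; left; apply/eqP.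
apply: eq_bigr => i _; rewrite E.
set x := \sum_(j < M) _; set y := v M i.
have -> : (x + sg * y) ^+ 2 = x ^+ 2 + 2 * (sg * (x * y)) + sg ^+ 2 * y ^+ 2 by ring.
rewrite sg2; ring.
Qed.

End Levels.

Section SquareFunctionLower.
Variables (R : realType) (X : finType) (L1 L2 : eqType) (n : nat).
Variables (e1 : nat -> X -> L1) (e2 : nat -> X -> L2).
Hypothesis bif : @bifiltration R X L1 L2 n e1 e2.
Variables (G : finType) (l1 l2 : G -> nat) (base : G -> X).
Hypotheses (l1n : forall i, (l1 i <= n)%N) (l2n : forall i, (l2 i <= n)%N).
Variables (w : G -> R) (p q r A : R).
Hypothesis w0 : forall i, 0 <= w i.
Hypotheses (p0 : 0 < p) (q0 : 0 < q) (r0 : 0 < r) (pqr : q^-1 = p^-1 + r^-1) (A0 : 0 <= A).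
Local Notation inr := (in_rect e1 e2 l1 l2 base).
Local Notation sq := (sqfun e1 e2 l1 l2 base).
Local Notation av := (rect_avg e1 e2 l1 l2 base).
Local Notation smax := (smax n e1 e2).
Implicit Types (u v : X) (i : G) (f : X -> R).

(* [N i] and [H] are a local and a maximal average of order [low_exp] of the square
   function [S]; that order is below [r], so that [H] is bounded by [S] in [L^r],
   and at least [r - 2], so that for [2 <= r] the average of [S u `^ (r - 2)] over
   the rectangle [i] is at most [N i `^ (r - 2)]. *)
Definition low_exp : R := Num.max (r - 2) (r / 2).
Local Notation beta := low_exp.
Variables (S Sb H : X -> R) (N : G -> R).
Hypothesis SE : forall u, S u = sq w u `^ 2^-1.
Hypothesis SbE : forall u, Sb u = S u `^ beta.
Hypothesis NE : forall i, N i = (av i Sb) `^ beta^-1.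
Hypothesis HE : forall u, H u = (smax Sb u) `^ beta^-1.
Let E : R := \sum_u S u `^ r.
Let Y : R := \sum_i w i * N i `^ (r - 2).
Let alpha : R := r / p.

Let beta0 : 0 < beta. Proof. by rewrite lt_max divr_gt0 ?orbT. Qed.
Let beta_lt : beta < r. Proof. have r0' := r0; by rewrite gt_max; apply/andP; split; lra. Qed.
Let s0 u : 0 <= sq w u. Proof. exact: sqfun_ge0. Qed.
Let S0 u : 0 <= S u. Proof. by rewrite SE powR_ge0. Qed.
Let Sb0 u : 0 <= Sb u. Proof. by rewrite SbE powR_ge0. Qed.
Let N0 i : 0 <= N i. Proof. by rewrite NE powR_ge0. Qed.
Let H0 u : 0 <= H u. Proof. by rewrite HE powR_ge0. Qed.
Let E0 : 0 <= E. Proof. by apply: sumr_ge0 => u _; exact: powR_ge0. Qed.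
Let Y0 : 0 <= Y. Proof. by apply: sumr_ge0 => u _; rewrite mulr_ge0 ?powR_ge0. Qed.
Let alpha0 : 0 < alpha. Proof. exact: divr_gt0. Qed.

Let sq_S u : sq w u = S u ^+ 2.
Proof. by rewrite SE -(powR_mulrn 2) ?powR_ge0// -powRrM mulVf ?powRr1. Qed.

Let NH i u : inr i u -> N i <= H u.
Proof.
move=> iu; rewrite NE HE; apply: ge0_ler_powR; rewrite ?nnegrE ?invr_ge0 ?smax_ge0 ?(ltW beta0) ?rect_avg_ge0//.
by rewrite -[leLHS]ger0_norm ?rect_avg_ge0// rect_avg_smax.
Qed.

Let Npow i : N i `^ beta = av i Sb.
Proof. by rewrite NE powRV_powRK ?rect_avg_ge0// gt_eqF. Qed.

Let S_gt0 i u : 0 < w i -> inr i u -> 0 < S u.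
Proof.
move=> wi iu; rewrite SE; apply: powR_gt0; apply: lt_le_trans (le_sqfun w0 iu).
by rewrite divr_gt0// rect_size_gt0.
Qed.

Let N_gt0 i : 0 < w i -> 0 < N i.
Proof.
move=> wi; rewrite NE; apply: powR_gt0; rewrite rect_avgE divr_gt0 ?rect_size_gt0//.
rewrite (bigD1 (base i)) ?in_rect_base//= ltr_wpDr ?sumr_ge0//.
by rewrite SbE; apply: powR_gt0; apply: S_gt0 wi _; rewrite in_rect_base.
Qed.

Definition low_cH : R := smax_cst (r / beta).
Local Notation cH := low_cH.

Let sumH : \sum_u H u `^ r <= cH * E.
Proof.
have rb : 1 < r / beta by rewrite ltr_pdivlMr// mul1r.
have := smax_Ls bif Sb rb.
have -> : \sum_u `|Sb u| `^ (r / beta) = E.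
  apply: eq_bigr => u _; rewrite ger0_norm// SbE -powRrM; congr (_ `^ _).
  by field; rewrite gt_eqF.
apply: le_trans; rewrite le_eqVlt; apply/orP; left; apply/eqP.
by apply: eq_bigr => u _; rewrite HE -powRrM mulrC.
Qed.

Let cH0 : 0 <= cH. Proof. exact: smax_cst_ge0. Qed.

Definition low_cY : R := 1 + cH `^ ((1 - r / 2) * (r / 2)^-1).

Local Notation cY := low_cY.

Let cY0 : 1 <= cY. Proof. by rewrite lerDl powR_ge0. Qed.

(** The local averages [N i] may replace [S] in the sum of [S ^ 2 * S ^ (r - 2)]. For [2 <= r] this
    is Jensen's inequality. For [r < 2] the exponent is negative: [S ^ (r - 2)] is traded for
    [H ^ (r - 2)], which is at most [N i ^ (r - 2)] on the rectangle [i], and Hoelder with the bound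
    for [H] leaves a power of [E] to absorb. *)
Let EY : E <= cY * Y.
Proof.
have [r2|r2] := leP 2 r.
  suff h : E <= Y by apply: le_trans h _; rewrite ler_peMl.
  have -> : E = \sum_u sq w u * S u `^ (r - 2).
    apply: eq_bigr => u _; have := S0 u; rewrite sq_S le_eqVlt => /orP[/eqP<-|Sp].
      by rewrite expr0n mul0r powR0 ?gt_eqF.
    by rewrite -(powR_mulrn 2) ?(ltW Sp)// -powRD ?(gt_eqF Sp) ?implybT// addrC subrK.
  rewrite sum_sqfunM; apply: ler_sum => i _; rewrite ler_wpM2l//.
  move: r2; rewrite le_eqVlt => /orP[/eqP<-|r2].
    rewrite subrr powRr0 -[leRHS](cexp_cst (e12 e1 e2 (l1 i) (l2 i)) 1 (base i)).
    by apply: cexp_le => v _; rewrite powRr0.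
  have t01 : 0 < (r - 2) / beta <= 1.
    rewrite divr_gt0 ?subr_gt0//= ler_pdivrMr// mul1r /beta le_max lexx//.
  have -> : N i `^ (r - 2) = (av i Sb) `^ ((r - 2) / beta) by rewrite NE -powRrM mulrC.
  apply: le_trans (cexp_jensen _ _ t01 Sb0); apply: cexp_le => v _.
  rewrite SbE -powRrM (_ : beta * _ = r - 2)//; by field; rewrite gt_eqF.
have sumHY : \sum_u sq w u * H u `^ (r - 2) <= Y.
  rewrite sum_sqfunM; apply: ler_sum => i _.
  have := w0 i; rewrite le_eqVlt => /orP[/eqP<-|wi]; first by rewrite !mul0r.
  rewrite ler_pM2l// -[leRHS](cexp_cst (e12 e1 e2 (l1 i) (l2 i)) _ (base i)).
  apply: cexp_le => v /eqP vi; apply: le_powRN; [exact: N_gt0|exact: NH|lra].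
have t01 : 0 < r / 2 < 1 by rewrite divr_gt0//= ltr_pdivrMr// mul1r.
have t01' : 0 < r / 2 <= 1 by case/andP: t01 => -> /ltW.
have key : E <= cH `^ (1 - r / 2) * (Y `^ (r / 2) * E `^ (1 - r / 2)).
  have pw u : S u `^ r <= (sq w u * H u `^ (r - 2)) `^ (r / 2) * (H u `^ r) `^ (1 - r / 2).
    have := S0 u; rewrite le_eqVlt => /orP[/eqP<-|Sp].
      by rewrite powR0 ?gt_eqF// mulr_ge0 ?powR_ge0.
    have Hp : 0 < H u.
      rewrite HE; apply: powR_gt0; apply: lt_le_trans (smax_self bif Sb u).
      by rewrite ger0_norm// SbE; exact: powR_gt0.
    rewrite powRM ?powR_ge0// -mulrA -!powRrM -powRD ?(gt_eqF Hp) ?implybT//.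
    rewrite (_ : _ + _ = 0) ?powRr0 ?mulr1; last by have := r0; lra.
    by rewrite sq_S sqr_powR ?(ltW Sp)// (_ : 2 * (r / 2) = r)//; lra.
  apply: le_trans (ler_sum _ (fun u _ => pw u)) _.
  apply: le_trans (sum_holder t01 _ _) _ => [u|u|]; rewrite ?mulr_ge0 ?powR_ge0//.
  have sH0 : 0 <= \sum_u H u `^ r by apply: sumr_ge0 => u _; exact: powR_ge0.
  have sHY0 : 0 <= \sum_u sq w u * H u `^ (r - 2).
    by apply: sumr_ge0 => u _; rewrite mulr_ge0 ?powR_ge0.
  case/andP: t01 => t0 t1.
  rewrite mulrCA; apply: ler_pM; rewrite ?powR_ge0//.
    by apply: ge0_ler_powR sumHY; rewrite ?nnegrE// ltW.
  rewrite -powRM//; apply: ge0_ler_powR sumH; rewrite ?nnegrE ?(mulr_ge0 cH0 E0)//.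
  by rewrite subr_ge0 ltW.
apply: le_trans (powR_absorb t01' (powR_ge0 _ _) E0 Y0 key) _.
by rewrite -powRrM ler_wpM2r// lerDr.
Qed.

(** The average of [S ^ low_exp] over the rectangle [i] is [N i ^ low_exp], so by Chebyshev [S]
    exceeds [low_lam * N i] on at most an eighth of it. *)
Definition low_lam : R := 8 `^ beta^-1.
Local Notation lam := low_lam.
Let lam0 : 0 < lam. Proof. exact: powR_gt0. Qed.

Let large_S i : 0 < w i -> av i (fun u => (lam * N i < S u)%R%:R : R) <= 8^-1.
Proof.
move=> wi; have Np := N_gt0 wi; have avp : 0 < av i Sb by rewrite -Npow powR_gt0.
have pw u : (lam * N i < S u)%R%:R <= (8 * av i Sb)^-1 * Sb u.
  have c0 : 0 < 8 * av i Sb by rewrite mulr_gt0.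
  case: ltP => [h|_]; last by rewrite mulr_ge0 ?invr_ge0 ?(ltW c0).
  rewrite ler_pdivlMl// mulr1 -Npow.
  have -> : 8 = lam `^ beta by rewrite /low_lam powRV_powRK ?gt_eqF.
  rewrite -powRM ?(ltW lam0)// SbE.
  apply: ge0_ler_powR (ltW h); rewrite ?nnegrE ?(mulr_ge0 (ltW lam0) (N0 i)) ?(ltW beta0)//.
apply: le_trans (rect_avg_le (fun u _ => pw u)) _.
rewrite /rect_avg cexpZ -/(av i Sb) invfM -mulrA mulVf ?mulr1// gt_eqF//.
Qed.

(* A bad rectangle [i] has a subset of proportion at least [1 / 8] on which
   [S u <= lam * N i] and [D * N i < Phi u]; integrate [w i * N i `^ (r - 2)] there. *)
Lemma bad_rect_sum (bad : pred G) (Phi : X -> R) (D : R) : 0 < D -> (forall u, 0 <= Phi u) ->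
  (forall i, bad i -> 0 < w i -> 4^-1 <= av i (fun u => (D * N i < Phi u)%R%:R : R)) ->
  \sum_(i | bad i) w i * N i `^ (r - 2) <= 8 * lam ^+ 2 * D^-1 `^ r * \sum_u Phi u `^ r.
Proof.
move=> D0 Phi0 badP.
pose I i u := (D * N i < Phi u) && (S u <= lam * N i).
have h1 : \sum_(i | bad i) w i * N i `^ (r - 2) <=
    \sum_i 8 * (w i * N i `^ (r - 2) * av i (fun u => (I i u)%:R : R)).
  rewrite big_mkcond; apply: ler_sum => i _.
  have r1 : 0 <= w i * N i `^ (r - 2) by rewrite mulr_ge0 ?powR_ge0.
  case: ifP => bi; last by rewrite mulr_ge0// mulr_ge0// rect_avg_ge0.
  have := w0 i; rewrite le_eqVlt => /orP[/eqP<-|wi]; first by rewrite !mul0r mulr0.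
  rewrite mulrCA ler_peMr// -ler_pdivrMl// mulr1.
  have h := badP _ bi wi; have h' := large_S wi.
  have : av i (fun u => (D * N i < Phi u)%R%:R - (lam * N i < S u)%R%:R : R) <= av i (fun u => (I i u)%:R : R).
    apply: rect_avg_le => u _; rewrite /I.
    by case: (_ < Phi u)%R; case: (leP (S u) (lam * N i)) => _ /=;
      rewrite ?subrr ?subr0 ?sub0r ?lerN10.
  rewrite [X in X <= _]/rect_avg cexpB -/(av i _) -/(av i _); lra.
apply: le_trans h1 _; rewrite -mulr_sumr.
have -> : 8 * lam ^+ 2 * D^-1 `^ r * \sum_u Phi u `^ r =
    8 * \sum_u lam ^+ 2 * (D^-1 `^ r * Phi u `^ r) by rewrite -!mulr_sumr; ring.
rewrite ler_pM2l//.
have -> : \sum_i w i * N i `^ (r - 2) * av i (fun u => (I i u)%:R : R) =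
   \sum_u sq (fun i => w i * N i `^ (r - 2) * (I i u)%:R : R) u.
  transitivity (\sum_i \sum_(u | inr i u) w i * N i `^ (r - 2) * (I i u)%:R / rect_size R e1 e2 l1 l2 base i).
    apply: eq_bigr => i _; rewrite rect_avgE mulr_suml mulr_sumr.
    by apply: eq_bigr => u _; rewrite !mulrA.
  by rewrite (exchange_big_dep predT).
apply: ler_sum => u _.
have PD0 : 0 <= Phi u / D by rewrite divr_ge0 ?(ltW D0).
have -> : lam ^+ 2 * (D^-1 `^ r * Phi u `^ r) = lam ^+ 2 * (Phi u / D) `^ r.
  by rewrite mulrC -powRM ?invr_ge0 ?(ltW D0)// [_^-1 * _]mulrC mulrC.
have [/existsP[j /andP[ju /andP[Pj Sj]]]|none] := boolP [exists i, inr i u && I i u]; last first.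
  rewrite /sqfun big1 ?mulr_ge0 ?sqr_ge0 ?powR_ge0// => i iu.
  by have /existsPn/(_ i) := none; rewrite iu /= => /negPf->; rewrite mulr0 mul0r.
have SPhi : S u <= lam * (Phi u / D).
  apply: le_trans Sj _; rewrite ler_pM2l// ler_pdivlMr// mulrC; exact: ltW.
(* According to the sign of [r - 2], [N i ^ (r - 2)] is bounded through [N i < Phi u / D] or through
   [S u / lam <= N i]. The weights then add up to [S u ^ 2], and [S u <= lam * (Phi u / D)] finishes
   both cases. *)
have [r2|r2] := leP 2 r.
  apply: (@le_trans _ _ (sq (fun i => (Phi u / D) `^ (r - 2) * w i) u)).
    apply: sqfun_le => i iu; rewrite -mulrA [leRHS]mulrC ler_wpM2l//.
    rewrite /I; case: (ltP (D * N i) (Phi u)) => [h|_]; last by rewrite mulr0 powR_ge0.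
    apply: le_trans (_ : N i `^ (r - 2) <= _).
      by rewrite ler_piMr ?powR_ge0// lern1 leq_b1.
    apply: ge0_ler_powR; rewrite ?nnegrE ?subr_ge0//.
    by rewrite ler_pdivlMr// mulrC ltW.
  rewrite sqfunZ sq_S.
  apply: (@le_trans _ _ ((Phi u / D) `^ (r - 2) * (lam * (Phi u / D)) ^+ 2)).
    by rewrite ler_wpM2l ?powR_ge0// ler_sqr ?nnegrE ?(mulr_ge0 (ltW lam0) PD0).
  rewrite exprMn mulrCA ler_wpM2l ?sqr_ge0//.
  move: PD0; rewrite le_eqVlt => /orP[/eqP<-|PD0]; first by rewrite expr0n mulr0 powR_ge0.
  by rewrite -(powR_mulrn 2) ?(ltW PD0)// -powRD ?(gt_eqF PD0) ?implybT// subrK.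
have := S0 u; rewrite le_eqVlt => /orP[/eqP Su0|Sp].
  rewrite /sqfun big1 ?mulr_ge0 ?sqr_ge0 ?powR_ge0// => i iu.
  have -> : w i = 0; last by rewrite !mul0r.
  apply/eqP; rewrite eq_le w0 andbT leNgt; apply/negP => wi.
  by have := S_gt0 wi iu; rewrite -Su0 ltxx.
apply: (@le_trans _ _ (sq (fun i => (S u / lam) `^ (r - 2) * w i) u)).
  apply: sqfun_le => i iu; rewrite -mulrA [leRHS]mulrC ler_wpM2l//.
  rewrite /I andbC; case: (leP (S u) (lam * N i)) => [h|_]; last by rewrite mulr0 powR_ge0.
  apply: le_trans (_ : N i `^ (r - 2) <= _).
    by rewrite ler_piMr ?powR_ge0// lern1 leq_b1.
  apply: le_powRN; first by rewrite divr_gt0.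
    by rewrite ler_pdivrMr// mulrC.
  lra.
rewrite sqfunZ sq_S.
have -> : (S u / lam) `^ (r - 2) * S u ^+ 2 = lam ^+ 2 * (S u / lam) `^ r.
  have Sl : 0 < S u / lam by rewrite divr_gt0.
  have -> : (S u / lam) `^ r = (S u / lam) `^ (r - 2) * (S u / lam) ^+ 2.
    by rewrite -(powR_mulrn 2) ?(ltW Sl)// -powRD ?(gt_eqF Sl) ?implybT// subrK.
  by rewrite expr_div_n; field; rewrite gt_eqF.
rewrite ler_wpM2l ?sqr_ge0//; apply: ge0_ler_powR; rewrite ?nnegrE ?PD0 ?(divr_ge0 (S0 u) (ltW lam0)) ?(ltW r0)//.
by rewrite ler_pdivrMr// mulrC.
Qed.

Let alphaq : (1 + alpha) * q = r.
Proof.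
have : r * q^-1 = alpha + 1 by rewrite pqr mulrDr mulfV ?gt_eqF.
by rewrite addrC => <-; rewrite mulfVK ?gt_eqF.
Qed.

Let qr01 : 0 < q / r < 1.
Proof.
rewrite divr_gt0//= ltr_pdivrMr// mul1r -alphaq mulrC ltr_pMr// ltrDl//.
Qed.

Let qp : q / p = 1 - q / r.
Proof.
apply: (mulfI (x := q^-1)); first by rewrite invr_eq0 gt_eqF.
by rewrite mulrBr !mulKf ?gt_eqF// mulr1 pqr addrK.
Qed.

(** Makes [8 * low_lam ^ 2 * D ^ (- r) * c3 * low_cY] at most 1/4 in [bad_rect_sum]; the added 1
    keeps [D] positive when [c3 = 0]. *)
Definition low_D c3 : R := (32 * lam ^+ 2 * c3 * cY + 1) `^ r^-1.
Definition low_c5 c0 c3 : R := 2^-1 * (lam * low_D c3 `^ alpha) `^ (q - 2) * c0 ^+ 2.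
Definition low_cst c0 c3 : R := (cY * 2 * (low_c5 c0 c3)^-1 * c3 `^ (q / p)) `^ (q / r)^-1.

(* The test function [f] may depend on the weights [mu], which come from linearizing
   the power [q / 2] of the square function by means of [F] alone. *)
Lemma lower_core c0 c3 (F : X -> R) (good : pred G) (b : G -> R) :
  q <= 2 -> 0 < c0 -> 0 <= c3 -> (forall u, 0 <= F u) ->
  \sum_u F u `^ p <= c3 * E ->
  (forall i, good i -> 0 < w i -> c0 * N i `^ alpha <= b i) ->
  (forall i u, good i -> 0 < w i -> inr i u -> c0 * N i `^ alpha <= F u) ->
  \sum_(i | ~~ good i) w i * N i `^ (r - 2) <= 4^-1 * Y ->
  (forall mu : G -> R, (forall i, 0 <= mu i) ->
    exists f, (forall u, smax f u <= F u) /\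
      \sum_(i | good i) mu i * b i ^+ 2 <= \sum_i mu i * av i f ^+ 2) ->
  paraproduct_bounded n e1 e2 l1 l2 base p q w A ->
  E <= low_cst c0 c3 * A `^ r.
Proof.
move=> q2 c00 c30 F0 sumF gb gF badY exf bnd.
have cY0' : 0 < cY by apply: lt_le_trans cY0.
have lam2 : 0 < lam ^+ 2 by rewrite exprn_gt0.
set D := low_D c3.
have Dr : D `^ r = 32 * lam ^+ 2 * c3 * cY + 1.
  rewrite powRV_powRK ?gt_eqF// addr_ge0// mulr_ge0 ?(ltW cY0')// mulr_ge0//.
  by rewrite mulr_ge0 ?(ltW lam2).
have Dr0 : 0 < D `^ r by rewrite Dr ltr_wpDl// mulr_ge0 ?(ltW cY0')// mulr_ge0// mulr_ge0 ?(ltW lam2).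
have D0 : 0 < D.
  rewrite lt_def powR_ge0 andbT; apply/negP => /eqP Dz.
  by move: Dr0; rewrite Dz powR0 ?ltxx// gt_eqF.
(* [F] has the size of [N i ^ alpha]; this root is comparable with [N i], and its power [r] is
   [F ^ p]. *)
pose Phi u := F u `^ alpha^-1.
have Phi0 u : 0 <= Phi u by exact: powR_ge0.
pose bad : pred G := fun i => 4^-1 <= av i (fun u => (D * N i < Phi u)%R%:R : R).
have sumbad : \sum_(i | bad i) w i * N i `^ (r - 2) <= 4^-1 * Y.
  apply: le_trans (bad_rect_sum D0 Phi0 (bad := bad) _) _; first by [].
  have -> : \sum_u Phi u `^ r = \sum_u F u `^ p.
    apply: eq_bigr => u _; rewrite /Phi -powRrM; congr (_ `^ _).
    by rewrite /alpha invf_div divfK// gt_eqF.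
  have h : \sum_u F u `^ p <= c3 * (cY * Y).
    by apply: le_trans sumF _; rewrite ler_wpM2l.
  rewrite powRV ?(ltW D0)//.
  have c8 : 0 <= 8 * lam ^+ 2 / D `^ r by rewrite divr_ge0 ?(ltW Dr0)// mulr_ge0// ltW.
  apply: le_trans (ler_wpM2l c8 h) _.
  rewrite mulrAC ler_pdivrMr// Dr.
  have : 0 <= Y by [].
  set z := lam ^+ 2; set y := Y; move=> y0; rewrite -subr_ge0.
  suff -> : 4^-1 * y * (32 * z * c3 * cY + 1) - 8 * z * (c3 * (cY * y)) = 4^-1 * y.
    by rewrite mulr_ge0.
  by field.
have sumgg : 2^-1 * Y <= \sum_(i | good i && ~~ bad i) w i * N i `^ (r - 2).
  have t0 i : 0 <= w i * N i `^ (r - 2) by rewrite mulr_ge0 ?powR_ge0.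
  have : Y <= \sum_(i | ~~ good i) w i * N i `^ (r - 2) + \sum_(i | bad i) w i * N i `^ (r - 2)
      + \sum_(i | good i && ~~ bad i) w i * N i `^ (r - 2).
    rewrite [X in X + _ + _]big_mkcond [X in _ + X + _]big_mkcond [X in _ + _ + X]big_mkcond.
    rewrite -!big_split; apply: ler_sum => i _.
    by case: (good i); case: (bad i); rewrite /= ?addr0 ?add0r// lerDl.
  move: badY sumbad; set a := \sum_(i | ~~ _) _; set a' := \sum_(i | bad i) _; set a'' := \sum_(i | _ && _) _.
  by move=> h1 h2 h3; lra.
(* As the squared square function [Z] of [pi_g f] is at most [(S * F) ^ 2] and [q <= 2], one has
   [Z * (S * F) ^ (q - 2) <= Z ^ (q / 2)]; the left side is linear in [Z], and these are its
   coefficients. *)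
pose mu i := w i * av i (fun u => (S u * F u) `^ (q - 2)).
have mu0 i : 0 <= mu i by rewrite mulr_ge0 ?rect_avg_ge0// => u; exact: powR_ge0.
have c50 : 0 < low_c5 c0 c3.
  apply: mulr_gt0; last exact: exprn_gt0.
  apply: mulr_gt0; first by rewrite invr_gt0.
  by apply: powR_gt0; apply: mulr_gt0 => //; exact: powR_gt0.
have ggi i : good i -> ~~ bad i -> low_c5 c0 c3 * (w i * N i `^ (r - 2)) <= mu i * b i ^+ 2.
  move=> gi bi; have := w0 i; rewrite le_eqVlt => /orP[/eqP wi|wi].
    by rewrite /mu -wi !mul0r mulr0.
  have Np := N_gt0 wi.
  set V := (lam * N i * (D * N i) `^ alpha) `^ (q - 2).
  have V0 : 0 < V.
    apply: powR_gt0; apply: mulr_gt0; first exact: mulr_gt0.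
    by apply: powR_gt0; exact: mulr_gt0.
  have avV : 2^-1 * V <= av i (fun u => (S u * F u) `^ (q - 2)).
    (* Outside portions of at most 1/8 and less than 1/4 of the rectangle, [S <= lam * N i] and
       [F <= (D * N i) ^ alpha], so the weight is at least [V] on more than half of it. *)
    have h1 := large_S wi.
    have h2 : av i (fun u => (D * N i < Phi u)%R%:R : R) < 4^-1 by rewrite ltNge.
    have h3 : av i (fun u => V * (1 - (D * N i < Phi u)%R%:R - (lam * N i < S u)%R%:R)) <=
              av i (fun u => (S u * F u) `^ (q - 2)).
      apply: rect_avg_le => u iu.
      have Sp := S_gt0 wi iu.
      have Fp : 0 < F u.
        by apply: lt_le_trans (gF _ _ gi wi iu); rewrite mulr_gt0 ?powR_gt0.
      case: (leP (Phi u) (D * N i)) => [hP|_] /=; last first.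
        apply: le_trans (powR_ge0 _ _); rewrite pmulr_rle0// subrr sub0r oppr_le0//.
      case: (leP (S u) (lam * N i)) => [hS|_] /=; last first.
        by rewrite subr0 subrr mulr0 powR_ge0.
      rewrite !subr0 mulr1; apply: le_powRN; first exact: mulr_gt0.
        apply: ler_pM; rewrite ?(ltW Sp) ?(ltW Fp)//.
        have -> : F u = Phi u `^ alpha by rewrite /Phi powRV_powRK ?gt_eqF// ltW.
        by apply: ge0_ler_powR hP; rewrite ?nnegrE ?(ltW alpha0)// mulr_ge0 ?(ltW D0).
      by rewrite subr_le0.
    apply: le_trans h3; rewrite [leRHS]/rect_avg cexpZ !cexpB cexp_cst.
    rewrite -/(av i (fun u => (D * N i < Phi u)%R%:R)) -/(av i (fun u => (lam * N i < S u)%R%:R)).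
    by rewrite mulrC ler_pM2l//; lra.
  have bi0 : 0 <= c0 * N i `^ alpha by rewrite mulr_ge0 ?powR_ge0 ?ltW.
  have b2 : (c0 * N i `^ alpha) ^+ 2 <= b i ^+ 2.
    by rewrite ler_sqr ?nnegrE ?gb//; apply: le_trans (gb _ gi wi).
  apply: (@le_trans _ _ (w i * (2^-1 * V) * (c0 * N i `^ alpha) ^+ 2)); last first.
    have V2 : 0 <= 2^-1 * V by apply: mulr_ge0; [rewrite invr_ge0|exact: ltW].
    rewrite /mu; apply: (ler_pM _ (sqr_ge0 _) _ b2); first exact: mulr_ge0 (ltW wi) V2.
    by rewrite ler_pM2l.
  have -> : V = (lam * D `^ alpha) `^ (q - 2) * N i `^ ((1 + alpha) * (q - 2)).
    have eN : N i `^ ((1 + alpha) * (q - 2)) = (N i * N i `^ alpha) `^ (q - 2).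
      by rewrite powRrM (powR_mul_sum _ ltr01 alpha0) powRr1 ?(ltW Np).
    have nn x : 0 <= x `^ alpha :> R by exact: powR_ge0.
    rewrite eN -(powRM _ (mulr_ge0 (ltW lam0) (nn _)) (mulr_ge0 (ltW Np) (nn _))).
    by rewrite /V (powRM _ (ltW D0) (ltW Np)) mulrACA.
  rewrite exprMn powR_sqr//.
  (* The exponents match because [(1 + alpha) * q = r]. *)
  have -> : N i `^ (r - 2) = N i `^ ((1 + alpha) * (q - 2)) * N i `^ (2 * alpha).
    rewrite -powRD ?(gt_eqF Np) ?implybT//; congr (_ `^ _).
    by rewrite mulrBr alphaq; ring.
  rewrite /low_c5 -/D le_eqVlt; apply/orP; left; apply/eqP.
  set z1 := (_ * _) `^ (q - 2); set z2 := N i `^ _; set z3 := N i `^ _; ring.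
have [f [fF fQ]] := exf mu mu0.
have muY : low_c5 c0 c3 * (2^-1 * Y) <= \sum_(i | good i) mu i * b i ^+ 2.
  apply: le_trans (ler_wpM2l (ltW c50) sumgg) _; rewrite mulr_sumr.
  rewrite big_mkcond [leRHS]big_mkcond; apply: ler_sum => i _.
  case: (boolP (good i)) => //= gi; case: (boolP (bad i)) => //= bi.
    by rewrite mulr_ge0 ?sqr_ge0.
  exact: ggi.
have Sf : \sum_i mu i * av i f ^+ 2 <= \sum_u sq (fun i => w i * av i f ^+ 2) u `^ (q / 2).
  have -> : \sum_i mu i * av i f ^+ 2 = \sum_u sq (fun i => w i * av i f ^+ 2) u * (S u * F u) `^ (q - 2).
    by rewrite sum_sqfunM; apply: eq_bigr => i _; rewrite /mu mulrAC.
  apply: ler_sum => u _; set Z := sq _ u.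
  have Z0 : 0 <= Z by apply: sqfun_ge0 => i; rewrite mulr_ge0 ?sqr_ge0.
  have ZSF : Z <= (S u * F u) ^+ 2.
    rewrite exprMn -sq_S mulrC -sqfunZ; apply: sqfun_le => i iu.
    rewrite mulrC ler_wpM2r// -real_normK ?num_real// ler_sqr ?nnegrE//.
    by apply: le_trans (fF u); exact: rect_avg_smax.
  have SF0 : 0 <= S u * F u by rewrite mulr_ge0.
  move: Z0; rewrite le_eqVlt => /orP[/eqP<-|Zp]; first by rewrite mul0r powR_ge0.
  have SFp : 0 < S u * F u.
    rewrite lt_def SF0 andbT; apply/negP => /eqP SFz.
    by move: ZSF; rewrite SFz expr0n leNgt Zp.
  have -> : (S u * F u) `^ (q - 2) = ((S u * F u) ^+ 2) `^ (q / 2 - 1).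
    by rewrite sqr_powR// mulrBr mulr1 mulrCA mulfV ?mulr1.
  rewrite -[leRHS](@mulr_powRB1 _ Z) ?(ltW Zp) ?divr_gt0// ler_pM2l//.
  by apply: le_powRN => //; rewrite subr_le0 ler_pdivrMr// mul1r.
have sm : (A * (\sum_u smax f u `^ p) `^ p^-1) `^ q <= A `^ q * (c3 * E) `^ (q / p).
  have sp0 : 0 <= \sum_u smax f u `^ p by apply: sumr_ge0 => u _; exact: powR_ge0.
  rewrite powRM ?powR_ge0// ler_wpM2l ?powR_ge0// -powRrM mulrC.
  apply: ge0_ler_powR; rewrite ?nnegrE ?(mulr_ge0 c30 E0) ?divr_ge0 ?(ltW p0) ?(ltW q0)//.
  apply: le_trans sumF; apply: ler_sum => u _.
  by apply: ge0_ler_powR (fF u); rewrite ?nnegrE ?smax_ge0 ?(ltW p0).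
have key : Y <= 2 * (low_c5 c0 c3)^-1 * (A `^ q * (c3 * E) `^ (q / p)).
  have h := le_trans (le_trans (le_trans (le_trans muY fQ) Sf) (bnd f)) sm.
  rewrite -mulrA -ler_pdivrMl// ler_pdivlMl// .
have [qr0 qr1] := andP qr01.
have c0' : 0 <= cY * 2 * (low_c5 c0 c3)^-1 * c3 `^ (q / p).
  by rewrite mulr_ge0 ?powR_ge0// mulr_ge0 ?invr_ge0 ?(ltW c50)// mulr_ge0// ltW.
apply: powR_absorb => //; first by rewrite qr0 ltW.
  exact: powR_ge0.
apply: le_trans EY _; rewrite -qp -powRrM.
have -> : r * (q / r) = q by rewrite mulrCA mulfV ?mulr1// gt_eqF.
apply: le_trans (ler_wpM2l (ltW cY0') key) _.
rewrite (powRM (q / p) c30 E0) le_eqVlt; apply/orP; left; apply/eqP; ring.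
Qed.

Let Ha u : R := H u `^ alpha.

Let Ha0 u : 0 <= Ha u. Proof. exact: powR_ge0. Qed.

Let avHa i : N i `^ alpha <= av i Ha.
Proof.
rewrite -[leLHS](cexp_cst (e12 e1 e2 (l1 i) (l2 i)) _ (base i)).
apply: cexp_le => v /eqP vi; apply: ge0_ler_powR (NH vi); rewrite ?nnegrE//.
exact: ltW.
Qed.

Definition low_c6 : R := smax_cst p * cH.

Let low_c60 : 0 <= low_c6. Proof. by apply: mulr_ge0 => //; exact: smax_cst_ge0. Qed.

Let sum_smax_Ha : 1 < p -> \sum_u smax Ha u `^ p <= low_c6 * E.
Proof.
move=> p1; apply: le_trans (smax_Ls bif Ha p1) _; rewrite /low_c6 -mulrA ler_wpM2l ?smax_cst_ge0//.
apply: le_trans sumH; rewrite le_eqVlt; apply/orP; left; apply/eqP.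
apply: eq_bigr => u _; rewrite ger0_norm// /Ha -powRrM; congr (_ `^ _).
by rewrite /alpha divfK// gt_eqF.
Qed.

(** The average of [Ha] over a rectangle is at least [N i ^ alpha], so every rectangle is good and
    one test function serves all weights [mu]; [p > 1] gives the bound for its maximal function. *)
Lemma lower_gt1_le2 : 1 < p -> q <= 2 ->
  paraproduct_bounded n e1 e2 l1 l2 base p q w A ->
  E <= low_cst 1 low_c6 * A `^ r.
Proof.
move=> p1 q2 bnd.
apply: (@lower_core 1 low_c6 (smax Ha) predT (fun i => av i Ha)) => //.
- by move=> u; exact: smax_ge0.
- exact: sum_smax_Ha.
- by move=> i _ _; rewrite mul1r.
- move=> i u _ _ iu; rewrite mul1r; apply: le_trans (avHa i) _.
  by rewrite -[leLHS]ger0_norm ?rect_avg_ge0// rect_avg_smax.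
- by rewrite big_pred0// mulr_ge0.
- by move=> mu mu0; exists Ha.
Qed.

Definition low_cst2 : R := (cY * (low_c6 `^ (2 / p) * cH `^ (1 - 2 / q))) `^ (2 / r)^-1.

(** For [q > 2] the linearization by [(S * F) ^ (q - 2)] goes in the wrong direction. Instead [Y] is
    bounded by the sum of [W * H ^ (r - 2 * (r / q))], whose exponent is now nonnegative, and
    Hoelder separates [W] from [H]. *)
Lemma lower_gt2 : 1 < p -> 2 < q ->
  paraproduct_bounded n e1 e2 l1 l2 base p q w A ->
  E <= low_cst2 * A `^ r.
Proof.
move=> p1 q2 bnd.
have cY0' : 0 < cY by apply: lt_le_trans cY0.
have rq : 0 <= r - 2 * (r / q).
  rewrite -alphaq -mulrA mulfV ?gt_eqF// mulr1 mulrC -mulrBl mulr_ge0 ?subr_ge0 ?ltW//.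
  by rewrite ltr_wpDl// ltW.
have rqE : r / q = 1 + alpha by rewrite -alphaq mulfK ?gt_eqF.
set W := sq (fun i => w i * av i Ha ^+ 2).
have W0 u : 0 <= W u by apply: sqfun_ge0 => i; rewrite mulr_ge0 ?sqr_ge0.
have YW : Y <= \sum_u W u * H u `^ (r - 2 * (r / q)).
  rewrite sum_sqfunM; apply: ler_sum => i _.
  have := w0 i; rewrite le_eqVlt => /orP[/eqP<-|wi]; first by rewrite !mul0r.
  have Np := N_gt0 wi.
  rewrite -mulrA ler_pM2l//.
  have -> : N i `^ (r - 2) = (N i `^ alpha) ^+ 2 * N i `^ (r - 2 * (r / q)).
    rewrite powR_sqr ?(ltW Np)// -powRD ?(gt_eqF Np) ?implybT//; congr (_ `^ _).
    by rewrite rqE; ring.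
  apply: ler_pM; rewrite ?sqr_ge0 ?powR_ge0//.
    by rewrite ler_sqr ?nnegrE ?powR_ge0 ?rect_avg_ge0// avHa.
  rewrite -[leLHS](cexp_cst (e12 e1 e2 (l1 i) (l2 i)) _ (base i)).
  by apply: cexp_le => v /eqP vi; apply: ge0_ler_powR (NH vi); rewrite ?nnegrE.
have q21 : 0 < 2 / q < 1 by rewrite divr_gt0//= ltr_pdivrMr// mul1r.
have sm0 : 0 <= \sum_u smax Ha u `^ p by apply: sumr_ge0 => u _; exact: powR_ge0.
have sW0 : 0 <= \sum_u W u `^ (q / 2) by apply: sumr_ge0 => u _; exact: powR_ge0.
have sH0 : 0 <= \sum_u H u `^ r by apply: sumr_ge0 => u _; exact: powR_ge0.
have WH : \sum_u W u * H u `^ (r - 2 * (r / q)) <=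
    (\sum_u W u `^ (q / 2)) `^ (2 / q) * (\sum_u H u `^ r) `^ (1 - 2 / q).
  apply: le_trans (sum_holder q21 (fun u => powR_ge0 (W u) (q / 2)) (fun u => powR_ge0 (H u) r)).
  rewrite le_eqVlt; apply/orP; left; apply/eqP; apply: eq_bigr => u _.
  rewrite -!powRrM (_ : q / 2 * (2 / q) = 1) ?powRr1//; last by field; rewrite gt_eqF.
  by congr (_ * _ `^ _); field; rewrite gt_eqF.
have A1 : (\sum_u W u `^ (q / 2)) `^ (2 / q) <= A ^+ 2 * (low_c6 * E) `^ (2 / p).
  have qq : 0 <= 2 / q by case/andP: q21 => /ltW.
  apply: (@le_trans _ _ (((A * (\sum_u smax Ha u `^ p) `^ p^-1) `^ q) `^ (2 / q))).
    by apply: ge0_ler_powR (bnd Ha); rewrite ?nnegrE ?powR_ge0.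
  rewrite -powRrM (_ : q * (2 / q) = 2%:R); last by field; rewrite gt_eqF.
  rewrite powR_mulrn ?mulr_ge0 ?powR_ge0// exprMn ler_wpM2l ?sqr_ge0//.
  rewrite powR_sqr// (_ : 2 * p^-1 = 2 / p)//.
  apply: ge0_ler_powR (sum_smax_Ha p1); rewrite ?nnegrE ?(mulr_ge0 low_c60 E0)//.
  by rewrite divr_ge0 ?(ltW p0).
have A2 : (\sum_u H u `^ r) `^ (1 - 2 / q) <= (cH * E) `^ (1 - 2 / q).
  apply: ge0_ler_powR sumH; rewrite ?nnegrE ?(mulr_ge0 cH0 E0)//.
  by rewrite subr_ge0; case/andP: q21 => _ /ltW.
have key : E <= cY * (low_c6 `^ (2 / p) * cH `^ (1 - 2 / q)) * ((A `^ r) `^ (2 / r) * E `^ (1 - 2 / r)).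
  apply: le_trans EY _; rewrite -mulrA ler_pM2l//.
  apply: le_trans (le_trans YW WH) _.
  apply: le_trans (ler_pM (powR_ge0 _ _) (powR_ge0 _ _) A1 A2) _.
  rewrite (powRM _ low_c60 E0) (powRM _ cH0 E0) -(powRrM A) (_ : r * (2 / r) = 2%:R); last first.
    by field; rewrite gt_eqF.
  rewrite powR_mulrn//.
  have -> : E `^ (1 - 2 / r) = E `^ (2 / p) * E `^ (1 - 2 / q).
    rewrite -powR_mul_sum; [|by rewrite divr_gt0|by rewrite subr_gt0; case/andP: q21].
    congr (_ `^ _); rewrite pqr; ring.
  rewrite le_eqVlt; apply/orP; left; apply/eqP; ring.
apply: powR_absorb key => //; last exact: powR_ge0.
  have r2 : 2 < r by apply: lt_trans q2 _; rewrite -alphaq ltr_pMl// ltrDl.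
  by rewrite divr_gt0//= ler_pdivrMr// mul1r ltW.
by rewrite mulr_ge0 ?(ltW cY0')// mulr_ge0 ?powR_ge0.
Qed.

(** Small enough for the rectangles with a large error to carry at most [Y / 4]; [2 ^ r] stems from
    [D = 1 / 2] in [bad_rect_sum], and the added 2 ensures [low_eps < 1]. *)
Definition low_eps : R :=
  (32 * lam ^+ 2 * 2 `^ r * ((4 * (16 * 28)) * (geo r * cH) * cY) + 2)^-1.
Definition low_c3 : R := (16 * 58) `^ (p / 2) * (16 * low_eps ^- 4) `^ (1 - p / 2) * (geo r * cH).
(** The average of the localized indicator over a good rectangle is at least 1/2, and the level is
    at least half of [N i]. *)
Definition low_c0 : R := 2^-1 * 2^-1 `^ alpha.

Lemma lower_le1 : p <= 1 ->
  paraproduct_bounded n e1 e2 l1 l2 base p q w A ->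
  E <= low_cst low_c0 low_c3 * A `^ r.
Proof.
move=> p1 bnd.
have cY0' : 0 < cY by apply: lt_le_trans cY0.
have q1 : q <= 1.
  apply: le_trans p1; rewrite -lef_pV2 ?posrE// pqr lerDl invr_ge0 ltW//.
have g1 := geo_gt1 r0; have g0 : 0 < geo r by apply: lt_trans g1.
have gH0 : 0 <= geo r * cH by rewrite mulr_ge0// ltW.
have den0 : 0 <= 32 * lam ^+ 2 * 2 `^ r * ((4 * (16 * 28)) * (geo r * cH) * cY).
  apply: mulr_ge0.
    by apply: mulr_ge0; [apply: mulr_ge0; [exact: ler0n|exact: sqr_ge0]|exact: powR_ge0].
  by apply: mulr_ge0; [apply: mulr_ge0 => //; rewrite !mulr_ge0|exact: ltW].
have eps01 : 0 < low_eps < 1.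
  rewrite /low_eps invr_gt0 invf_lt1; last by rewrite ltr_wpDl.
  by rewrite ltr_wpDl//= ltr_wpDl// ltr1n.
have /andP[eps0 _] := eps01.
(* Starting the dyadic levels at a positive lower bound of all relevant [N i] leaves finitely many
   of them, numbered by naturals. *)
pose d := \big[Num.min/1]_(i | 0 < w i) N i.
have d0 : 0 < d.
  rewrite /d; elim/big_ind: _ => [|x y x0 y0|i wi]; [exact: ltr01|by rewrite lt_min x0|exact: N_gt0].
have dN i : 0 < w i -> d <= N i by move=> wi; apply: bigmin_le_cond.
pose th j := d * 2 ^+ j.
have th0 j : 0 < th j by rewrite mulr_gt0 ?exprn_gt0.
have exlev i : exists j, 0 < w i -> th j <= N i < th j.+1.
  have := w0 i; rewrite le_eqVlt => /orP[/eqP wi|wi]; first by exists 0%N; rewrite -wi ltxx.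
  have : 1 <= N i / d by rewrite ler_pdivlMr// mul1r dN.
  move=> /dyadic_level[j]; rewrite ler_pdivlMr// ltr_pdivrMr// => h.
  by exists j => _; rewrite /th ![d * _]mulrC.
have [lev levP] := choice exlev.
pose M := (\max_i lev i).+1.
have levM i : (lev i < M)%N by rewrite ltnS; exact: leq_bigmax.
pose Om j : pred X := fun u => th j <= H u.
pose f j := test_fun n e1 e2 (Om j) low_eps.
pose err j u := (Om j u)%:R - f j u.
have sumOm : \sum_(j < M) th j `^ r * #|Om j|%:R <= geo r * cH * E.
  rewrite -mulrA; apply: le_trans (ler_wpM2l (ltW g0) sumH).
  under eq_bigr do rewrite -(sum_ind R) mulr_sumr.
  rewrite exchange_big mulr_sumr /=; apply: ler_sum => u _.
  apply: le_trans (geometric_levels M d0 r0 (H0 u)).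
  apply: ler_sum => j _; rewrite /Om /th; case: ifP; by rewrite ?mulr1 ?mulr0.
(* A rectangle lies in the superlevel set of its own level, as [N i <= H] on it; hence the indicator
   averages to 1 there and only the error has to be controlled. *)
pose good : pred G := fun i => `|av i (err (lev i))| <= 2^-1.
pose F u := \sum_(j < M) th j `^ alpha * smax (f j) u.
pose b i := th (lev i) `^ alpha * av i (f (lev i)).
have term0 j u : 0 <= th j `^ alpha * smax (f j) u by rewrite mulr_ge0 ?powR_ge0 ?smax_ge0.
have good_av i : good i -> 0 < w i -> 2^-1 <= av i (f (lev i)).
  move=> gi wi; have avE : av i (err (lev i)) = 1 - av i (f (lev i)).
    rewrite /err /rect_avg cexpB; congr (_ - _).
    rewrite -[RHS](cexp_cst (e12 e1 e2 (l1 i) (l2 i)) 1 (base i)).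
    apply: eq_cexp => v vi; rewrite /Om (le_trans _ (@NH i v _))//.
      by case/andP: (levP i wi).
    by rewrite /in_rect vi.
  by move: gi; rewrite /good avE ler_norml => /andP[_]; lra.
have bN i : good i -> 0 < w i -> low_c0 * N i `^ alpha <= b i.
  move=> gi wi; have /andP[lo hi] := levP i wi.
  have -> : low_c0 * N i `^ alpha = (2^-1 `^ alpha * N i `^ alpha) * 2^-1.
    by rewrite /low_c0; ring.
  rewrite /b; apply: ler_pM; rewrite ?invr_ge0//; first by rewrite mulr_ge0 ?powR_ge0.
    rewrite -powRM ?invr_ge0//.
    apply: ge0_ler_powR; rewrite ?nnegrE ?(ltW alpha0) ?(ltW (th0 _))//.
      by rewrite mulr_ge0 ?invr_ge0.
    rewrite ler_pdivrMl//; apply: le_trans (ltW hi) _.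
    by rewrite /th exprS mulrCA.
  exact: good_av.
apply: (@lower_core low_c0 low_c3 F good b) => //.
- by apply: le_trans q1 _; rewrite ler1n.
- by rewrite /low_c0 mulr_gt0 ?invr_gt0// powR_gt0 ?invr_gt0.
- by rewrite mulr_ge0// mulr_ge0 ?powR_ge0.
- by move=> u; apply: sumr_ge0.
- have p01 : 0 < p <= 1 by rewrite p0.
  apply: (@le_trans _ _ (\sum_u \sum_(j < M) (th j `^ alpha * smax (f j) u) `^ p)).
    by apply: ler_sum => u _; exact: (@powR_sum_subadd _ p M (fun j => th j `^ alpha * smax (f j) u)).
  rewrite exchange_big/= /low_c3 -[leRHS]mulrA.
  set K := (16 * 58) `^ (p / 2) * (16 * low_eps ^- 4) `^ (1 - p / 2).
  have K0 : 0 <= K by apply: mulr_ge0; exact: powR_ge0.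
  apply: le_trans (ler_wpM2l K0 sumOm); rewrite mulr_sumr; apply: ler_sum => j _.
  have -> : \sum_u (th j `^ alpha * smax (f j) u) `^ p = th j `^ r * \sum_u smax (f j) u `^ p.
    rewrite mulr_sumr; apply: eq_bigr => u _; rewrite powRM ?powR_ge0 ?smax_ge0//.
    by rewrite -powRrM /alpha divfK// gt_eqF.
  rewrite [leRHS]mulrCA ler_pM2l ?powR_gt0//.
  by apply: sum_smax_test_fun => //; rewrite p0/=; apply: le_lt_trans p1 _; rewrite ltr1n.
- move=> i u gi wi iu; apply: le_trans (bN i gi wi) _.
  rewrite /F (bigD1 (Ordinal (levM i)))//= -[leLHS]addr0 lerD ?sumr_ge0//.
  rewrite /b ler_pM2l ?powR_gt0//.
  by apply: le_trans (ler_norm _) _; exact: rect_avg_smax.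
(* On a rectangle that is not good, [2 * smax (err (lev i)) >= 1], so that [Phi] is at least the
   level, which exceeds [N i / 2], everywhere on it. *)
- pose Phi u := (\sum_(j < M) th j `^ r * (4 * smax (err j) u ^+ 2)) `^ r^-1.
  have tm0 j u : 0 <= th j `^ r * (4 * smax (err j) u ^+ 2).
    by rewrite mulr_ge0 ?powR_ge0// mulr_ge0 ?sqr_ge0.
  have Phi0 u : 0 <= Phi u by exact: powR_ge0.
  have h2 : 0 < 2^-1 :> R by [].
  apply: le_trans (bad_rect_sum h2 Phi0 (bad := fun i => ~~ good i) _) _.
    move=> i; rewrite /good -ltNge => bi wi.
    rewrite (_ : av i _ = 1); first by rewrite invf_le1// ler1n.
    rewrite -[RHS](cexp_cst (e12 e1 e2 (l1 i) (l2 i)) 1 (base i)).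
    apply: eq_cexp => v /eqP vi; have /andP[lo hi] := levP i wi.
    suff -> : 2^-1 * N i < Phi v by [].
    apply: (@lt_le_trans _ _ (th (lev i))).
      by rewrite ltr_pdivrMl// (lt_le_trans hi)// /th exprS mulrCA.
    rewrite -[leLHS](@powR_powRVK _ _ r) ?gt_eqF// ?(ltW (th0 _))//.
    apply: ge0_ler_powR; rewrite ?nnegrE ?invr_ge0 ?powR_ge0 ?(ltW r0)//; first by rewrite sumr_ge0.
    rewrite (bigD1 (Ordinal (levM i)))//= -[leLHS]addr0 lerD ?sumr_ge0//.
    rewrite ler_peMr ?powR_ge0//.
    have sv : 2^-1 <= smax (err (lev i)) v.
      by apply: le_trans (ltW bi) _; exact: rect_avg_smax.
    have : 2^-1 ^+ 2 <= smax (err (lev i)) v ^+ 2 by rewrite ler_sqr ?nnegrE ?smax_ge0.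
    have -> : 2^-1 ^+ 2 = 4^-1 :> R by rewrite exprVn -natrX.
    lra.
  have sumPhi : \sum_u Phi u `^ r <= (4 * (16 * 28)) * low_eps * (geo r * cH * (cY * Y)).
    have -> : \sum_u Phi u `^ r = \sum_(j < M) th j `^ r * (4 * \sum_u smax (err j) u ^+ 2).
      under eq_bigr => u _ do rewrite powRV_powRK ?gt_eqF ?sumr_ge0//.
      rewrite exchange_big; apply: eq_bigr => j _.
      by rewrite -!mulr_sumr.
    apply: (@le_trans _ _ ((4 * (16 * 28)) * low_eps * (geo r * cH * E))); last first.
      by rewrite ler_pM2l ?mulr_gt0// ler_wpM2l.
    apply: (@le_trans _ _ ((4 * (16 * 28)) * low_eps * \sum_(j < M) th j `^ r * #|Om j|%:R)); last first.
      by rewrite ler_pM2l ?mulr_gt0.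
    rewrite mulr_sumr; apply: ler_sum => j _; rewrite [leRHS]mulrCA ler_pM2l ?powR_gt0//.
    have t1 := smax_L2 bif (err j); have t2 := sum_test_err bif (Om j) eps01.
    have -> : (4 * (16 * 28)) * low_eps * #|Om j|%:R = 4 * (16 * (28 * low_eps * #|Om j|%:R)) by ring.
    by rewrite ler_pM2l//; apply: le_trans t1 _; rewrite ler_pM2l.
  rewrite invrK.
  have c8 : 0 <= 8 * lam ^+ 2 * 2 `^ r by rewrite mulr_ge0 ?powR_ge0// mulr_ge0 ?sqr_ge0.
  apply: le_trans (ler_wpM2l c8 sumPhi) _.
  rewrite /low_eps; set a := lam ^+ 2; set a' := 2 `^ r; set g := geo r * cH.
  set den := _ + 2.
  have dp : 0 < den by rewrite /den ltr_wpDl.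
  have -> : 8 * a * a' * ((4 * (16 * 28)) / den * (g * (cY * Y))) =
    4^-1 * Y * ((32 * a * a' * ((4 * (16 * 28)) * g * cY)) / den) by field; rewrite gt_eqF.
  rewrite ler_piMr//; first by rewrite mulr_ge0 ?invr_ge0.
  by rewrite ler_pdivrMr// mul1r /den lerDl.
(* With greedy signs the quadratic form dominates the sum over all levels, from which each rectangle
   retains only its own level. *)
- move=> mu mu0.
  have [s [s1 sQ]] := greedy_signs mu (fun j i => th j `^ alpha * av i (f j)) M.
  pose g u := \sum_(j < M) s j * th j `^ alpha * f j u.
  exists g; split.
    move=> u; apply: le_trans (smax_sum _ _ _ _ _ _) _.
    apply: ler_sum => j _; rewrite smaxZ normrM s1 mul1r ger0_norm ?powR_ge0//.
  have avg i : av i g = \sum_(j < M) s j * (th j `^ alpha * av i (f j)).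
    rewrite /rect_avg cexp_big; apply: eq_bigr => j _.
    by rewrite cexpZ mulrA.
  under [leRHS]eq_bigr do rewrite avg.
  apply: le_trans sQ; rewrite exchange_big/= big_mkcond; apply: ler_sum => i _.
  have t0 j : 0 <= mu i * (th j `^ alpha * av i (f j)) ^+ 2 by rewrite mulr_ge0 ?sqr_ge0.
  case: ifP => _; last by apply: sumr_ge0.
  by rewrite (bigD1 (Ordinal (levM i)))//= lerDl sumr_ge0.
Qed.

End SquareFunctionLower.

Lemma sqfun_lower (R : realType) (p q r : R) : 0 < p -> 0 < q -> 0 < r -> q^-1 = p^-1 + r^-1 ->
  exists2 C : R, 0 <= C & forall (X : finType) (L1 L2 : eqType) n e1 e2
    (G : finType) (l1 l2 : G -> nat) (base : G -> X) (w : G -> R) (A : R),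
  @bifiltration R X L1 L2 n e1 e2 ->
  (forall i, (l1 i <= n)%N) -> (forall i, (l2 i <= n)%N) -> (forall i, 0 <= w i) ->
  0 <= A -> paraproduct_bounded n e1 e2 l1 l2 base p q w A ->
  \sum_u sqfun e1 e2 l1 l2 base w u `^ (r / 2) <= C * A `^ r.
Proof.
move=> p0 q0 r0 pqr.
have [a aE a0] : exists2 a, low_cst p q r 1 (low_c6 p r) = a & 0 <= a.
  by eexists; [reflexivity|exact: powR_ge0].
have [b bE b0] : exists2 b, low_cst2 p q r = b & 0 <= b.
  by eexists; [reflexivity|exact: powR_ge0].
have [c cE c0] : exists2 c, low_cst p q r (low_c0 p r) (low_c3 p r) = c & 0 <= c.
  by eexists; [reflexivity|exact: powR_ge0].
exists (a + b + c); first exact: addr_ge0 (addr_ge0 a0 b0) c0.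
move=> X L1 L2 n e1 e2 G l1 l2 base w A bif l1n l2n w0 A0 bnd.
have -> : \sum_u sqfun e1 e2 l1 l2 base w u `^ (r / 2) =
   \sum_u (sqfun e1 e2 l1 l2 base w u `^ 2^-1) `^ r.
  by apply: eq_bigr => u _; rewrite -powRrM mulrC.
have Ar : 0 <= A `^ r by exact: powR_ge0.
have le x : x <= a + b + c -> x * A `^ r <= (a + b + c) * A `^ r by move=> h; rewrite ler_wpM2r.
have [p1|p1] := leP p 1.
  apply: le_trans (lower_le1 bif l1n l2n w0 p0 q0 r0 pqr A0 (fun=> erefl) (fun=> erefl) (fun=> erefl) (fun=> erefl) p1 bnd) _.
  by rewrite cE; apply: le; rewrite lerDr addr_ge0.
have [q2|q2] := leP q 2.
  apply: le_trans (lower_gt1_le2 bif l1n l2n w0 p0 q0 r0 pqr A0 (fun=> erefl) (fun=> erefl) (fun=> erefl) (fun=> erefl) p1 q2 bnd) _.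
  by rewrite aE; apply: le; rewrite -addrA lerDl addr_ge0.
apply: le_trans (lower_gt2 bif l1n l2n w0 p0 q0 r0 pqr A0 (fun=> erefl) (fun=> erefl) (fun=> erefl) (fun=> erefl) p1 q2 bnd) _.
by rewrite bE; apply: le; rewrite addrAC lerDr addr_ge0.
Qed.

(** * Dyadic rectangles as atoms of a finite product *)

Section ProductFiltration.
Variables (R : realType) (W : finType) (A : eqType) (n : nat) (g : nat -> W -> A).
Hypothesis g_nest : forall i x y, g i.+1 x = g i.+1 y -> g i x = g i y.
Hypothesis g_fine : injective (g n).
Hypothesis g_double : forall i x,
  (#|[pred y | g i y == g i x]| <= 2 * #|[pred y | g i.+1 y == g i.+1 x]|)%N.
Implicit Types (f : W * W -> R) (u v : W * W).

Definition fst_label i u := g i u.1.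
Definition snd_label i u := g i u.2.
Local Notation lab := (e12 fst_label snd_label).

Lemma sum_rect_fiber i j u f : \sum_(v | lab i j v == lab i j u) f v =
  \sum_(x | g i x == g i u.1) \sum_(y | g j y == g j u.2) f (x, y).
Proof. by rewrite pair_big; apply: eq_big => -[x y]. Qed.

Lemma card_rect_fiber i j u : #|[pred v | lab i j v == lab i j u]| =
  (#|[pred x | g i x == g i u.1]| * #|[pred y | g j y == g j u.2]|)%N.
Proof. by rewrite -cardX; apply: eq_card => -[x y]. Qed.

Lemma cexp_rect i j f u : cexp (lab i j) f u =
  cexp (g i) (fun x => cexp (g j) (fun y => f (x, y)) u.2) u.1.
Proof.
rewrite /cexp sum_rect_fiber card_rect_fiber natrM invfM mulrA mulrAC mulr_suml.
by congr (_ / _); rewrite mulr_suml.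
Qed.

(** At the finest level averaging is the identity, so [lab1] and [lab2] average over a single
    coordinate; their commutation is an exchange of two finite sums. *)
Lemma product_bifiltration : bifiltration R n fst_label snd_label.
Proof.
have fin h x : cexp (g n) h x = h x :> R by apply: cexp_id => y z /g_fine->.
have E1 i f u : cexp (lab1 n fst_label snd_label i) f u = cexp (g i) (fun x => f (x, u.2)) u.1.
  by rewrite /lab1 cexp_rect; apply: eq_cexp => x _; rewrite fin.
have E2 i f u : cexp (lab2 n fst_label snd_label i) f u = cexp (g i) (fun y => f (u.1, y)) u.2.
  by rewrite /lab2 cexp_rect fin.
split.
- by move=> i u v; rewrite /lab1 /e12 /fst_label /snd_label => -[/g_nest-> ->].
- by move=> i u v; rewrite /lab2 /e12 /fst_label /snd_label => -[-> /g_nest->].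
- by move=> [x y] [x' y']; rewrite /lab1 /e12 /fst_label /snd_label => -[/g_fine-> /g_fine->].
- by move=> [x y] [x' y']; rewrite /lab2 /e12 /fst_label /snd_label => -[/g_fine-> /g_fine->].
- by move=> i u; rewrite /lab1 !card_rect_fiber mulnA leq_mul2r g_double orbT.
- by move=> i u; rewrite /lab2 !card_rect_fiber mulnCA leq_mul2l g_double orbT.
- move=> i j f u; rewrite E1 cexp_rect; apply: eq_cexp => x _; by rewrite E2.
- move=> i j f u; rewrite E2 cexp_rect.
  rewrite (eq_cexp (g := fun y => cexp (g i) (fun x => f (x, y)) u.1)); last first.
    by move=> y _; rewrite E1.
  by rewrite /cexp -!mulr_suml exchange_big mulrAC.
Qed.

End ProductFiltration.

Section DyadicBlocks.
Variable n : nat.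
Local Notation W := (bool * 'I_(2 ^ n))%type.

(** The boolean is the half-line, never merged because no dyadic interval contains points of both.
    From level [n] on the blocks are single points. *)
Definition block i (w : W) := (w.1, (w.2 %/ 2 ^ (n - i))%N).

Lemma block_nest i x y : block i.+1 x = block i.+1 y -> block i x = block i y.
Proof.
rewrite /block => -[-> h]; congr (_, _).
have [ni|ni] := leqP n i.
  move: h; have -> : (n - i.+1 = 0)%N by apply/eqP; rewrite subn_eq0 leqW.
  by have -> : (n - i = 0)%N by apply/eqP; rewrite subn_eq0.
by rewrite -(subnSK ni) expnSr !divnMA h.
Qed.

Lemma block_fine : injective (block n).
Proof. by move=> [b x] [b' x']; rewrite /block subnn !divn1 => -[-> /val_inj->]. Qed.

Lemma card_block i x : (i <= n)%N -> #|[pred y | block i y == block i x]| = (2 ^ (n - i))%N.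
Proof.
case: x => s x ni.
have d0 : (0 < 2 ^ (n - i))%N by rewrite expn_gt0.
pose c := (x %/ 2 ^ (n - i))%N.
have lt (k : 'I_(2 ^ (n - i))) : (c * 2 ^ (n - i) + k < 2 ^ n)%N.
  have hc : (c < 2 ^ i)%N by rewrite /c ltn_divLR// -expnD subnKC.
  apply: (@leq_trans (c.+1 * 2 ^ (n - i))); first by rewrite mulSnr ltn_add2l.
  by rewrite -[X in (_ <= 2 ^ X)%N](subnKC ni) expnD leq_mul2r hc orbT.
pose h k : W := (s, Ordinal (lt k)).
have hinj : injective h by move=> k k' [/addnI/val_inj].
rewrite -[RHS]card_ord -(card_codom hinj); apply: eq_card => -[s' y].
rewrite !inE /block xpair_eqE /=; apply/andP/codomP => [[/eqP-> /eqP yc]|[k [-> ->]]].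
  exists (Ordinal (ltn_pmod y d0)); rewrite /h; congr (_, _); apply: val_inj => /=.
  by rewrite /c -yc -divn_eq.
by rewrite /= divnMDl// (divn_small (ltn_ord k)) addn0.
Qed.

Lemma block_double i x :
  (#|[pred y | block i y == block i x]| <= 2 * #|[pred y | block i.+1 y == block i.+1 x]|)%N.
Proof.
have [ni|ni] := leqP n i; last by rewrite !card_block// ?(ltnW ni)// -expnS subnSK.
have -> : #|[pred y | block i y == block i x]| = #|[pred y | block i.+1 y == block i.+1 x]|.
  apply: eq_card => y; rewrite !inE /block.
  have -> : (n - i.+1 = 0)%N by apply/eqP; rewrite subn_eq0 leqW.
  by have -> : (n - i = 0)%N by apply/eqP; rewrite subn_eq0.
by rewrite leq_pmull.
Qed.

Lemma dyadic_bifiltration (R : realType) :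
  bifiltration R n (fst_label block) (snd_label block).
Proof. exact: product_bifiltration block_nest block_fine block_double. Qed.

End DyadicBlocks.

Local Open Scope classical_set_scope.
Local Open Scope ring_scope.

Section DyadicIntervals.
Variable R : realType.
Implicit Types (I : dint) (x y : R) (k m : int) (d : nat).

Lemma pow2_gt0 k : 0 < 2%:R ^ k :> R.
Proof. by rewrite exprz_gt0. Qed.

Lemma dint_floor I x : @dint_set R I x <-> Num.floor (x / 2%:R ^ I.1) = I.2.
Proof.
rewrite /dint_set /=; split => [h|/eqP].
  by apply/eqP; rewrite floor_eq ler_pdivlMr ?pow2_gt0// ltr_pdivrMr ?pow2_gt0.
by rewrite floor_eq ler_pdivlMr ?pow2_gt0// ltr_pdivrMr ?pow2_gt0.
Qed.

Lemma floor_div_pow2 d y : Num.floor (y / 2 ^+ d) = (Num.floor y %/ 2 ^+ d)%Z.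
Proof.
have p0 : (0 : int) < 2 ^+ d by rewrite exprn_gt0.
have p0' : (0 : R) < 2 ^+ d by rewrite exprn_gt0.
have pE : (2 ^+ d)%:~R = 2 ^+ d :> R by rewrite rmorphXn.
apply/eqP; rewrite floor_eq ler_pdivlMr// ltr_pdivrMr//.
set a := Num.floor y; set b := (a %/ 2 ^+ d)%Z.
apply/andP; split.
  apply: le_trans (floor_le y); rewrite -pE -intrM ler_int.
  by rewrite [leRHS](divz_eq a (2 ^+ d)) lerDl modz_ge0// gt_eqF.
apply: lt_le_trans (floorD1_gt y) _; rewrite -pE -intrM ler_int -/a.
rewrite lezD1 mulrDl mul1r [ltLHS](divz_eq a (2 ^+ d)) ltrD2l.
exact: ltz_pmod.
Qed.

Lemma dint_coarsen k d m m' x : @dint_set R (k, m) x ->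
  @dint_set R (k + d%:Z, m') x <-> (m %/ 2 ^+ d)%Z = m'.
Proof.
move/dint_floor => /= h; rewrite dint_floor /=.
by rewrite expfzDr ?pnatr_eq0// invfM mulrA -exprnP floor_div_pow2 h.
Qed.

Lemma dint_itv k m :
  @dint_set R (k, m) = `[m%:~R * 2%:R ^ k, (m + 1)%:~R * 2%:R ^ k[%classic.
Proof. by apply/seteqP; split => x /=; rewrite in_itv. Qed.

Lemma measurable_dint I : measurable (@dint_set R I).
Proof. by case: I => k m; rewrite dint_itv; exact: measurable_itv. Qed.

Lemma lebesgue_dint I : lebesgue_measure (@dint_set R I) = (dint_len R I)%:E.
Proof.
case: I => k m; rewrite dint_itv lebesgue_measure_itv /= lte_fin.
rewrite ltr_pM2r ?pow2_gt0// ltr_int ltrDl ltr01 -EFinB -mulrBl intrD addrAC subrr.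
by rewrite add0r mul1r.
Qed.

Lemma dint_len_gt0 I : 0 < dint_len R I.
Proof. exact: pow2_gt0. Qed.

Lemma dint_exists k x : @dint_set R (k, Num.floor (x / 2%:R ^ k)) x.
Proof. exact/dint_floor. Qed.

Lemma int_sub_abs (a b : int) : a <= b -> b = a + (absz (b - a)%R)%:Z.
Proof. by move=> ab; rewrite gez0_abs ?subr_ge0// addrC subrK. Qed.

Variable N : nat.

Definition fine_cell (c : int) : dint := (- N%:Z, c).

(** Level and index of the smallest dyadic interval containing [I] whose length is at least the cell
    side; an interval shorter than a cell is replaced by the cell around it. *)
Definition coarse_lev I : nat := if - N%:Z <= I.1 then absz (I.1 - - N%:Z)%R else 0%N.
Definition coarse_idx I : int :=
  if - N%:Z <= I.1 then I.2 else (I.2 %/ 2 ^+ absz (- N%:Z - I.1)%R)%Z.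

Lemma coarse_dint I x : @dint_set R I x ->
  @dint_set R (- N%:Z + (coarse_lev I)%:Z, coarse_idx I) x.
Proof.
case: I => k m h; rewrite /coarse_lev /coarse_idx /=; case: leP => [kN|kN].
  by rewrite -int_sub_abs.
rewrite addr0 [X in (X, _)](int_sub_abs (ltW kN)).
by apply/(dint_coarsen _ _ h).
Qed.

(** One formula for both regimes: a cell inside a longer [I] is the fraction [2 ^ (- coarse_lev)] of
    it, whereas a shorter [I] lies entirely in one cell, at level 0. *)
Lemma cell_dint c I : lebesgue_measure (@dint_set R (fine_cell c) `&` @dint_set R I) =
  (dint_len R I * (if (c %/ 2 ^+ coarse_lev I)%Z == coarse_idx I
                   then 2 ^- coarse_lev I else 0))%:E.
Proof.
case: I => k m; rewrite /coarse_lev /coarse_idx /=; case: leP => [kN|kN].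
  have kE : k = - N%:Z + (absz (k - - N%:Z)%R)%:Z by exact: int_sub_abs.
  have inI x : @dint_set R (fine_cell c) x ->
      @dint_set R (k, m) x <-> (c %/ 2 ^+ absz (k - - N%:Z)%R)%Z = m.
    by move=> h; rewrite {1}kE (dint_coarsen _ _ h).
  case: eqP => cm.
    rewrite (_ : _ `&` _ = @dint_set R (fine_cell c)); last first.
      by apply/seteqP; split => [x []//|x h]; split => //; apply/inI.
    rewrite lebesgue_dint /dint_len/=.
    have -> : 2%:R ^ k = 2%:R ^ (- N%:Z) * 2 ^+ absz (k - - N%:Z)%R :> R.
      by rewrite [in LHS]kE expfzDr ?pnatr_eq0.
    by rewrite mulfK// expf_neq0// pnatr_eq0.
  rewrite (_ : _ `&` _ = set0) ?measure0 ?mulr0//.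
  by apply/seteqP; split => x // [h1 h2]; apply: cm; apply/inI; first exact: h1.
rewrite expr0 divz1 invr1.
have NE : - N%:Z = k + (absz (- N%:Z - k)%R)%:Z by exact: int_sub_abs (ltW kN).
have inC x : @dint_set R (k, m) x ->
    @dint_set R (fine_cell c) x <-> (m %/ 2 ^+ absz (- N%:Z - k)%R)%Z = c.
  by move=> h; rewrite /fine_cell {1}NE (dint_coarsen _ _ h).
case: eqP => cm.
  rewrite (_ : _ `&` _ = @dint_set R (k, m)) ?lebesgue_dint ?mulr1//.
  by apply/seteqP; split => [x []//|x h]; split => //; apply/inC.
rewrite (_ : _ `&` _ = set0) ?measure0 ?mulr0//.
by apply/seteqP; split => x // [h1 h2]; apply: cm; apply/esym/inC; first exact: h2.
Qed.

End DyadicIntervals.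

Lemma sum_pair (V : nmodType) (A B : finType) (F : A * B -> V) :
  \sum_u F u = \sum_a \sum_b F (a, b).
Proof. by rewrite (pair_bigA _ (fun a b => F (a, b))); apply: eq_bigr => -[]. Qed.

Section Reflection.
Variables (R : realType) (N n : nat).
Local Notation W := (bool * 'I_(2 ^ n))%type.
Local Notation C := (bool * bool * 'I_(2 ^ n))%type.
Implicit Types (psi : W -> R) (c : C) (I : dint).

(* The cells of side [2 ^ (- N)] in [[- 2 ^ (n + 1), 2 ^ (n + 1)) * 2 ^ (- N)] are
   coded by (sign, reflected, position); [reflected] selects the outer half of
   each side, which carries the negative of a translate of the inner half. *)
Definition half_idx (s r : bool) : int := if s then r%:Z else -1 - r%:Z.
Definition cell_idx c : int := half_idx c.1.1 c.1.2 * 2 ^+ n + (c.2 : nat)%:Z.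
Definition fold_cell c : W := (c.1.1, c.2).
Definition cell_sign c : R := (-1) ^+ c.1.2.

Lemma half_idx_inj s r s' r' : half_idx s r = half_idx s' r' -> (s, r) = (s', r').
Proof. by case: s; case: r; case: s'; case: r'. Qed.

Let pos_pow (d : nat) : (0 : int) < 2 ^+ d. Proof. by rewrite exprn_gt0. Qed.

Lemma cell_idx_fine c j : (j <= n)%N ->
  (cell_idx c %/ 2 ^+ j)%Z = half_idx c.1.1 c.1.2 * 2 ^+ (n - j) + (c.2 %/ 2 ^ j)%N%:Z.
Proof.
move=> jn; rewrite /cell_idx.
have -> : (2 : int) ^+ n = 2 ^+ (n - j) * 2 ^+ j by rewrite -exprD subnK.
rewrite mulrA divzMDl ?gt_eqF//; congr (_ + _).
have -> : (2 : int) ^+ j = (2 ^ j)%N%:Z by rewrite -[RHS]natz natrX.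
by rewrite divz_nat.
Qed.

Lemma cell_idx_top c : (cell_idx c %/ 2 ^+ n)%Z = half_idx c.1.1 c.1.2.
Proof. by rewrite cell_idx_fine// subnn expr0 mulr1 divn_small ?addr0. Qed.

Lemma cell_idx_coarse c j : (n < j)%N -> (cell_idx c %/ 2 ^+ j)%Z = if c.1.1 then 0 else -1.
Proof.
move=> nj; have -> : (2 : int) ^+ j = 2 ^+ n * 2 ^+ (j - n) by rewrite -exprD subnKC// ltnW.
rewrite divzMA_ge0 ?(ltW (pos_pow n))// cell_idx_top.
have d1 : (2 : int) <= 2 ^+ (j - n).
  by rewrite -(subnSK nj) exprS ler_peMr// exprn_ege1.
rewrite /half_idx; case: c.1.1.
  apply: divz_small; rewrite abszE gtr0_norm ?pos_pow//.
  by case: c.1.2; rewrite /= ?pos_pow//= (lt_le_trans _ d1).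
have -> : -1 - (c.1.2 : nat)%:Z = -1 * 2 ^+ (j - n) + (2 ^+ (j - n) - 1 - (c.1.2 : nat)%:Z) by ring.
rewrite divzMDl ?gt_eqF// divz_small ?addr0//.
rewrite abszE gtr0_norm ?pos_pow//; apply/andP; split.
  by case: c.1.2 => /=; lia.
by rewrite -addrA gtrDl; case: c.1.2.
Qed.

(** The average over [I] of the one-variable function extended with signs to all cells. *)
Definition refl_sum I psi : R := \sum_c cell_sign c * psi (fold_cell c) *
  (if (cell_idx c %/ 2 ^+ coarse_lev N I)%Z == coarse_idx N I then 2 ^- coarse_lev N I else 0).

(** Beyond level [n] an interval contains both halves of a side or neither, and their contributions
    cancel. Without this, averages over ever larger rectangles would make the maximal function of a
    function of nonzero mean fail to be [p]-integrable for [p <= 1]. *)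
Lemma refl_sum_coarse I psi : (n < coarse_lev N I)%N -> refl_sum I psi = 0.
Proof.
move=> nj; rewrite /refl_sum.
rewrite !sum_pair.
apply: big1 => s _; rewrite big_bool /= -big_split big1// => t _.
by rewrite !cell_idx_coarse// /cell_sign /fold_cell /= expr0 expr1 -mulrDl mulN1r mul1r addNr mul0r.
Qed.

Lemma cell_idx_block c c0 j : (j <= n)%N ->
  (cell_idx c %/ 2 ^+ j == cell_idx c0 %/ 2 ^+ j)%Z =
  (c.1 == c0.1) && (block (n - j) (fold_cell c) == block (n - j) (fold_cell c0)).
Proof.
move=> jn; apply/eqP/andP => [h|[/eqP h1 /eqP]]; last first.
  by rewrite !cell_idx_fine// h1 /block subKn// => -[_ ->].
have ht : half_idx c.1.1 c.1.2 = half_idx c0.1.1 c0.1.2.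
  rewrite -!cell_idx_top.
  have -> : (2 : int) ^+ n = 2 ^+ j * 2 ^+ (n - j) by rewrite -exprD subnKC.
  by rewrite !divzMA_ge0 ?(ltW (pos_pow j))// h.
have e1 : c.1 = c0.1 by rewrite (surjective_pairing c.1) (half_idx_inj ht) -surjective_pairing.
split; first by rewrite e1.
move: h; rewrite !cell_idx_fine// ht => /addrI[] h.
by rewrite /block /fold_cell e1 subKn// h.
Qed.

(** Up to level [n] all cells that contribute lie in one half of one side, where the sign is
    constant. *)
Lemma refl_sum_fine I c0 psi : (coarse_lev N I <= n)%N ->
  (cell_idx c0 %/ 2 ^+ coarse_lev N I)%Z = coarse_idx N I ->
  refl_sum I psi = cell_sign c0 * cexp (block (n - coarse_lev N I)) psi (fold_cell c0).
Proof.
move=> jn h; rewrite /refl_sum -h; set j := coarse_lev N I in jn *.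
have -> : cexp (block (n - j)) psi (fold_cell c0) =
    (\sum_t (if block (n - j) (c0.1.1, t) == block (n - j) (fold_cell c0)
             then psi (c0.1.1, t) else 0)) * 2 ^- j.
  rewrite /cexp card_block ?leq_subr// subKn// natrX; congr (_ / _).
  rewrite big_mkcond sum_pair.
  rewrite (bigD1 c0.1.1)//= [X in _ + X]big1 ?addr0// => s /negPf sc.
  by rewrite big1// => t _; rewrite /block /fold_cell xpair_eqE /= sc.
rewrite mulrA mulr_sumr mulr_suml.
rewrite sum_pair.
rewrite (bigD1 c0.1)//= [X in _ + X]big1 ?addr0 => [|a /negPf ac]; last first.
  by rewrite big1// => t _; rewrite cell_idx_block//= ac mulr0.
apply: eq_bigr => t _; rewrite cell_idx_block//= eqxx /=.
by rewrite /fold_cell /cell_sign /=; case: ifP => _; rewrite ?mulr0 ?mul0r.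
Qed.

Lemma cell_of_point I (x : R) c0 : (coarse_lev N I <= n)%N ->
  (cell_idx c0 %/ 2 ^+ coarse_lev N I)%Z = coarse_idx N I -> dint_set I x ->
  exists c, [/\ dint_set (fine_cell N (cell_idx c)) x, c.1 = c0.1 &
    block (n - coarse_lev N I) (fold_cell c) = block (n - coarse_lev N I) (fold_cell c0)].
Proof.
move=> jn h /(coarse_dint N) xI; set j := coarse_lev N I in jn h xI *.
set a := Num.floor (x / 2%:R ^ (- N%:Z)).
have xa : dint_set (fine_cell N a) x by exact: dint_exists.
have aj : (a %/ 2 ^+ j)%Z = coarse_idx N I by apply/(dint_coarsen _ _ xa).
have an : (a %/ 2 ^+ n)%Z = half_idx c0.1.1 c0.1.2.
  rewrite -cell_idx_top; have -> : (2 : int) ^+ n = 2 ^+ j * 2 ^+ (n - j) by rewrite -exprD subnKC.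
  by rewrite !divzMA_ge0 ?(ltW (pos_pow j))// h aj.
have tl : (absz (a %% 2 ^+ n)%Z < 2 ^ n)%N.
  rewrite -ltz_nat gez0_abs ?modz_ge0 ?gt_eqF//.
  have -> : (2 ^ n)%N%:Z = (2 : int) ^+ n by rewrite -[LHS]natz natrX.
  exact: ltz_pmod.
pose c : C := (c0.1, Ordinal tl).
have ca : cell_idx c = a.
  rewrite /cell_idx /= gez0_abs ?modz_ge0 ?gt_eqF// -an; exact/esym/divz_eq.
exists c; split; rewrite ?ca//.
have /eqP := etrans aj (esym h); rewrite -ca cell_idx_block// => /andP[_ /eqP]; exact.
Qed.

Lemma cell_inj (x : R) c c' : dint_set (fine_cell N (cell_idx c)) x ->
  dint_set (fine_cell N (cell_idx c')) x -> c = c'.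
Proof.
move=> /dint_floor /= h /dint_floor /= h'; have /eqP : cell_idx c = cell_idx c' by rewrite -h -h'.
have := @cell_idx_block c c' 0 (leq0n n); rewrite !expr0 !divz1 subn0 => -> /andP[/eqP c1 /eqP].
move/block_fine => [_ c2]; by rewrite (surjective_pairing c) c1 c2 -surjective_pairing.
Qed.

Lemma refl_sum_cases I : (forall psi, refl_sum I psi = 0) \/
  (exists c0, (coarse_lev N I <= n)%N /\
    (cell_idx c0 %/ 2 ^+ coarse_lev N I)%Z = coarse_idx N I).
Proof.
have [jn|jn] := leqP (coarse_lev N I) n; last by left => psi; exact: refl_sum_coarse.
have [/existsP[c0 /eqP h]|/existsPn none] :=
  boolP [exists c, (cell_idx c %/ 2 ^+ coarse_lev N I)%Z == coarse_idx N I].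
  by right; exists c0.
by left => psi; apply: big1 => c _; rewrite (negPf (none c)) mulr0.
Qed.

End Reflection.

(** The integral is the supremum over simple functions below the integrand, so the inequality
    applies directly to suprema such as [Md f]. *)
Lemma ge0_le_integralT d (T : measurableType d) (R : realType)
    (mu : {measure set T -> \bar R}) (f g : T -> \bar R) :
  (forall x, 0 <= f x)%E -> (forall x, f x <= g x)%E ->
  (\int[mu]_x f x <= \int[mu]_x g x)%E.
Proof.
move=> f0 fg; have g0 x : (0 <= g x)%E by exact: le_trans (f0 x) (fg x).
rewrite !ge0_integralTE//; apply: ereal_sup_le => /= _ [h hf <-].
exists h => // x; exact: le_trans (hf x) (fg x).
Qed.

(** * Transfer to the plane *)

Section CellFunctions.
Context d (T : measurableType d) (R : realType) (mu : {measure set T -> \bar R}).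
Variables (I : finType) (cell : I -> set T) (a : R).
Hypothesis cell_meas : forall i, measurable (cell i).
Hypothesis cell_disj : forall i j x, cell i x -> cell j x -> i = j.
Hypothesis cell_mu : forall i, mu (cell i) = a%:E.
Implicit Types (H : I -> R) (x : T).

Definition cellfun H x : R := \sum_i H i * \1_(cell i) x.

Lemma cellfun_in H i x : cell i x -> cellfun H x = H i.
Proof.
move=> ix; rewrite /cellfun (bigD1 i)//= indicE mem_set// mulr1 big1 ?addr0// => j ji.
rewrite indicE memNset ?mulr0// => jx; by move/eqP: ji; apply; exact: cell_disj jx ix.
Qed.

Lemma cellfun_out H x : (forall i, ~ cell i x) -> cellfun H x = 0.
Proof. by move=> nx; apply: big1 => i _; rewrite indicE memNset ?mulr0. Qed.

Lemma cell_dec x : (exists i, cell i x) \/ (forall i, ~ cell i x).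
Proof. by have [?|/forallNP] := pselect (exists i, cell i x); [left|right]. Qed.

Lemma cellfun_ge0 H x : (forall i, 0 <= H i) -> 0 <= cellfun H x.
Proof. by move=> H0; apply: sumr_ge0 => i _; rewrite mulr_ge0. Qed.

(** Off the cells the value 0 must stay 0, while [0 ^ 0 = 1]; hence [p != 0]. *)
Lemma cellfun_powR H x p : p != 0 -> cellfun H x `^ p = cellfun (fun i => H i `^ p) x.
Proof.
move=> p0; have [[i ix]|nx] := cell_dec x; first by rewrite !(cellfun_in _ ix).
by rewrite !cellfun_out// powR0.
Qed.

Lemma integrable_cell i : mu.-integrable setT (fun x => (\1_(cell i) x : R)%:E).
Proof.
apply/integrableP; split; first by apply/measurable_EFinP; exact: measurable_indic.
under eq_integral do rewrite gee0_abs ?lee_fin//.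
by rewrite integral_indic// setIT cell_mu ltry.
Qed.

Lemma integrable_cellfun H : mu.-integrable setT (EFin \o cellfun H).
Proof.
rewrite (_ : EFin \o _ = fun x => (\sum_i (H i)%:E * (\1_(cell i) x)%:E)%E); last first.
  by apply/funext => x /=; rewrite -sumEFin; apply: eq_bigr => i _; rewrite EFinM.
by apply: integrable_sum => // i _; apply: integrableZl => //; exact: integrable_cell.
Qed.

Lemma integral_cellfun H D : measurable D ->
  (\int[mu]_(x in D) (cellfun H x)%:E = \sum_i (H i)%:E * mu (cell i `&` D))%E.
Proof.
move=> mD.
rewrite (eq_integral (fun x => (\sum_i (H i)%:E * (\1_(cell i) x)%:E)%E)); last first.
  by move=> x _; rewrite -sumEFin; apply: eq_bigr => i _; rewrite EFinM.
have ii i : mu.-integrable D (fun x => (\1_(cell i) x)%:E).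
  by apply: (@integrableS _ _ _ mu setT) => //; exact: integrable_cell.
rewrite integral_sum => //; last by move=> i; exact: integrableZl.
by apply: eq_bigr => i _; rewrite integralZl// integral_indic.
Qed.

Lemma integral_cellfunT H :
  (\int[mu]_x (cellfun H x)%:E = (a * \sum_i H i)%:E)%E.
Proof.
rewrite integral_cellfun// mulr_sumr -sumEFin; apply: eq_bigr => i _.
by rewrite setIT cell_mu -EFinM mulrC.
Qed.

End CellFunctions.

Section PlaneDyadic.
Variable R : realType.
Implicit Types (Q : drect).
Local Notation mu2 := (@leb2 R).

Lemma measurable_drect Q : measurable (@drect_set R Q).
Proof.
have -> : @drect_set R Q = dint_set Q.1 `*` dint_set Q.2 by [].
by apply: measurableX; exact: measurable_dint.
Qed.

Lemma leb2_setX (A B : set R) : measurable A -> measurable B ->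
  mu2 (A `*` B) = (lebesgue_measure A * lebesgue_measure B)%E.
Proof. by move=> mA mB; rewrite /leb2 product_measure1E. Qed.

Lemma leb2_drect Q : mu2 (drect_set Q) = (drect_area R Q)%:E.
Proof.
by rewrite (leb2_setX (@measurable_dint R Q.1) (@measurable_dint R Q.2)) !lebesgue_dint -EFinM.
Qed.

Lemma drect_area_gt0 Q : 0 < drect_area R Q.
Proof. by rewrite mulr_gt0// dint_len_gt0. Qed.

Lemma drectI Q Q' : drect_set Q `&` drect_set Q' =
  (@dint_set R Q.1 `&` dint_set Q'.1) `*` (dint_set Q.2 `&` dint_set Q'.2).
Proof. by apply/seteqP; split => x /= [[? ?] [? ?]]. Qed.

(** An open set is the countable union of the dyadic rectangles it contains, which ties the topology
    of the plane to the product sigma-algebra. *)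
Lemma open_measurable2 (U : set (R * R)) : open U -> measurable U.
Proof.
move=> oU.
have -> : U = \bigcup_(Q : drect) if `[< drect_set Q `<=` U >] then @drect_set R Q else set0.
  apply/seteqP; split => [x Ux|x [Q _]]; last by case: asboolP => // QU; exact: QU.
  have : nbhs x U by exact: open_nbhs_nbhs.
  move=> /nbhs_ballP[e /= e0 eU].
  have [k ke] : exists k : nat, 2 ^- k < e.
    exists (Num.truncn e^-1).+1; rewrite invf_plt ?posrE ?exprn_gt0//.
    apply: lt_trans (truncnS_gt e^-1) _; rewrite -natrX ltr_nat; exact: ltn_expl.
  pose I (y : R) : dint := (- k%:Z, Num.floor (y / 2%:R ^ (- k%:Z))).
  have Iy (y : R) : dint_set (I y) y by exact: dint_exists.
  have small (y z : R) : dint_set (I y) z -> `|y - z| < e.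
    move=> Iz; have := Iy y; move: Iz.
    rewrite dint_itv /= !in_itv /= intrD mulrDl mul1r.
    have -> : 2%:R ^ (- k%:Z) = 2 ^- k :> R by rewrite -exprnN.
    set m := _ * _; move=> /andP[h1 h2] /andP[h3 h4].
    rewrite ltr_norml; apply/andP; split; lra.
  exists (I x.1, I x.2) => //; case: asboolP => [_|[]]; first by split => /=.
  by move=> z [/= z1 z2]; apply: eU; split => /=; exact: small.
apply: countable_bigcupT_measurable => [|Q]; first exact: countableP.
case: ifP => // _; exact: measurable_drect.
Qed.

Lemma compact_measurable2 (K : set (R * R)) : compact K -> measurable K.
Proof.
move=> /compact_closed cK; rewrite -[K]setCK; apply: measurableC.
by apply: open_measurable2; rewrite openC; apply: cK; exact: norm_hausdorff.
Qed.

End PlaneDyadic.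

(* The analysis library has another [davg]. *)
Local Notation davg := Defs.davg.
Local Notation mu2 := [the measure _ _ of @leb2 _].

Lemma lee_poweR (R : realType) (x y : \bar R) (p : R) : 0 <= p -> (0 <= x)%E ->
  (x <= y)%E -> (x `^ p <= y `^ p)%E.
Proof.
move=> p0 x0 xy; apply: gt0_ler_poweR => //; rewrite in_itv /= ?leey ?andbT//.
exact: le_trans xy.
Qed.

Section ReflectedTestFunctions.
Variables (R : realType) (N n : nat).
Local Notation W := (bool * 'I_(2 ^ n))%type.
Local Notation C := (bool * bool * 'I_(2 ^ n))%type.
Local Notation e1 := (fst_label (@block n)).
Local Notation e2 := (snd_label (@block n)).
Implicit Types (V : W * W -> R) (cc : C * C) (Q : drect).

Definition plane_cell cc : drect :=
  (fine_cell N (cell_idx cc.1), fine_cell N (cell_idx cc.2)).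
Definition plane_fold cc : W * W := (fold_cell cc.1, fold_cell cc.2).
Definition plane_cell_area : R := 2%:R ^ (- N%:Z) * 2%:R ^ (- N%:Z).
Local Notation cell := (fun cc => @drect_set R (plane_cell cc)).

Lemma plane_cell_area_gt0 : 0 < plane_cell_area.
Proof. by rewrite mulr_gt0// pow2_gt0. Qed.

Lemma plane_cell_meas cc : measurable (cell cc).
Proof. exact: measurable_drect. Qed.

Lemma plane_cell_inj cc cc' x : cell cc x -> cell cc' x -> cc = cc'.
Proof.
case: cc cc' => [c1 c2] [c1' c2'] [/= h1 h2] [/= h1' h2'].
by rewrite (cell_inj h1 h1') (cell_inj h2 h2').
Qed.

Lemma plane_cell_mu cc : leb2 (cell cc) = plane_cell_area%:E.
Proof. by rewrite leb2_drect. Qed.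

Definition refl_fun V : R * R -> R :=
  cellfun cell (fun cc => cell_sign R cc.1 * cell_sign R cc.2 * V (plane_fold cc)).

Lemma loc_integrable_refl_fun V : loc_integrable (refl_fun V).
Proof.
move=> K /compact_measurable2 mK.
apply: (@integrableS _ _ _ mu2 setT) => //.
exact: (integrable_cellfun (mu := mu2) plane_cell_meas plane_cell_mu).
Qed.

Lemma davg_refl_fun V Q : davg (refl_fun V) Q =
  refl_sum N Q.1 (fun w => refl_sum N Q.2 (fun w' => V (w, w'))).
Proof.
have a0 := drect_area_gt0 R Q.
rewrite /davg /Rintegral (integral_cellfun (mu := mu2) plane_cell_meas plane_cell_mu); last exact: measurable_drect.
pose k (c : C) I : R := if (cell_idx c %/ 2 ^+ coarse_lev N I)%Z == coarse_idx N I
  then 2 ^- coarse_lev N I else 0.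
rewrite (eq_bigr (fun cc => (cell_sign R cc.1 * cell_sign R cc.2 * V (plane_fold cc) *
  ((dint_len R Q.1 * k cc.1 Q.1) * (dint_len R Q.2 * k cc.2 Q.2)))%:E)); last first.
  move=> cc _; rewrite [RHS]EFinM; congr (_ * _)%E.
  rewrite drectI; set A := _ `&` _; set B := _ `&` _.
  have mA : measurable A by apply: measurableI; exact: measurable_dint.
  have mB : measurable B by apply: measurableI; exact: measurable_dint.
  by apply: (etrans (leb2_setX mA mB)); rewrite /A /B /= !cell_dint -EFinM.
rewrite sumEFin /= sum_pair mulr_sumr /refl_sum; apply: eq_bigr => c1 _ /=.
rewrite -!/(k _ _) mulr_sumr mulr_sumr mulr_suml; apply: eq_bigr => c2 _ /=.
rewrite -!/(k _ _) /plane_fold /=.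
set x := V _; rewrite /drect_area in a0 *.
move: (k c1 _) (k c2 _) => k1 k2; field.
by apply/andP; split; rewrite gt_eqF// dint_len_gt0.
Qed.

Lemma cell_sign_norm (c : C) : `|cell_sign R c| = 1.
Proof. by rewrite normrX normrN1 expr1n. Qed.

(** Either the average vanishes, or the rectangle meets only cells folded onto one atom of the
    model, and its average is, up to sign, an average occurring in [smax]. *)
Lemma davg_refl_fun_le V Q x : drect_set Q x ->
  `|davg (refl_fun V) Q| <= cellfun cell (fun cc => smax n e1 e2 V (plane_fold cc)) x.
Proof.
move=> [x1 x2]; rewrite davg_refl_fun.
have c0 : 0 <= cellfun cell (fun cc => smax n e1 e2 V (plane_fold cc)) x.
  by apply: cellfun_ge0 => cc; exact: smax_ge0.
have [z|[a [an ah]]] := refl_sum_cases R N n Q.1; first by rewrite z normr0.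
have [z|[b [bn bh]]] := refl_sum_cases R N n Q.2.
  rewrite (refl_sum_fine _ an ah) (eq_cexp (g := fun=> 0)); last by move=> w _; exact: z.
  by rewrite cexp_cst mulr0 normr0.
rewrite (refl_sum_fine _ an ah).
rewrite (eq_cexp (g := fun w => cell_sign R b *
  cexp (block (n - coarse_lev N Q.2)) (fun w' => V (w, w')) (fold_cell b))); last first.
  by move=> w _; rewrite (refl_sum_fine _ bn bh).
rewrite cexpZ normrM cell_sign_norm mul1r normrM cell_sign_norm mul1r.
have := cexp_rect (@block n) (n - coarse_lev N Q.1) (n - coarse_lev N Q.2) V (fold_cell a, fold_cell b).
move=> /= <-.
have [c [c1 _ c2]] := cell_of_point an ah x1.
have [d [d1 _ d2]] := cell_of_point bn bh x2.
rewrite (@cellfun_in _ _ _ _ _ (@plane_cell_inj) _ (c, d))//.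
apply: le_trans (le_smax e1 e2 V _ (leq_subr (coarse_lev N Q.1) n) (leq_subr (coarse_lev N Q.2) n)).
rewrite (_ : cexp _ V _ = cexp (e12 e1 e2 (n - coarse_lev N Q.1) (n - coarse_lev N Q.2)) V (plane_fold (c, d)))//.
by apply: cexp_label; rewrite /e12 /fst_label /snd_label /= c2 d2.
Qed.

(** Folding is two-to-one in each variable; this is the origin of the factor 4 in the norm of a
    reflected function. *)
Lemma sum_plane_fold (F : W * W -> R) : \sum_cc F (plane_fold cc) = 4 * \sum_u F u.
Proof.
have S1 (G : W -> R) : \sum_c G (fold_cell c) = 2 * \sum_w G w.
  rewrite (sum_pair (fun c : C => _)) (sum_pair (fun c : bool * bool => _)) (sum_pair G) mulr_sumr.
  apply: eq_bigr => s _; rewrite big_bool /= /fold_cell /=.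
  by rewrite mulr_natl mulr2n.
rewrite sum_pair (eq_bigr (fun c => 2 * \sum_w' F (fold_cell c, w'))); last first.
  by move=> c _; rewrite -S1.
rewrite -mulr_sumr (S1 (fun w => \sum_w' F (w, w'))) mulrA -natrM.
by rewrite -sum_pair.
Qed.

Lemma Md_ge0 (f : R * R -> R) x : (0 <= Md f x)%E.
Proof.
pose Q : drect := ((0, Num.floor (x.1 / 2%:R ^ 0)), (0, Num.floor (x.2 / 2%:R ^ 0))).
apply: (@le_trans _ _ (`|davg f Q|)%:E); first by rewrite lee_fin.
by apply: ereal_sup_ubound; exists Q => //; split; exact: dint_exists.
Qed.

Lemma LnormE (f : R * R -> \bar R) p : (forall x, 0 <= f x)%E ->
  Lnorm (@leb2 R) p%:E f = ((\int[mu2]_x (f x `^ p)) `^ p^-1)%E.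
Proof.
move=> f0; rewrite unlock; congr (_ `^ _)%E; apply: eq_integral => x _.
by rewrite gee0_abs.
Qed.

Lemma Hp_norm_refl_fun V p : 0 < p ->
  (Hp_norm p (refl_fun V) <=
   ((4 * plane_cell_area * \sum_u smax n e1 e2 V u `^ p) `^ p^-1)%:E)%E.
Proof.
move=> p0; rewrite /Hp_norm LnormE; last exact: Md_ge0.
rewrite -poweR_EFin.
apply: lee_poweR; first by rewrite invr_ge0 ltW.
  by apply: integral_ge0 => x _; exact: poweR_ge0.
set H := fun cc : C * C => smax n e1 e2 V (plane_fold cc) `^ p.
rewrite (_ : _%:E = \int[mu2]_x (cellfun cell H x)%:E)%E; last first.
  rewrite (integral_cellfunT (mu := mu2) plane_cell_meas plane_cell_mu).
  by rewrite (sum_plane_fold (fun u => smax n e1 e2 V u `^ p)) mulrA (mulrC plane_cell_area).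
apply: ge0_le_integralT => x; first exact: poweR_ge0.
rewrite -(cellfun_powR (@plane_cell_inj) (fun cc => smax n e1 e2 V (plane_fold cc))) ?gt_eqF//.
rewrite -poweR_EFin; apply: lee_poweR; [exact: ltW|exact: Md_ge0|].
apply: ub_ereal_sup => _ [Q xQ <-].
by rewrite lee_fin davg_refl_fun_le.
Qed.

End ReflectedTestFunctions.

Section DyadicCells.
Variables (R : realType) (N n : nat).
Local Notation W := (bool * 'I_(2 ^ n))%type.
Local Notation C := (bool * bool * 'I_(2 ^ n))%type.
Implicit Types (I : dint) (w : W) (c : C) (x : R).

Definition inner_cell w : C := ((w.1, false), w.2).
Definition cell_point w x := dint_set (fine_cell N (cell_idx (inner_cell w))) x.

Lemma fold_inner w : fold_cell (inner_cell w) = w.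
Proof. by case: w. Qed.

(** [I] is a union of unreflected cells, one of which is [c]: there the model sees the coefficients
    without any sign. *)
Definition adapted_cell I (c : C) := [/\ c.1.2 = false, - N%:Z <= I.1, (coarse_lev N I <= n)%N &
  (cell_idx c %/ 2 ^+ coarse_lev N I)%Z = coarse_idx N I].

Lemma adapted_point I c w x : adapted_cell I c -> cell_point w x ->
  dint_set I x <-> block (n - coarse_lev N I) w == block (n - coarse_lev N I) (fold_cell c).
Proof.
move=> [c0 NI jn h] wx.
have IE : I = (- N%:Z + (coarse_lev N I)%:Z, coarse_idx N I).
  rewrite /coarse_lev /coarse_idx NI; case: I NI {jn h} => k m /= NI.
  by rewrite -int_sub_abs.
rewrite [in X in X <-> _]IE (dint_coarsen _ _ wx) -h.
split=> [/eqP|e]; first by rewrite cell_idx_block// fold_inner => /andP[].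
apply/eqP; rewrite cell_idx_block// fold_inner e andbT /=.
by move/eqP: e => -[e _]; rewrite (surjective_pairing c.1) c0 e.
Qed.

Lemma adapted_cover I c x : adapted_cell I c -> dint_set I x -> exists w, cell_point w x.
Proof.
move=> [c0 NI jn h] Ix; have [d [dx d1 _]] := cell_of_point jn h Ix.
exists (d.1.1, d.2); rewrite /cell_point (_ : inner_cell _ = d)//.
by rewrite /inner_cell /= (surjective_pairing d) d1 (surjective_pairing c.1) c0.
Qed.

Lemma adapted_len I c : adapted_cell I c -> dint_len R I = 2%:R ^ (- N%:Z) *
  #|[pred w : W | block (n - coarse_lev N I) w == block (n - coarse_lev N I) (fold_cell c)]|%:R.
Proof.
move=> [c0 NI jn h]; rewrite card_block ?leq_subr// subKn// /dint_len.
have -> : I.1 = - N%:Z + (coarse_lev N I)%:Z.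
  by rewrite /coarse_lev NI; exact: int_sub_abs.
by rewrite expfzDr ?pnatr_eq0// natrX.
Qed.

Lemma adapted_sum I c (psi : W -> R) : adapted_cell I c ->
  refl_sum N I psi = cexp (block (n - coarse_lev N I)) psi (fold_cell c).
Proof.
by move=> [c0 NI jn h]; rewrite (refl_sum_fine _ jn h) /cell_sign c0 expr0 mul1r.
Qed.

End DyadicCells.

Lemma adapted_exists (B : nat) (I : dint) : (absz I.1 <= B)%N -> (absz I.2 <= B)%N ->
  exists c, @adapted_cell B (3 * B) I c.
Proof.
case: I => k m /= kB mB.
have NI : - B%:Z <= k by lia.
have lE : coarse_lev B (k, m) = absz (k + B%:Z)%R by rewrite /coarse_lev NI opprK.
have lB : (coarse_lev B (k, m) <= 2 * B)%N by rewrite lE; lia.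
set j := coarse_lev B (k, m) in lE lB *.
(* The level of [I] above the cells is at most [2 * B] and its index is at most [B < 2 ^ B], so the
   leftmost cell of [I] has an index below [2 ^ (3 * B)] in absolute value. *)
set n := (3 * B)%N.
have jn : (j <= n)%N by rewrite /n; lia.
have p0 : (0 : int) < 2 ^+ n by rewrite exprn_gt0.
have pj : (0 : int) < 2 ^+ j by rewrite exprn_gt0.
set a : int := m * 2 ^+ j.
have an : (absz a < 2 ^ n)%N.
  rewrite /a abszM abszX /=.
  have -> : n = (B + 2 * B)%N by rewrite /n; lia.
  rewrite expnD; apply: (@leq_ltn_trans (B * 2 ^ (2 * B))%N).
    by apply: leq_mul => //; rewrite leq_exp2l.
  by rewrite ltn_pmul2r ?expn_gt0// ltn_expl.
have pE : (2 : int) ^+ n = (2 ^ n)%N%:Z by rewrite -[RHS]natz natrX.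
have ad : (a %/ 2 ^+ n)%Z = half_idx (0 <= a) false.
  rewrite /half_idx; case: (leP 0 a) => a0.
    by apply: divz_small; rewrite pE; lia.
  have -> : a = -1 * 2 ^+ n + (a + 2 ^+ n) by ring.
  rewrite divzMDl ?gt_eqF// divz_small ?addr0//.
  by rewrite pE; lia.
have tl : (absz (a %% 2 ^+ n)%Z < 2 ^ n)%N.
  by rewrite -ltz_nat gez0_abs ?modz_ge0 ?gt_eqF// -pE; exact: ltz_pmod.
exists ((0 <= a, false), Ordinal tl); split => //.
have -> : cell_idx ((0 <= a, false), Ordinal tl) = a.
  rewrite /cell_idx /= gez0_abs ?modz_ge0 ?gt_eqF// -ad; exact/esym/divz_eq.
by rewrite /a mulzK ?gt_eqF// /coarse_idx NI.
Qed.

Section Discretization.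
Variables (R : realType) (N n : nat) (s : seq drect).
Local Notation W := (bool * 'I_(2 ^ n))%type.
Local Notation C := (bool * bool * 'I_(2 ^ n))%type.
Local Notation e1 := (fst_label (@block n)).
Local Notation e2 := (snd_label (@block n)).
Local Notation rect i := (tnth (in_tuple s) i).
Variables (c1 c2 : 'I_(size s) -> C).
Hypothesis ad1 : forall i, adapted_cell N (rect i).1 (c1 i).
Hypothesis ad2 : forall i, adapted_cell N (rect i).2 (c2 i).

Definition rlev1 i := (n - coarse_lev N (rect i).1)%N.
Definition rlev2 i := (n - coarse_lev N (rect i).2)%N.
Definition rbase i : W * W := (fold_cell (c1 i), fold_cell (c2 i)).
Local Notation inr := (in_rect e1 e2 rlev1 rlev2 rbase).
Local Notation area := (plane_cell_area R N).

Definition model_cell (u : W * W) : set (R * R) :=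
  drect_set (plane_cell N (inner_cell u.1, inner_cell u.2)).

Lemma model_cell_inj u v x : model_cell u x -> model_cell v x -> u = v.
Proof.
move=> h h'; have [] := plane_cell_inj h h'.
by case: u v {h h'} => [[? ?] [? ?]] [[? ?] [? ?]] /= -> -> -> ->.
Qed.

Lemma model_cell_meas u : measurable (model_cell u).
Proof. exact: measurable_drect. Qed.

Lemma model_cell_mu u : leb2 (model_cell u) = area%:E.
Proof. by rewrite leb2_drect. Qed.

Lemma model_in_rect i u x : model_cell u x -> drect_set (rect i) x <-> inr i u.
Proof.
move=> [h1 h2]; rewrite /in_rect /e12 /fst_label /snd_label xpair_eqE.
split=> [[/(adapted_point (ad1 i) h1)-> /(adapted_point (ad2 i) h2)->]//|].
by move=> /andP[/(adapted_point (ad1 i) h1) ? /(adapted_point (ad2 i) h2) ?]; split.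
Qed.

Lemma model_cover i x : drect_set (rect i) x -> exists u, model_cell u x.
Proof.
move=> [/(adapted_cover (ad1 i))[w ?] /(adapted_cover (ad2 i))[w' ?]].
by exists (w, w'); split.
Qed.

Lemma model_area i : drect_area R (rect i) = area * rect_size R e1 e2 rlev1 rlev2 rbase i.
Proof.
rewrite /drect_area (adapted_len R (ad1 i)) (adapted_len R (ad2 i)) /rect_size.
rewrite [X in _ = _ * X%:R](_ : _ = #|[pred v | e12 e1 e2 (rlev1 i) (rlev2 i) v == e12 e1 e2 (rlev1 i) (rlev2 i) (rbase i)]|)//.
by rewrite card_rect_fiber natrM mulrACA.
Qed.

Lemma model_davg V i : davg (refl_fun N V) (rect i) =
  rect_avg e1 e2 rlev1 rlev2 rbase i V :> R.
Proof.
rewrite davg_refl_fun (adapted_sum _ (ad1 i)) /rect_avg cexp_rect.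
by apply: eq_cexp => w _; rewrite (adapted_sum _ (ad2 i)).
Qed.

End Discretization.

(** * Exhaustion of countable families *)

Section CountableSums.
Variables (R : realType) (T : countType).
Implicit Types (S : set T) (s t : seq T) (F : T -> R).

Lemma esum_ge_seq S s (a : T -> \bar R) : uniq s -> (forall i, i \in s -> S i) ->
  (\sum_(i <- s) a i <= \esum_(i in S) a i)%E.
Proof.
move=> us sS; apply: esum_ge; exists [set` s]; last by rewrite fsbig_seq.
by split; [exact: finite_seq|move=> i /= /sS].
Qed.

Lemma esum_le_seq S (a : T -> \bar R) M :
  (forall s, uniq s -> (forall i, i \in s -> S i) -> (\sum_(i <- s) a i <= M)%E) ->
  (\esum_(i in S) a i <= M)%E.
Proof.
move=> h; apply: ub_ereal_sup => _ [A [finA AS] <-].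
rewrite fsbig_finite//; apply: h => [|i]; first exact: finmap.fset_uniq.
by rewrite in_fset_set// inE => /AS.
Qed.

Lemma sum_subseq_le F s t : uniq s -> uniq t -> {subset s <= t} -> (forall i, 0 <= F i) ->
  \sum_(i <- s) F i <= \sum_(i <- t) F i.
Proof.
move=> us ut st F0; rewrite [leRHS](bigID (mem s)) /=.
rewrite -[X in _ <= X + _]big_filter.
have -> : \sum_(i <- [seq i <- t | mem s i]) F i = \sum_(i <- s) F i; last by rewrite lerDl sumr_ge0.
apply: perm_big.
apply: uniq_perm => //; first exact: filter_uniq.
by move=> i; rewrite mem_filter; apply/andP/idP => [[]//|si]; split => //; exact: st.
Qed.

Definition trunc n : seq T := pmap pickle_inv (iota 0 n).

Lemma trunc_uniq n : uniq (trunc n).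
Proof. by apply: (pmap_uniq (@pickle_invK T)); exact: iota_uniq. Qed.

Lemma mem_trunc n i : (i \in trunc n) = (pickle i < n)%N.
Proof. by rewrite (can2_mem_pmap (@pickle_invK T) (@pickleK_inv T)) mem_iota. Qed.

Lemma sub_trunc m n : (m <= n)%N -> {subset trunc m <= trunc n}.
Proof. by move=> mn i; rewrite !mem_trunc => /leq_trans; apply. Qed.

Lemma trunc_cofinal s : exists n, {subset s <= trunc n}.
Proof.
elim: s => [|i s [n sn]]; first by exists 0%N.
exists (maxn n (pickle i).+1) => j; rewrite inE mem_trunc leq_max => /orP[/eqP->|/sn].
  by rewrite ltnSn orbT.
by rewrite mem_trunc => ->.
Qed.

End CountableSums.

Arguments trunc {T} n.

Section FiniteSquareFunction.
Variable R : realType.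
Implicit Types (s : seq drect) (c : drect -> R) (x : R * R) (f : R * R -> R) (q : R).

Definition Ssq s c x : R :=
  \sum_(Q <- s) c Q ^+ 2 / drect_area R Q * \1_(drect_set Q) x.

Lemma sqr_area_ge0 c Q : 0 <= c Q ^+ 2 / drect_area R Q.
Proof. by rewrite mulr_ge0 ?sqr_ge0// invr_ge0 ltW// drect_area_gt0. Qed.

Lemma Ssq_ge0 s c x : 0 <= Ssq s c x.
Proof. by apply: sumr_ge0 => Q _; rewrite mulr_ge0// sqr_area_ge0. Qed.

Lemma measurable_Ssq s c : measurable_fun setT (Ssq s c).
Proof.
apply: measurable_sum => Q; apply: measurable_funM; first exact: measurable_cst.
by apply: measurable_indic; exact: measurable_drect.
Qed.

Lemma Ssq_le_esum s c x : uniq s -> ((Ssq s c x)%:E <=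
  \esum_(Q in [set Q | drect_set Q x]) (c Q ^+ 2 / drect_area R Q)%:E)%E.
Proof.
move=> us; rewrite /Ssq.
rewrite (eq_bigr (fun Q => if `[< drect_set Q x >] then c Q ^+ 2 / drect_area R Q else 0)); last first.
  move=> Q _; case: asboolP => h; first by rewrite indicE mem_set ?mulr1.
  by rewrite indicE memNset ?mulr0.
rewrite -big_mkcond -big_filter -sumEFin; apply: esum_ge_seq; first exact: filter_uniq.
by move=> Q; rewrite mem_filter => /andP[/asboolP].
Qed.

Lemma Sd_ge0 c x : (0 <= Sd c x)%E.
Proof. exact: poweR_ge0. Qed.

Lemma Sd_powR c x q : (Sd c x `^ q =
  (\esum_(Q in [set Q | drect_set Q x]) (c Q ^+ 2 / drect_area R Q)%:E) `^ (q / 2))%E.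
Proof. by rewrite /Sd -poweRrM mulrC. Qed.

Lemma Hdot_norm_powR q c : 0 < q -> (Hdot_norm q c `^ q = \int[mu2]_x (Sd c x `^ q))%E.
Proof.
move=> q0; rewrite /Hdot_norm LnormE; last exact: Sd_ge0.
rewrite -poweRrM mulVf ?gt_eqF// poweRe1//.
by apply: integral_ge0 => x _; exact: poweR_ge0.
Qed.

Lemma Hp_norm_powR q f : 0 < q -> (Hp_norm q f `^ q = \int[mu2]_x (Md f x `^ q))%E.
Proof.
move=> q0; rewrite /Hp_norm LnormE; last exact: Md_ge0.
rewrite -poweRrM mulVf ?gt_eqF// poweRe1//.
by apply: integral_ge0 => x _; exact: poweR_ge0.
Qed.

Lemma Hdot_norm_ge q c s : 0 < q -> uniq s ->
  (\int[mu2]_x (Ssq s c x `^ (q / 2))%:E <= Hdot_norm q c `^ q)%E.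
Proof.
move=> q0 us; rewrite Hdot_norm_powR//; apply: ge0_le_integralT => x.
  by rewrite lee_fin powR_ge0.
rewrite Sd_powR -poweR_EFin; apply: lee_poweR; first by rewrite divr_ge0// ltW.
  by rewrite lee_fin Ssq_ge0.
exact: Ssq_le_esum.
Qed.

(** Monotone convergence along the sets [trunc n], which eventually contain any finite set of
    rectangles; thus only finite families have to be discretized. *)
Lemma Hdot_norm_le q c (M : \bar R) : 0 < q ->
  (forall s, uniq s -> \int[mu2]_x (Ssq s c x `^ (q / 2))%:E <= M)%E ->
  (Hdot_norm q c `^ q <= M)%E.
Proof.
move=> q0 h; rewrite Hdot_norm_powR//.
have q20 : 0 < q / 2 by rewrite divr_gt0.
pose G n x := (Ssq (trunc n) c x `^ (q / 2))%:E.
have Gmono x : nondecreasing_seq (G ^~ x).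
  move=> m n mn; rewrite lee_fin ge0_ler_powR ?nnegrE ?Ssq_ge0 ?(ltW q20)//.
  apply: sum_subseq_le; rewrite ?trunc_uniq//; first exact: sub_trunc.
  by move=> Q; rewrite mulr_ge0// sqr_area_ge0.
have Gcvg x : cvgn (G ^~ x) by exact: ereal_nondecreasing_is_cvgn.
have G0 n x : (0 <= G n x)%E by rewrite lee_fin powR_ge0.
have L0 x : (0 <= limn (G ^~ x))%E by apply: lime_ge => //; exact: nearW.
have GL n x : (G n x <= limn (G ^~ x))%E.
  apply: lime_ge => //; near=> m; apply: Gmono; near: m; exact: nbhs_infty_ge.
apply: (@le_trans _ _ (\int[mu2]_x limn (G ^~ x))%E).
  apply: ge0_le_integralT => x; first exact: poweR_ge0.
  have LE : (limn (G ^~ x) = (limn (G ^~ x) `^ (q / 2)^-1) `^ (q / 2))%E.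
    by rewrite -poweRrM mulVf ?gt_eqF// poweRe1.
  rewrite Sd_powR LE; apply: lee_poweR; first exact: ltW.
    by apply: esum_ge0 => Q _; rewrite lee_fin sqr_area_ge0.
  apply: esum_le_seq => s us sx; have [n sn] := trunc_cofinal s.
  apply: (@le_trans _ _ (Ssq (trunc n) c x)%:E).
    rewrite sumEFin lee_fin; apply: (@le_trans _ _ (Ssq s c x)).
      rewrite /Ssq le_eqVlt; apply/orP; left; apply/eqP; apply: eq_big_seq => Q Qs.
      by rewrite indicE mem_set ?mulr1//; exact: sx.
    apply: sum_subseq_le; rewrite ?trunc_uniq// => Q.
    by rewrite mulr_ge0// sqr_area_ge0.
  have -> : (Ssq (trunc n) c x)%:E = (G n x `^ (q / 2)^-1)%E.
    by rewrite /G poweR_EFin -powRrM mulfV ?gt_eqF// powRr1 ?Ssq_ge0.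
  by apply: lee_poweR => //; rewrite invr_ge0 ltW.
rewrite monotone_convergence//; last first.
  move=> n; apply/measurable_EFinP; apply: (measurableT_comp (measurable_powR _)).
  exact: measurable_Ssq.
apply: lime_le; last by apply: nearW => n; apply: h; exact: trunc_uniq.
apply: ereal_nondecreasing_is_cvgn => m n mn; apply: ge0_le_integralT => // x.
exact: Gmono.
Unshelve. all: by end_near. Qed.

End FiniteSquareFunction.

Lemma discretize (s : seq drect) : exists N n (c1 c2 : 'I_(size s) -> bool * bool * 'I_(2 ^ n)),
  (forall i, adapted_cell N (tnth (in_tuple s) i).1 (c1 i)) /\
  (forall i, adapted_cell N (tnth (in_tuple s) i).2 (c2 i)).
Proof.
pose h (Q : drect) := maxn (maxn (absz Q.1.1) (absz Q.1.2)) (maxn (absz Q.2.1) (absz Q.2.2)).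
pose B := (\max_(Q <- s) h Q)%N.
have hB i : (h (tnth (in_tuple s) i) <= B)%N.
  by rewrite /B (big_tnth _ _ s) (leq_bigmax i).
have [c1 h1] := fin_all_exists (fun i => @adapted_exists B (tnth (in_tuple s) i).1
  (leq_trans (leq_trans (leq_maxl _ _) (leq_maxl _ _)) (hB i))
  (leq_trans (leq_trans (leq_maxr _ _) (leq_maxl _ _)) (hB i))).
have [c2 h2] := fin_all_exists (fun i => @adapted_exists B (tnth (in_tuple s) i).2
  (leq_trans (leq_trans (leq_maxl _ _) (leq_maxr _ _)) (hB i))
  (leq_trans (leq_trans (leq_maxr _ _) (leq_maxr _ _)) (hB i))).
by exists B, (3 * B)%N, c1, c2.
Qed.

Lemma poweR_inj_le (R : realType) (x y : \bar R) (t : R) : 0 < t -> (0 <= x)%E -> (0 <= y)%E ->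
  (x `^ t <= y `^ t)%E -> (x <= y)%E.
Proof.
move=> t0 x0 y0 h; rewrite -(poweRe1 x0) -(poweRe1 y0) -(mulfV (lt0r_neq0 t0)) !poweRrM.
by apply: lee_poweR => //; [rewrite invr_ge0 ltW|exact: poweR_ge0].
Qed.

Section OpenCover.
Variable R : realType.
Implicit Types (Q : drect) (l : seq drect) (A B : set R).

Lemma open_setX2 A B : open A -> open B -> open (A `*` B : set (R * R)).
Proof.
move=> oA oB; rewrite (_ : _ `*` _ = fst @^-1` A `&` snd @^-1` B); last by apply/seteqP; split.
apply: openI; apply: open_comp => // x _; [exact: cvg_fst|exact: cvg_snd].
Qed.

(** Extending the interval to the left by its own length doubles it and makes it interior. *)
Lemma dint_open_cover (I : dint) : exists A, [/\ open A, @dint_set R I `<=` A &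
  lebesgue_measure A = (2 * dint_len R I)%:E].
Proof.
case: I => k m; exists `](m - 1)%:~R * 2%:R ^ k, (m + 1)%:~R * 2%:R ^ k[%classic; split.
- exact: itv_open.
- rewrite dint_itv => x /=; rewrite !in_itv /= => /andP[mx ->]; rewrite andbT.
  by apply: lt_le_trans mx; rewrite ltr_pM2r ?pow2_gt0// ltr_int gtrBl.
- rewrite lebesgue_measure_itv /= lte_fin ltr_pM2r ?pow2_gt0// ltr_int.
  rewrite (_ : m - 1 < m + 1); last by rewrite (@lt_trans _ _ m) ?gtrBl ?ltrDl.
  rewrite -EFinB -mulrBl; congr (_ * _)%:E.
  by rewrite -rmorphB /= (_ : m + 1 - (m - 1) = 2)//; ring.
Qed.

Lemma open_cover l : exists Om : set (R * R), [/\ open Om,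
  forall Q, Q \in l -> drect_set Q `<=` Om &
  (leb2 Om <= (\sum_(Q <- l) 4 * drect_area R Q)%:E)%E].
Proof.
elim: l => [|Q l [Om [oOm lOm mOm]]].
  exists set0; split => //.
  have -> : leb2 (set0 : set (R * R)) = 0%E by exact: (measure0 mu2).
  by rewrite big_nil.
have [A [oA QA mA]] := dint_open_cover Q.1; have [B [oB QB mB]] := dint_open_cover Q.2.
have oAB := open_setX2 oA oB.
exists ((A `*` B) `|` Om); split; first exact: openU.
  move=> Q'; rewrite inE => /orP[/eqP-> x [x1 x2]|/lOm Q'O x /Q'O]; last by right.
  by left; split; [exact: QA|exact: QB].
have mAB : (leb2 (A `*` B) <= (4 * drect_area R Q)%:E)%E.
  rewrite leb2_setX; [|exact: open_measurable|exact: open_measurable].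
  by rewrite mA mB -EFinM lee_fin /drect_area mulrACA -natrM.
apply: le_trans (measureU2 mu2 _ _) _; [exact: open_measurable2|exact: open_measurable2|].
by rewrite big_cons EFinD; exact: leeD.
Qed.

End OpenCover.

Section Transfer.
Variables (R : realType) (N n : nat) (s : seq drect).
Local Notation W := (bool * 'I_(2 ^ n))%type.
Local Notation C := (bool * bool * 'I_(2 ^ n))%type.
Local Notation e1 := (fst_label (@block n)).
Local Notation e2 := (snd_label (@block n)).
Local Notation rect i := (tnth (in_tuple s) i).
Variables (c1 c2 : 'I_(size s) -> C).
Hypothesis ad1 : forall i, adapted_cell N (rect i).1 (c1 i).
Hypothesis ad2 : forall i, adapted_cell N (rect i).2 (c2 i).
Local Notation l1 := (@rlev1 N n s).
Local Notation l2 := (@rlev2 N n s).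
Local Notation base := (rbase c1 c2).
Local Notation area := (plane_cell_area R N).
Local Notation mc := (@model_cell R N n).
Local Notation sq := (sqfun e1 e2 l1 l2 base).
Implicit Types (c g : drect -> R) (f : R * R -> R) (x : R * R) (p q r t : R).

Let a0 : 0 < area. Proof. exact: plane_cell_area_gt0. Qed.

(** The area of a rectangle is [area] times its number of cells, so dividing by [area] here makes
    [sqfun] the true squared square function. *)
Definition model_weight c i : R := c (rect i) ^+ 2 / area.

Lemma model_weight_ge0 c i : 0 <= model_weight c i.
Proof. by rewrite /model_weight mulr_ge0 ?sqr_ge0// invr_ge0 ltW. Qed.

Lemma Ssq_model c x : Ssq s c x = cellfun mc (sq (model_weight c)) x.
Proof.
rewrite /Ssq (big_tnth _ _ s); have [[u ux]|nx] := cell_dec mc x.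
  rewrite (cellfun_in (@model_cell_inj R N n) _ ux) /sqfun [RHS]big_mkcond /=.
  apply: eq_bigr => i _; have iu := model_in_rect ad1 ad2 i ux.
  case: ifPn => h; last by rewrite indicE memNset ?mulr0// => /iu; exact/negP.
  rewrite indicE mem_set ?mulr1; last exact/iu.
  by rewrite (model_area R ad1 ad2) invfM mulrA.
rewrite (cellfun_out _ nx) big1// => i _; rewrite indicE memNset ?mulr0//.
by move=> /(model_cover ad1 ad2)[u]; exact: nx.
Qed.

Lemma integral_Ssq c t : t != 0 ->
  (\int[mu2]_x (Ssq s c x `^ t)%:E = (area * \sum_u sq (model_weight c) u `^ t)%:E)%E.
Proof.
move=> t0; under eq_integral do rewrite Ssq_model (cellfun_powR (@model_cell_inj R N n))//.
exact: (integral_cellfunT (mu := mu2) (@model_cell_meas R N n) (@model_cell_mu R N n)).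
Qed.

Definition avg_abs f i : R := `|davg f (rect i)|.

Lemma sum_rect_max_Md f p : 0 < p ->
  ((area * \sum_u rect_max e1 e2 l1 l2 base (avg_abs f) u `^ p)%:E <= Hp_norm p f `^ p)%E.
Proof.
move=> p0; rewrite Hp_norm_powR//.
set H := fun u => rect_max e1 e2 l1 l2 base (avg_abs f) u `^ p.
rewrite (_ : _%:E = \int[mu2]_x (cellfun mc H x)%:E)%E; last first.
  by rewrite (integral_cellfunT (mu := mu2) (@model_cell_meas R N n) (@model_cell_mu R N n)).
apply: ge0_le_integralT => x.
  by rewrite lee_fin cellfun_ge0// => u; exact: powR_ge0.
rewrite -(cellfun_powR (@model_cell_inj R N n) (rect_max e1 e2 l1 l2 base (avg_abs f))) ?gt_eqF//.
rewrite -poweR_EFin.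
have r0 u : 0 <= rect_max e1 e2 l1 l2 base (avg_abs f) u by exact: rect_max_ge0.
apply: lee_poweR; [exact: ltW|by rewrite lee_fin cellfun_ge0|].
have [[u ux]|nx] := cell_dec mc x; last by rewrite cellfun_out// Md_ge0.
rewrite (cellfun_in (@model_cell_inj R N n) _ ux).
rewrite /rect_max; elim/big_ind: _ => [|y z yM zM|i /(model_in_rect ad1 ad2 i ux) ix].
- exact: Md_ge0.
- by rewrite EFin_max ge_max yM.
- by apply: ereal_sup_ubound; exists (rect i).
Qed.

Lemma model_weight_pi g f i :
  model_weight (pi_g g f) i = model_weight g i * avg_abs f i ^+ 2.
Proof. by rewrite /model_weight /pi_g /avg_abs exprMn real_normK ?num_real// mulrAC. Qed.

Lemma sq_pi g f u : sq (model_weight (pi_g g f)) u =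
  sq (fun i => model_weight g i * avg_abs f i ^+ 2) u.
Proof. by apply: eq_bigr => i _; rewrite model_weight_pi. Qed.

Lemma integral_Ssq_holder g f p q r : 0 < p -> 0 < q -> 0 < r -> q^-1 = p^-1 + r^-1 ->
  (Hp_norm p f <= 1)%E -> uniq s ->
  (\int[mu2]_x (Ssq s (pi_g g f) x `^ (q / 2))%:E <= Hdot_norm r g `^ q)%E.
Proof.
move=> p0 q0 r0 pqr f1 us.
have q20 : q / 2 != 0 by rewrite gt_eqF// divr_gt0.
have r20 : r / 2 != 0 by rewrite gt_eqF// divr_gt0.
rewrite integral_Ssq//; under eq_bigr do rewrite sq_pi.
have := Hdot_norm_ge g r0 us; rewrite integral_Ssq// => gr.
have -> : (Hdot_norm r g `^ q = (Hdot_norm r g `^ r) `^ (q / r))%E.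
  by rewrite -poweRrM mulrCA divff ?mulr1// gt_eqF.
apply: le_trans (lee_poweR _ _ gr); last 2 first.
- by rewrite divr_ge0// ltW.
- by rewrite lee_fin (mulr_ge0 (ltW a0))// sumr_ge0// => u _; exact: powR_ge0.
rewrite poweR_EFin lee_fin.
have := sum_rect_max_Md f p0 => fp.
have {}fp : area * \sum_u rect_max e1 e2 l1 l2 base (avg_abs f) u `^ p <= 1.
  rewrite -lee_fin; apply: le_trans fp _; rewrite -[leRHS](poweR1r p).
  by apply: lee_poweR; [exact: ltW|exact: Lnorm_ge0|].
have S0 : 0 <= \sum_u sq (model_weight g) u `^ (r / 2).
  by apply: sumr_ge0 => u _; exact: powR_ge0.
have M0 : 0 <= \sum_u rect_max e1 e2 l1 l2 base (avg_abs f) u `^ p.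
  by apply: sumr_ge0 => u _; exact: powR_ge0.
have H := paraproduct_holder e1 e2 l1 l2 base p0 q0 r0 pqr (model_weight_ge0 g)
  (fun i => normr_ge0 _ : 0 <= avg_abs f i).
apply: (@le_trans _ _ (area * ((\sum_u sq (model_weight g) u `^ (r / 2)) `^ (q / r) *
  (\sum_u rect_max e1 e2 l1 l2 base (avg_abs f) u `^ p) `^ (q / p)))).
  by rewrite ler_wpM2l// ltW.
(* Lebesgue measure is [area] times the counting measure; the relation between the exponents splits
   this factor exactly between the two sums. *)
have aE : area `^ (q / r) * area `^ (q / p) = area.
  rewrite -powRD; last by apply/implyP => _; rewrite gt_eqF.
  by rewrite -mulrDr addrC -pqr mulfV ?gt_eqF// powRr1// ltW.
rewrite -[X in X * _ <= _]aE mulrACA -!powRM ?(ltW a0)//.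
rewrite -[leRHS]mulr1; apply: ler_wpM2l; first exact: powR_ge0.
have -> : 1 = 1 `^ (q / p) :> R by rewrite powR1.
apply: ge0_ler_powR => //; first by rewrite divr_ge0// ltW.
  by rewrite nnegrE mulr_ge0// ltW.
by rewrite nnegrE.
Qed.

Lemma integral_Ssq_carleson g f p K D : 0 < p -> (Hp_norm p f <= 1)%E ->
  \sum_u sq (fun i => model_weight g i * avg_abs f i ^+ 2) u `^ (p / 2) <=
    D * K `^ (p / 2) * \sum_u rect_max e1 e2 l1 l2 base (avg_abs f) u `^ p ->
  0 <= D ->
  (\int[mu2]_x (Ssq s (pi_g g f) x `^ (p / 2))%:E <= (D * K `^ (p / 2))%:E)%E.
Proof.
move=> p0 f1 H D0.
have p20 : p / 2 != 0 by rewrite gt_eqF// divr_gt0.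
rewrite integral_Ssq//; under eq_bigr do rewrite sq_pi.
have fp : area * \sum_u rect_max e1 e2 l1 l2 base (avg_abs f) u `^ p <= 1.
  rewrite -lee_fin; apply: le_trans (sum_rect_max_Md f p0) _; rewrite -[leRHS](poweR1r p).
  by apply: lee_poweR; [exact: ltW|exact: Lnorm_ge0|].
have K0 : 0 <= D * K `^ (p / 2) by rewrite mulr_ge0// powR_ge0.
rewrite lee_fin; apply: (le_trans (ler_wpM2l (ltW a0) H)).
by rewrite mulrCA -[leRHS]mulr1 ler_wpM2l.
Qed.

(** The powers of [area] convert Lebesgue norms into sums over points, on the square-function and on
    the maximal side; the 4 counts the cells folded onto one point. *)
Definition lower_cst p q (A : R) := A * area `^ (- q^-1) * (4 * area) `^ p^-1.

Lemma model_bounded g p q A : 0 < p -> 0 < q -> uniq s -> 0 <= A ->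
  (forall f, loc_integrable f -> (Hp_norm p f <= 1)%E -> (Hdot_norm q (pi_g g f) <= A%:E)%E) ->
  paraproduct_bounded n e1 e2 l1 l2 base p q (model_weight g) (lower_cst p q A).
Proof.
move=> p0 q0 us A0 bnd V.
have q20 : 0 < q / 2 by rewrite divr_gt0.
pose M := \sum_u smax n e1 e2 V u `^ p.
have M0 : 0 <= M by apply: sumr_ge0 => u _; exact: powR_ge0.
have sqavg u : sq (fun i => model_weight g i * rect_avg e1 e2 l1 l2 base i V ^+ 2) u =
    sq (model_weight (pi_g g (refl_fun N V))) u.
  apply: eq_bigr => i _; rewrite model_weight_pi /avg_abs (model_davg ad1 ad2).
  by rewrite real_normK ?num_real.
have L0 : 0 <= lower_cst p q A by rewrite /lower_cst; apply: mulr_ge0 (powR_ge0 _ _); apply: mulr_ge0 (powR_ge0 _ _).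
(* If [M = 0] then [V] cannot be normalized, but all its averages vanish and so does the left
   side. *)
have [M00|Mn0] := eqVneq M 0.
  rewrite -/M M00 powR0 ?invr_eq0 ?gt_eqF// mulr0 powR0 ?gt_eqF//.
  rewrite big1// => u _; rewrite [X in X `^ _]big1 ?powR0 ?gt_eqF// => i iu.
  have sm0 : smax n e1 e2 V u = 0.
    have /eqP := M00; rewrite psumr_eq0; last by move=> v _; exact: powR_ge0.
    by move=> /allP/(_ u (mem_index_enum _)) /=; rewrite powR_eq0 => /andP[/eqP].
  have := @rect_avg_smax R _ _ _ n e1 e2 _ l1 l2 base (fun i => leq_subr _ _)
    (fun i => leq_subr _ _) i V u iu.
  by rewrite sm0 normr_le0 => /eqP->; rewrite expr0n /= mulr0 mul0r.
have Mp : 0 < M by rewrite lt_def Mn0.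
have aM0 : 0 < 4 * area * M by rewrite mulr_gt0// mulr_gt0.
set S := \sum_u _.
(* Normalizes the reflected function to norm at most 1, as required by the definition of the
   operator norm. *)
pose t := (4 * area * M) `^ (- p^-1).
have t0 : 0 < t by exact: powR_gt0.
have tp : t `^ p = (4 * area * M)^-1.
  by rewrite /t -powRrM mulNr mulVf ?gt_eqF// powR_inv1// ltW.
pose Z := (4 * area * M) `^ (p^-1 * q).
have tqZ : t `^ q * Z = 1.
  by rewrite /t /Z -powRrM mulNr powRN mulVf// gt_eqF// powR_gt0.
pose f := refl_fun N (fun u => t * V u).
have f1 : (Hp_norm p f <= 1)%E.
  apply: le_trans (Hp_norm_refl_fun N (fun u => t * V u) p0) _.
  under eq_bigr do rewrite smaxZ (gtr0_norm t0) (powRM _ (ltW t0) (smax_ge0 _ _ _ _ _)) tp.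
  by rewrite -mulr_sumr -/M mulrCA mulVf ?gt_eqF// powR1.
have fS : area * (t `^ q * S) <= A `^ q.
  have := Hdot_norm_ge (pi_g g f) q0 us; rewrite integral_Ssq ?gt_eqF// => h.
  have {}h := le_trans h (lee_poweR (ltW q0) (Lnorm_ge0 _ _ _) (bnd _ (loc_integrable_refl_fun _ _) f1)).
  move: h; rewrite poweR_EFin lee_fin; apply: le_trans; rewrite ler_wpM2l ?(ltW a0)//.
  rewrite /S mulr_sumr le_eqVlt; apply/orP; left; apply/eqP; apply: eq_bigr => u _.
  rewrite sq_pi [X in _ = X `^ _](_ : _ = t ^+ 2 * sq (fun i => model_weight g i * rect_avg e1 e2 l1 l2 base i V ^+ 2) u); last first.
    rewrite -sqfunZ; apply: eq_bigr => i _; rewrite /avg_abs /f (model_davg ad1 ad2) /rect_avg cexpZ.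
    by rewrite real_normK ?num_real// exprMn mulrCA.
  rewrite powRM ?sqr_ge0 ?sqfun_ge0//; last by move=> i; rewrite mulr_ge0 ?model_weight_ge0 ?sqr_ge0.
  by rewrite sqr_powR ?(ltW t0)// [2 * _]mulrC divfK.
have -> : (lower_cst p q A * M `^ p^-1) `^ q = A `^ q * area^-1 * Z.
  rewrite /lower_cst -mulrA -powRM ?(ltW Mp)//; last by rewrite mulr_ge0// ltW.
  rewrite powRM ?powR_ge0//; last by apply: mulr_ge0 (powR_ge0 _ _).
  by rewrite powRM ?powR_ge0// -!powRrM mulNr mulVf ?gt_eqF// powR_inv1 ?ltW//.
have -> : S = area * (t `^ q * S) * area^-1 * Z.
  by rewrite -[LHS]mul1r -tqZ [area * _]mulrC mulfK ?gt_eqF//; ring.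
by rewrite ler_wpM2r ?powR_ge0// ler_wpM2r// invr_ge0 ltW.
Qed.

Lemma area_rect_union (P : pred 'I_(size s)) (Om : set (R * R)) : measurable Om ->
  (forall i, P i -> drect_set (rect i) `<=` Om) ->
  ((area * #|rect_union e1 e2 l1 l2 base P|%:R)%:E <= leb2 Om)%E.
Proof.
move=> mOm PO; set U := rect_union _ _ _ _ _ _.
rewrite -sum1_card natr_sum big_mkcond /=.
pose H (u : W * W) : R := if u \in U then 1 else 0.
rewrite (_ : _%:E = \int[mu2]_x (cellfun mc H x)%:E)%E; last first.
  by rewrite (integral_cellfunT (mu := mu2) (@model_cell_meas R N n) (@model_cell_mu R N n)).
have -> : leb2 Om = (\int[mu2]_x (\1_Om x : R)%:E)%E.
  by rewrite (integral_indic mu2 measurableT mOm) setIT.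
apply: ge0_le_integralT => x; rewrite lee_fin.
  by apply: cellfun_ge0 => u; rewrite /H; case: ifP.
have [[u ux]|nx] := cell_dec mc x; last by rewrite cellfun_out.
rewrite (cellfun_in (@model_cell_inj R N n) _ ux) /H; case: ifPn => // /existsP[i /andP[Pi iu]].
by rewrite indicE mem_set//; apply: (PO i Pi); exact/(model_in_rect ad1 ad2 i ux).
Qed.

Lemma carleson_sum g K (Om : set (R * R)) : measurable Om -> 0 <= K ->
  (forall i, drect_set (rect i) `<=` Om) ->
  carleson e1 e2 l1 l2 base K (model_weight g) ->
  ((\sum_(Q <- s) g Q ^+ 2)%:E <= K%:E * leb2 Om)%E.
Proof.
move=> mOm K0 sO car; have := car predT; rewrite /model_weight -mulr_suml => h.
apply: le_trans (lee_wpmul2l _ (area_rect_union mOm (fun i (_ : predT i) => sO i))); last first.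
  by rewrite lee_fin.
rewrite -EFinM lee_fin mulrCA [leRHS]mulrC -ler_pdivrMr// (big_tnth _ _ s).
exact: h.
Qed.

(** The union of the rectangles is half-open, whereas the norm tests open sets: the cells of the
    union are covered individually, at the cost of the factor 4. *)
Lemma BMO_carleson g K : 0 <= K -> uniq s -> (BMO_norm g <= K%:E)%E ->
  carleson e1 e2 l1 l2 base (4 * K ^+ 2) (model_weight g).
Proof.
move=> K0 us gK P; set U := rect_union _ _ _ _ _ _.
have [/existsP[i0 Pi0]|/existsPn P0] := boolP [exists i, P i]; last first.
  rewrite big_pred0; first by rewrite mulr_ge0// mulr_ge0// sqr_ge0.
  by move=> i; apply: negbTE.
pose l := [seq plane_cell N (inner_cell u.1, inner_cell u.2) | u : W * W <- enum U].
have [Om [oOm lOm mOm]] := open_cover R l.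
have PO i : P i -> drect_set (rect i) `<=` Om.
  move=> Pi x ix; have [u ux] := model_cover ad1 ad2 ix.
  apply: (lOm _ _ _ ux); apply/mapP; exists u => //; rewrite mem_enum.
  by apply/existsP; exists i; rewrite Pi; apply/(model_in_rect ad1 ad2 i ux).
have {}mOm : (leb2 Om <= (4 * area * #|U|%:R)%:E)%E.
  apply: le_trans mOm _; rewrite lee_fin big_map big_enum /= -mulr_sumr.
  by rewrite (eq_bigr (fun=> area))// sumr_const -(mulr_natr area) (mulrA 4).
have Om0 : (0 < leb2 Om)%E.
  apply: lt_le_trans (area_rect_union (open_measurable2 oOm) PO).
  rewrite lte_fin mulr_gt0// ltr0n; apply/card_gt0P; exists (base i0).
  by apply/existsP; exists i0; rewrite Pi0 in_rect_base.
have Omy : (leb2 Om < +oo)%E by apply: le_lt_trans mOm _; exact: ltry.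
have OmE : leb2 Om = (fine (leb2 Om))%:E by rewrite fineK// ge0_fin_numE// ltW.
have fOm0 : 0 < fine (leb2 Om) by rewrite -lte_fin -OmE.
have sE : (\sum_(i | P i) g (rect i) ^+ 2)%:E = (\sum_(Q <- [seq rect i | i <- enum P]) (g Q ^+ 2)%:E)%E.
  by rewrite big_map big_enum sumEFin.
have uP : uniq [seq rect i | i <- enum P].
  by rewrite map_inj_uniq ?enum_uniq//; apply/tuple_uniqP.
have h : ((\sum_(i | P i) g (rect i) ^+ 2)%:E <=
    \esum_(Q in [set Q | drect_set Q `<=` Om]) (g Q ^+ 2)%:E)%E.
  rewrite sE; apply: esum_ge_seq => // Q /mapP[i]; rewrite mem_enum => Pi ->; exact: PO.
have gO : ((((fine (leb2 Om))^-1)%:E *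
    \esum_(Q in [set Q | drect_set Q `<=` Om]) (g Q ^+ 2)%:E) `^ (2%:R^-1) <= K%:E)%E.
  by apply: le_trans gK; apply: ereal_sup_ubound; exists Om.
have S0 : 0 <= \sum_(i | P i) g (rect i) ^+ 2 by apply: sumr_ge0 => i _; exact: sqr_ge0.
have {}gO : ((((fine (leb2 Om))^-1 * \sum_(i | P i) g (rect i) ^+ 2) `^ (2%:R^-1)) <= K).
  rewrite -lee_fin; apply: le_trans gO; rewrite -poweR_EFin; apply: lee_poweR => //.
    by rewrite lee_fin mulr_ge0// invr_ge0 ltW.
  by rewrite EFinM; apply: lee_wpmul2l => //; rewrite lee_fin invr_ge0 ltW.
have {}gO : \sum_(i | P i) g (rect i) ^+ 2 <= K ^+ 2 * fine (leb2 Om).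
  rewrite -ler_pdivrMr// mulrC -[leLHS](powRV_powRK (s := 2)) ?mulr_ge0 ?invr_ge0 ?(ltW fOm0)//.
  by rewrite -powR_mulrn// ge0_ler_powR ?nnegrE ?powR_ge0.
rewrite /model_weight -mulr_suml ler_pdivrMr//; apply: (le_trans gO).
have F : fine (leb2 Om) <= 4 * area * #|U|%:R by rewrite -lee_fin -OmE.
apply: (le_trans (ler_wpM2l (sqr_ge0 K) F)); move: area => b.
by rewrite [leRHS](_ : _ = K ^+ 2 * (4 * b * #|U|%:R))//; ring.
Qed.

End Transfer.

(** * The four inequalities in the plane *)

Section Inequalities.
Variable R : realType.
Implicit Types (g : drect -> R) (p q r : R).

Lemma pi_opnorm_ge0 p q g : 0 < p -> (0 <= pi_opnorm p q g)%E.
Proof.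
move=> p0; pose f : R * R -> R := @refl_fun R 0 0 (fun u => 0 * 0).
apply: (@le_trans _ _ (Hdot_norm q (pi_g g f))); first exact: Lnorm_ge0.
apply: ereal_sup_ubound; exists f => //; split; first exact: loc_integrable_refl_fun.
apply: le_trans (Hp_norm_refl_fun 0 _ p0) _.
under eq_bigr do rewrite (smaxZ _ _ _ 0 (fun=> 0)) normr0 mul0r powR0 ?gt_eqF//.
by rewrite big1// mulr0 powR0 ?invr_eq0 ?gt_eqF// lee_fin.
Qed.

Lemma BMO_norm_ge0 g : (0 <= BMO_norm g)%E.
Proof.
pose Q : drect := ((0, 0), (0, 0)).
have [Om [oOm QOm mOm]] := open_cover R [:: Q].
apply: (@le_trans _ _ ((((fine (leb2 Om))^-1)%:E *
    \esum_(Q in [set Q | drect_set Q `<=` Om]) (g Q ^+ 2)%:E) `^ (2%:R^-1))%E).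
  exact: poweR_ge0.
apply: ereal_sup_ubound; exists Om => //; split => //; split; last first.
  by apply: le_lt_trans mOm _; exact: ltry.
apply: (@lt_le_trans _ _ (leb2 (@drect_set R Q))).
  by rewrite leb2_drect lte_fin drect_area_gt0.
apply: (le_measure mu2); rewrite ?inE.
- exact: measurable_drect.
- exact: open_measurable2.
- by apply: QOm; rewrite inE.
Qed.

Lemma opnorm_le_Hdot p q r g : 0 < p -> 0 < q -> 0 < r -> q^-1 = p^-1 + r^-1 ->
  (pi_opnorm p q g <= Hdot_norm r g)%E.
Proof.
move=> p0 q0 r0 pqr; apply: ub_ereal_sup => _ [f [_ f1] <-].
apply: (poweR_inj_le q0); [exact: Lnorm_ge0|exact: Lnorm_ge0|].
apply: Hdot_norm_le => // s us.
have [N [n [c1 [c2 [h1 h2]]]]] := discretize s.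
exact: (integral_Ssq_holder h1 h2 g p0 q0 r0 pqr f1 us).
Qed.

Lemma opnorm_bound p q g A f : (pi_opnorm p q g <= A)%E -> loc_integrable f ->
  (Hp_norm p f <= 1)%E -> (Hdot_norm q (pi_g g f) <= A)%E.
Proof. by move=> gA lf f1; apply: le_trans gA; apply: ereal_sup_ubound; exists f. Qed.

(** Shows the dependence on the cell size: the area disappears for [p = q], and in (I) its exponent
    [- r^-1] cancels the area in front of the sum of [S ^ r]. *)
Lemma lower_cstE N p q (A : R) :
  lower_cst N p q A = 4 `^ p^-1 * A * plane_cell_area R N `^ (p^-1 - q^-1).
Proof.
rewrite /lower_cst; move: (plane_cell_area R N) (plane_cell_area_gt0 R N) => a a0.
rewrite powRM ?(ltW a0)// powRD; last by apply/implyP => _; rewrite gt_eqF.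
by ring.
Qed.

Lemma Hdot_le_opnorm p q r : 0 < p -> 0 < q -> 0 < r -> q^-1 = p^-1 + r^-1 ->
  exists2 D : R, 0 <= D & forall g A, 0 <= A -> (pi_opnorm p q g <= A%:E)%E ->
    (Hdot_norm r g <= (D * A)%:E)%E.
Proof.
move=> p0 q0 r0 pqr; have [C C0 low] := sqfun_lower p0 q0 r0 pqr.
exists (C `^ r^-1 * 4 `^ p^-1); first by apply: mulr_ge0; exact: powR_ge0.
move=> g A A0 gA.
apply: (poweR_inj_le r0); [exact: Lnorm_ge0|by rewrite lee_fin; do !apply: mulr_ge0 => //; exact: powR_ge0|].
apply: Hdot_norm_le => // s us.
have [N [n [c1 [c2 [h1 h2]]]]] := discretize s.
have bnd := model_bounded h1 h2 p0 q0 us A0 (fun f => opnorm_bound gA).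
rewrite (integral_Ssq h1 h2) ?gt_eqF ?divr_gt0// poweR_EFin lee_fin.
have a0 := plane_cell_area_gt0 R N.
have L0 : 0 <= lower_cst N p q A.
  by rewrite /lower_cst; apply: mulr_ge0 (powR_ge0 _ _); apply: mulr_ge0 (powR_ge0 _ _).
have H := low _ _ _ n _ _ _ _ _ _ _ _ (dyadic_bifiltration n R)
  (fun i => leq_subr _ _) (fun i => leq_subr _ _) (model_weight_ge0 N g) L0 bnd.
apply: (le_trans (ler_wpM2l (ltW a0) H)).
rewrite -mulrA (powRM _ (powR_ge0 _ _)) ?mulr_ge0 ?powR_ge0// -powRrM mulVf ?gt_eqF// powRr1//.
rewrite mulrCA; apply: ler_wpM2l => //.
rewrite lower_cstE; move: (plane_cell_area R N) a0 => a a0.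
rewrite powRM ?powR_ge0//; last by rewrite mulr_ge0 ?powR_ge0.
rewrite pqr opprD addrA subrr add0r -powRrM mulNr mulVf ?gt_eqF// powR_inv1 ?(ltW a0)//.
by rewrite mulrCA mulfV ?gt_eqF// mulr1.
Qed.

Lemma BMO_le_opnorm p : 0 < p -> exists2 D : R, 0 <= D & forall g A, 0 <= A ->
  (pi_opnorm p p g <= A%:E)%E -> (BMO_norm g <= (D * A)%:E)%E.
Proof.
move=> p0; have [C C0 low] := carleson_lower p0.
exists (C `^ 2^-1 * 4 `^ p^-1); first by apply: mulr_ge0; exact: powR_ge0.
move=> g A A0 gA; apply: ub_ereal_sup => _ [Om [oOm [Om0 Omy]] <-].
have OmE : leb2 Om = (fine (leb2 Om))%:E by rewrite fineK// ge0_fin_numE// ltW.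
have fOm0 : 0 < fine (leb2 Om) by rewrite -lte_fin -OmE.
set L := 4 `^ p^-1 * A.
have L0 : 0 <= L by rewrite /L mulr_ge0 ?powR_ge0.
have CL0 : 0 <= C * L ^+ 2 by rewrite mulr_ge0// sqr_ge0.
have H : (\esum_(Q in [set Q | drect_set Q `<=` Om]) ((g Q) ^+ 2)%:E <=
    (C * L ^+ 2 * fine (leb2 Om))%:E)%E.
  apply: esum_le_seq => s us sO; rewrite sumEFin EFinM -OmE.
  have [N [n [c1 [c2 [h1 h2]]]]] := discretize s.
  have bnd := model_bounded h1 h2 p0 p0 us A0 (fun f => opnorm_bound gA).
  have LE : lower_cst N p p A = L by rewrite lower_cstE subrr powRr0 mulr1.
  rewrite LE in bnd.
  apply: (carleson_sum h1 h2 (open_measurable2 oOm) CL0).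
    by move=> i; apply: sO; exact: mem_tnth.
  exact: (low _ _ _ n _ _ _ _ _ _ _ _ (dyadic_bifiltration n R)
    (fun i => leq_subr _ _) (fun i => leq_subr _ _) (model_weight_ge0 N g) L0 bnd).
apply: (@le_trans _ _ ((C * L ^+ 2)%:E `^ 2^-1)%E).
  apply: lee_poweR => //.
    apply: mule_ge0; first by rewrite lee_fin invr_ge0 ltW.
    by apply: esum_ge0 => Q _; rewrite lee_fin sqr_ge0.
  apply: le_trans (lee_wpmul2l _ H) _; first by rewrite lee_fin invr_ge0 ltW.
  by rewrite -EFinM lee_fin mulrCA mulVf ?gt_eqF// mulr1.
rewrite poweR_EFin lee_fin powRM ?sqr_ge0// sqr_powR// mulfV ?pnatr_eq0// powRr1//.
by rewrite /L mulrA.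
Qed.

Lemma opnorm_le_BMO p : 0 < p -> exists2 D : R, 0 <= D & forall g K, 0 <= K ->
  (BMO_norm g <= K%:E)%E -> (pi_opnorm p p g <= (D * K)%:E)%E.
Proof.
move=> p0.
have [D D0 HD] : exists2 D : R, 0 <= D & forall n (G : finType) (l1 l2 : G -> nat) base K w a,
    (forall i, (l1 i <= n)%N) -> (forall i, (l2 i <= n)%N) -> 0 <= K ->
    (forall i, 0 <= w i) -> (forall i, 0 <= a i) ->
    carleson (fst_label (@block n)) (snd_label (@block n)) l1 l2 base K w ->
    \sum_u sqfun (fst_label (@block n)) (snd_label (@block n)) l1 l2 base
      (fun i => w i * a i ^+ 2) u `^ (p / 2) <=
    D * K `^ (p / 2) * \sum_u rect_max (fst_label (@block n)) (snd_label (@block n)) l1 l2 base a u `^ p.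
  have [p2|p2|p2] := ltgtP p 2.
  - exists 1 => // n G l1 l2 base K w a _ _ K0 w0 a0 car; rewrite mul1r.
    by apply: paraproduct_carleson_lt2 => //; rewrite p0.
  - exists (smax_cst (p / (p - 2)) `^ ((1 - 2 / p) * (p / 2))); first exact: powR_ge0.
    move=> n G l1 l2 base K w a l1n l2n K0 w0 a0 car.
    exact: (paraproduct_carleson_gt2 (dyadic_bifiltration n R) l1n l2n p2 K0 w0 a0 car).
  - exists 1 => // n G l1 l2 base K w a _ _ K0 w0 a0 car; rewrite mul1r p2 mulfV ?pnatr_eq0// powRr1//.
    have w1 i : 0 <= w i * a i ^+ 2 by rewrite mulr_ge0 ?sqr_ge0.
    under eq_bigr do rewrite powRr1 ?(sqfun_ge0 _ _ _ _ _ _ w1)//.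
    under [X in _ * X]eq_bigr do rewrite powR_mulrn ?rect_max_ge0//.
    exact: paraproduct_carleson_2.
(* The 2 is the square root of the 4 lost in [BMO_carleson]. *)
exists (D `^ p^-1 * 2); first by rewrite mulr_ge0// powR_ge0.
move=> g K K0 gK; apply: ub_ereal_sup => _ [f [_ f1] <-].
apply: (poweR_inj_le p0); [exact: Lnorm_ge0|by rewrite lee_fin mulr_ge0// mulr_ge0// powR_ge0|].
apply: Hdot_norm_le => // s us.
have [N [n [c1 [c2 [h1 h2]]]]] := discretize s.
have car := BMO_carleson h1 h2 K0 us gK.
have K4 : 0 <= 4 * K ^+ 2 by rewrite mulr_ge0// sqr_ge0.
have := integral_Ssq_carleson h1 h2 p0 f1 (HD _ _ _ _ _ _ _ _ (fun i => leq_subr _ _)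
  (fun i => leq_subr _ _) K4 (model_weight_ge0 N g) (fun i => normr_ge0 _) car) D0.
move/le_trans; apply; rewrite poweR_EFin lee_fin -mulrA powRM ?powR_ge0//; last by rewrite mulr_ge0.
rewrite powRV_powRK ?gt_eqF//; apply: ler_wpM2l => //.
have -> : 4 * K ^+ 2 = (2 * K) ^+ 2 by ring.
by rewrite sqr_powR ?mulr_ge0// [2 * (p / 2)]mulrC divfK.
Qed.

End Inequalities.

(** Passes from finite bounds to extended ones. With [D + 1] the constant is positive, so that an
    infinite [y] gives an infinite right side even for [D = 0]. *)
Lemma lee_cst_mul (R : realType) (D : R) (x y : \bar R) : 0 <= D -> (0 <= y)%E ->
  (forall A, 0 <= A -> (y <= A%:E)%E -> (x <= (D * A)%:E)%E) ->
  (x <= (D + 1)%:E * y)%E.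
Proof.
move=> D0; case: y => [A A0 h|_ _|//].
  rewrite lee_fin in A0; apply: le_trans (h A A0 (lexx _)) _.
  by rewrite -EFinM lee_fin ler_wpM2r// lerDl.
by rewrite gt0_muley ?leey// lte_fin ltr_wpDl.
Qed.

Theorem theorem3p1 (R : realType) :
  (forall p q r : R, 0 < p -> 0 < q -> 0 < r -> q^-1 = p^-1 + r^-1 ->
     exists c C : R, 0 < c /\ 0 < C /\
       forall g : drect -> R,
         (c%:E * Hdot_norm r g <= pi_opnorm p q g)%E /\
         (pi_opnorm p q g <= C%:E * Hdot_norm r g)%E) /\
  (forall p : R, 0 < p ->
     exists c C : R, 0 < c /\ 0 < C /\
       forall g : drect -> R,
         (c%:E * BMO_norm g <= pi_opnorm p p g)%E /\
         (pi_opnorm p p g <= C%:E * BMO_norm g)%E).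
Proof.
split=> [p q r p0 q0 r0 pqr|p p0].
  have [D D0 low] := Hdot_le_opnorm p0 q0 r0 pqr.
  have D1 : 0 < D + 1 by rewrite ltr_wpDl.
  exists (D + 1)^-1, 1; rewrite invr_gt0; split => //; split => // g; split.
    rewrite lee_pdivrMl//; apply: lee_cst_mul => //; first exact: pi_opnorm_ge0.
    by move=> A A0; exact: low.
  by rewrite mul1e; exact: opnorm_le_Hdot.
have [D D0 low] := BMO_le_opnorm p0; have [E E0 up] := opnorm_le_BMO p0.
have D1 : 0 < D + 1 by rewrite ltr_wpDl.
exists (D + 1)^-1, (E + 1); rewrite invr_gt0; split => //; split; first by rewrite ltr_wpDl.
move=> g; split.
  rewrite lee_pdivrMl//; apply: lee_cst_mul => //; first exact: pi_opnorm_ge0.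
  by move=> A A0; exact: low.
apply: lee_cst_mul => //; first exact: BMO_norm_ge0.
by move=> A A0; exact: up.
Qed.
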